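(* Consider the logit model $\log\{\mathbb P(Z_i=\ell)/\mathbb P(Z_i=0)\}=X_{i(\ell)}^T\beta$, $\ell=1,\dots,m-1$, $i=1,\dots,n$, with true coefficient vector $\beta_0\in\mathbb R^d$, and the group-sparse prior $\Pi$ on $\beta\in\mathbb R^d$ described in the context (with constants $A_1,A_2,A_3,A_4>0$). Let $\xi_0=s_0+A_4^{-1}\{4+100/\phi^2(S_0)\}s_0$ and, for $M>0$, $$\mathcal B_2(M)=\Big\{\beta_0\in\mathbb R^d: s_0\sqrt{\max\{\log p,\overline g\log n\}}\;\max_{1\le i\le n}\lVert X_i\rVert_\ast\le M\,\psi_1^2(\xi_0+s_0)\,\phi^2(S_0)\,\lVert X\rVert_\ast\Big\}.$$ Then there exist constants $M_3>0$ and $M_4>0$ such that, as $n\to\infty$, $$\sup_{\beta_0\in\mathcal B_2(M_3)}\mathbb E_0\,\Pi\Big\{\beta:\lVert W^{1/2}X(\beta-\beta_0)\rVert_2>\frac{M_4\sqrt{s_0\max\{\log p,\overline g\log n\}}}{\psi_1(\xi_0+s_0)\,\phi(S_0)}\;\Big|\;Y\Big\}\to0,$$ $$\sup_{\beta_0\in\mathcal B_2(M_3)}\mathbb E_0\,\Pi\Big\{\beta:\lVert\beta-\beta_0\rVert_2>\frac{M_4\sqrt{s_0\max\{\log p,\overline g\log n\}}}{\psi_1(\xi_0+s_0)\,\psi_2(\xi_0+s_0)\,\phi(S_0)\,\lVert X\rVert_\ast}\;\Big|\;Y\Big\}\to0,$$ $$\sup_{\beta_0\in\mathcal B_2(M_3)}\mathbb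 E_0\,\Pi\Big\{\beta:\lVert\beta-\beta_0\rVert_{2,1}>\frac{M_4\,s_0\sqrt{\max\{\log p,\overline g\log n\}}}{\psi_1^2(\xi_0+s_0)\,\phi^2(S_0)\,\lVert X\rVert_\ast}\;\Big|\;Y\Big\}\to0.$$
   Context: Model. $m\ge2$ is a fixed integer (number of categories). For each sample size $n$, $Z_1,\dots,Z_n$ are independent with values in $\{0,1,\dots,m-1\}$; $X_i\in\mathbb R^{(m-1)\times d}$ are deterministic design matrices, $X_{i(\ell)}\in\mathbb R^d$ is the $\ell$th row of $X_i$, and $X=(X_1^T,\dots,X_n^T)^T\in\mathbb R^{n(m-1)\times d}$ ($X\neq0$). The quantities $d$, $p$, the groups and the design may depend on $n$; ''constant'' means independent of $n$. Set $Y_{i\ell}=\mathbf 1(Z_i=\ell)$, $Y_i=(Y_{i1},\dots,Y_{i,m-1})^T$, $Y=(Y_1^T,\dots,Y_n^T)^T\in\mathbb R^{n(m-1)}$. The density of $Y$ w.r.t. counting measure under parameter $\beta$ is $f_\beta^n$, i.e. $f^n_\beta(Y)=\prod_{i=1}^n \exp(Y_i^TX_i\beta)/\{1+\sum_{\ell=1}^{m-1}\exp(X_{i(\ell)}^T\beta)\}$. $\mathbb E_0$ is the expectation under the true parameter $\beta_0$; $\mu=\mathbb E_0Y$ and $W=\mathbb E_0\{(Y-\mu)(Y-\mu)^T\}$ (so $W$ depends on $\beta_0$). Groups and norms. $G_1,\dots,G_p$ is a partition of $\{1,\dots,d\}$ into nonempty sets; $g_j=|G_j|$, $\overline g=\max_j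 g_j$. $\beta_j\in\mathbb R^{g_j}$ is the subvector of $\beta\in\mathbb R^d$ indexed by $G_j$. For a matrix $A$ with $d$ columns, $A_{\cdot j}$ is the submatrix of columns indexed by $G_j$ and $\lVert A\rVert_\ast=\max_{1\le j\le p}\lVert A_{\cdot j}\rVert_{\rm sp}$ with $\lVert\cdot\rVert_{\rm sp}$ the spectral norm (this applies to $A=X$ and to each $A=X_i$). $\lVert\beta\rVert_{2,1}=\sum_{j=1}^p\lVert\beta_j\rVert_2$. For $S\subset\{1,\dots,p\}$: $s=|S|$, $\beta_S=\{\beta_j:j\in S\}$, $\beta_{S^c}=\{\beta_j:j\notin S\}$, $\lVert\beta_S\rVert_{2,1}=\sum_{j\in S}\lVert\beta_j\rVert_2$ (similarly for $S^c$), $d_S=\sum_{j\in S}g_j$. $S_\beta=\{j:\beta_j\ne0\}$, $s_\beta=|S_\beta|$; $S_0=S_{\beta_0}$, $s_0=|S_0|$. Compatibility numbers (for $S\subset\{1,\dots,p\}$ with $s=|S|$ in $\phi(S)$, and a real argument $s$ in $\psi_1,\psi_2$): $$\phi(S)=\inf\Big\{\frac{\lVert W^{1/2}X\beta\rVert_2\sqrt s}{\lVert X\rVert_\ast\lVert\beta\rVert_{2,1}}:\ \lVert\beta_{S^c}\rVert_{2,1}\le7\lVert\beta_S\rVert_{2,1},\ \beta_S\ne0\Big\},$$ $$\psi_1(s)=\inf\Big\{\frac{\lVert W^{1/2}X\beta\rVert_2\sqrt{s_\beta}}{\lVert X\rVert_\ast\lVert\beta\rVert_{2,1}}:1\le s_\beta\le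 s\Big\},\qquad \psi_2(s)=\inf\Big\{\frac{\lVert W^{1/2}X\beta\rVert_2}{\lVert X\rVert_\ast\lVert\beta\rVert_2}:1\le s_\beta\le s\Big\}.$$ Prior. $\Pi$ is the law of $\beta$ under: draw $s\in\{0,\dots,p\}$ from a probability mass function $\pi_p$; given $s$ draw $S\subset\{1,\dots,p\}$ uniformly among subsets of size $s$; given $S$ draw $\beta_S$ from the density $h_S$ on $\mathbb R^{d_S}$ and set $\beta_{S^c}=0$. Here, for fixed constants $A_1,A_2,A_3,A_4>0$, $$\frac{A_1}{\max\{p,n^{\overline g}\}^{A_3}}\le\frac{\pi_p(s)}{\pi_p(s-1)}\le\frac{A_2}{\max\{p,n^{\overline g}\}^{A_4}},\quad s=1,\dots,p,$$ $$h_S(\beta_S)=\Big(\frac{\lambda}{\sqrt\pi}\Big)^{d_S}\frac{\prod_{j\in S}\Gamma(g_j/2)}{2^s\prod_{j\in S}\Gamma(g_j)}e^{-\lambda\lVert\beta_S\rVert_{2,1}},\qquad \lambda=8\lVert X\rVert_\ast\sqrt{\max\{\log p,\overline g\log n\}}.$$ $\Pi(\cdot\mid Y)$ is the posterior: $\Pi(B\mid Y)=\int_B f_\beta^n(Y)\,d\Pi(\beta)/\int_{\mathbb R^d}f^n_\beta(Y)\,d\Pi(\beta)$. *)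

(* Defs.v *)
From HB Require Import structures.
From mathcomp Require Import all_boot all_order all_algebra.
From mathcomp Require Import all_classical all_reals all_analysis.
From mathcomp Require Import measurable_realfun.

Set Implicit Arguments.
Unset Strict Implicit.
Unset Printing Implicit Defensive.

Import Order.TTheory GRing.Theory Num.Theory.
Import numFieldNormedType.Exports.

Local Open Scope classical_set_scope.
Local Open Scope ring_scope.

(* Borel sigma-algebra on column vectors, generated by the coordinates. *)
Definition measure_vec_display : measure_display -> measure_display.
Proof. exact. Qed.

Section measurable_vec.
Context {disp : measure_display} {T : sigmaRingType disp} (k : nat).

Let coord (i : 'I_k) (v : 'cV[T]_k) : T := v i ord0.

Let vec_set0 : g_sigma_preimage coord set0.
Proof. exact: sigma_algebra0. Qed.

Let vec_setC A : g_sigma_preimage coord A -> g_sigma_preimage coord (~` A).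
Proof. exact: sigma_algebraC. Qed.

Let vec_bigcup (F : _^nat) : (forall i, g_sigma_preimage coord (F i)) ->
  g_sigma_preimage coord (\bigcup_i (F i)).
Proof. exact: sigma_algebra_bigcup. Qed.

HB.instance Definition _ := @isMeasurable.Build (measure_vec_display disp)
  'cV[T]_k (g_sigma_preimage coord) vec_set0 vec_setC vec_bigcup.

End measurable_vec.

Lemma measurable_coord disp (T : sigmaRingType disp) k (i : 'I_k) :
  measurable_fun [set: 'cV[T]_k] (fun v => v i ord0).
Proof.
move=> _ Y mY; rewrite setTI; apply: sub_sigma_algebra => /=.
rewrite -bigcup_seq/=; exists i => /=; first by rewrite mem_index_enum.
by exists Y => //; rewrite setTI.
Qed.

Lemma measurable_fun_vecP d1 d2 (T1 : measurableType d1)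
    (T2 : measurableType d2) k (f : T1 -> 'cV[T2]_k) :
  (forall i, measurable_fun [set: T1] (fun x => f x i ord0)) ->
  measurable_fun [set: T1] f.
Proof.
move=> mf; apply: (@measurability _ _ _ _ _ _
  (\big[setU/set0]_(i < k) preimage_set_system setT
     (fun v : 'cV[T2]_k => v i ord0) measurable)) => //.
move=> _ [A + <-]; rewrite -bigcup_seq/= => -[i _ [C mC <-]].
by rewrite setTI; apply: mf.
Qed.

(* Lebesgue measure on R^k, as the k-fold product of the Lebesgue measure
   on R: R^(k+1) carries the image of lebesgue_measure \x vec_lebesgue k under
   (x, v) |-> (x, v_1, ..., v_k). *)
Section vec_lebesgue.
Context {R : realType}.

Definition vec_cons k (xv : R * 'cV[R]_k) : 'cV[R]_k.+1 :=
  \col_i if unlift ord0 i is Some j then xv.2 j ord0 else xv.1.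

Definition vec_uncons k (v : 'cV[R]_k.+1) : R * 'cV[R]_k :=
  (v ord0 ord0, \col_i v (lift ord0 i) ord0).

Lemma vec_consK k : cancel (@vec_cons k) (@vec_uncons k).
Proof.
move=> [x v]; rewrite /vec_uncons /vec_cons; congr pair.
  by rewrite mxE unlift_none.
by apply/colP => i; rewrite !mxE liftK.
Qed.

Lemma measurable_vec_cons k : measurable_fun setT (@vec_cons k).
Proof.
apply: measurable_fun_vecP => i; under eq_fun do rewrite mxE.
case: unliftP => [j _|_]; last exact: measurable_fst.
exact: measurableT_comp (measurable_coord j) measurable_snd.
Qed.

Lemma measurable_vec_uncons k : measurable_fun setT (@vec_uncons k).
Proof.
apply/measurable_fun_pairP; split; first exact: measurable_coord.
apply: measurable_fun_vecP => i /=; under eq_fun do rewrite mxE.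
exact: measurable_coord.
Qed.

Section step.
Variables (k : nat) (mu : {sigma_finite_measure set 'cV[R]_k -> \bar R}).

Definition vec_lebesgueS : set 'cV[R]_k.+1 -> \bar R :=
  pushforward (lebesgue_measure \x mu)%E (@vec_cons k).

HB.instance Definition _ := Measure.copy vec_lebesgueS
  (measure_function_pushforward__canonical__measure_function_Measure
    (lebesgue_measure \x mu)%E (@measurable_vec_cons k)).

Let vec_lebesgueS_sigma_finite : sigma_finite setT vec_lebesgueS.
Proof.
have /sigma_finiteP[F [TF ndF Foo]] := sigma_finiteT (@lebesgue_measure R).
have /sigma_finiteP[G [TG ndG Goo]] := sigma_finiteT mu.
exists (fun i => @vec_uncons k @^-1` (F i `*` G i)).
  rewrite -preimage_bigcup (_ : \bigcup_i _ = setT) ?preimage_setT//.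
  apply/seteqP; split => // -[x v] _.
  have [i _ Fix] : (\bigcup_i F i) x by rewrite -TF.
  have [j _ Gjv] : (\bigcup_i G i) v by rewrite -TG.
  exists (maxn i j) => //; split => /=.
    by move: x Fix; exact/subsetPset/ndF/leq_maxl.
  by move: v Gjv; exact/subsetPset/ndG/leq_maxr.
move=> i; have [? ?] := Foo i; have [? ?] := Goo i; split.
  rewrite -[X in measurable X]setTI.
  by apply: measurable_vec_uncons => //; exact: measurableX.
rewrite /vec_lebesgueS /pushforward -comp_preimage.
rewrite (_ : _ \o _ = id) ?preimage_id//; last first.
  by apply/funext => xv /=; rewrite vec_consK.
by rewrite product_measure1E// lte_mul_pinfty// ge0_fin_numE.
Qed.

HB.instance Definition _ := Measure_isSigmaFinite.Build _ _ _ vec_lebesgueS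
  vec_lebesgueS_sigma_finite.

End step.

Fixpoint vec_lebesgue k : {sigma_finite_measure set 'cV[R]_k -> \bar R} :=
  match k with
  | 0 => @dirac _ 'cV[R]_0 0 R
  | k'.+1 => vec_lebesgueS (vec_lebesgue k')
  end.

Lemma measurable_box k (A : 'I_k -> set R) :
  (forall i, measurable (A i)) ->
  measurable [set v : 'cV[R]_k | forall i, A i (v i ord0)].
Proof.
move=> mA; rewrite (_ : [set _ | _] =
  \bigcap_(i in [set: 'I_k]) ((fun v : 'cV[R]_k => v i ord0) @^-1` A i)).
  apply: fin_bigcap_measurable => // i _.
  rewrite -[X in measurable X]setTI.
  exact: measurable_coord.
by apply/seteqP; split => [v h i _|v h i]; [exact: h|exact: (h i)].
Qed.

Lemma vec_lebesgue_box k (A : 'I_k -> set R) :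
  (forall i, measurable (A i)) ->
  vec_lebesgue k [set v : 'cV[R]_k | forall i, A i (v i ord0)]
  = (\prod_(i < k) lebesgue_measure (A i))%E.
Proof.
elim: k A => [|k ih] A mA.
  rewrite big_ord0 /= /dirac indicE mem_set//; by case.
rewrite big_ord_recl -(ih (fun i => A (lift ord0 i)))//.
transitivity ((lebesgue_measure \x vec_lebesgue k)%E
  (A ord0 `*` [set v : 'cV[R]_k | forall i, A (lift ord0 i) (v i ord0)])).
  rewrite /= /vec_lebesgueS /pushforward; congr (_ _).
  apply/seteqP; split=> -[x v] /=.
    move=> h; split; first by have := h ord0; rewrite mxE unlift_none.
    by move=> i; have := h (lift ord0 i); rewrite mxE liftK.
  by move=> [Ax Av] i; rewrite mxE; case: unliftP => [j ->|->].
rewrite product_measure1E//; first exact: (mA ord0).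
by apply: (@measurable_box k (fun i => A (lift ord0 i))) => i; exact: mA.
Qed.

End vec_lebesgue.

Section norms.
Context {R : realType}.

Definition norm2 k (v : 'cV[R]_k) : R := Num.sqrt (\sum_i v i ord0 ^+ 2).

(* Spectral norm, as the operator norm induced by norm2. *)
Definition spnorm k l (A : 'M[R]_(k, l)) : R :=
  sup [set norm2 (A *m v) | v in [set v : 'cV[R]_l | norm2 v <= 1]].

Definition psd k (A : 'M[R]_k) : Prop :=
  A^T = A /\ forall v : 'cV[R]_k, 0 <= (v^T *m A *m v) ord0 ord0.

(* The positive semidefinite square root of A; junk value 0 when A is not
   positive semidefinite. *)
Definition sqrtmx k (A : 'M[R]_k) : 'M[R]_k :=
  xget 0 [set B | psd B /\ B *m B = A].

Definition Gamma (x : R) : R :=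
  \int[lebesgue_measure]_(t in `]0, +oo[) (t `^ (x - 1) * expR (- t)).

End norms.

Section groups.
Context {R : realType} {d p : nat} (G : 'I_p -> {set 'I_d}).

Definition group_partition : Prop :=
  [/\ forall j, G j != finset.set0,
      forall j k, j != k -> (G j :&: G k)%SET = finset.set0
    & (\bigcup_j G j)%SET = finset.setT].

Definition max_group : nat := \max_j #|G j|.

Definition group_sub (b : 'cV[R]_d) (j : 'I_p) : 'cV[R]_#|G j| :=
  rowsub enum_val b.

(* ||b_S||_{2,1}; ||b||_{2,1} is the case S = setT. *)
Definition norm21 (S : {set 'I_p}) (b : 'cV[R]_d) : R :=
  \sum_(j in S) norm2 (group_sub b j).

Definition group_supp (b : 'cV[R]_d) : {set 'I_p} :=
  [set j | group_sub b j != 0]%SET.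

Definition starnorm k (A : 'M[R]_(k, d)) : R :=
  \big[Num.max/0]_(j < p) spnorm (colsub (enum_val : 'I_#|G j| -> 'I_d) A).

(* max {log p, gbar log n} *)
Definition log_rate (n : nat) : R :=
  Num.max (ln p%:R) (max_group%:R * ln n%:R).

Section compatibility.
Context {k : nat} (W : 'M[R]_k) (X : 'M[R]_(k, d)).
Local Open Scope ereal_scope.

(* Infima in [0, +oo]: the infimum over an empty set of vectors is +oo. The
   argument of psi1 and psi2 may be +oo. *)
Definition phi (S : {set 'I_p}) : \bar R :=
  ereal_inf [set (norm2 (sqrtmx W *m (X *m b)) * Num.sqrt #|S|%:R
                  / (starnorm X * norm21 [set: 'I_p]%SET b))%:E
            | b in [set b | (norm21 (~: S)%SET b <= 7 * norm21 S b)%R /\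
                            exists2 j, j \in S & group_sub b j != 0%R]].

Definition psi1 (s : \bar R) : \bar R :=
  ereal_inf [set (norm2 (sqrtmx W *m (X *m b)) * Num.sqrt #|group_supp b|%:R
                  / (starnorm X * norm21 [set: 'I_p]%SET b))%:E
            | b in [set b | (1 <= #|group_supp b|)%N /\
                            #|group_supp b|%:R%:E <= s]].

Definition psi2 (s : \bar R) : \bar R :=
  ereal_inf [set (norm2 (sqrtmx W *m (X *m b)) / (starnorm X * norm2 b))%:E
            | b in [set b | (1 <= #|group_supp b|)%N /\
                            #|group_supp b|%:R%:E <= s]].

End compatibility.

Section prior.
Variable lam : {nonneg R}.

Definition coords (S : {set 'I_p}) : {set 'I_d} := (\bigcup_(j in S) G j)%SET.

(* #|coords S| is d_S; extend v is the b with b_S = v and b_{S^c} = 0. *)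
Definition extend (S : {set 'I_p}) (v : 'cV[R]_#|coords S|) : 'cV[R]_d :=
  \col_i \sum_(k | enum_val k == i) v k ord0.

Definition slab_density (S : {set 'I_p}) (v : 'cV[R]_#|coords S|) : R :=
  (lam%:num / Num.sqrt pi) ^+ #|coords S|
  * ((\prod_(j in S) Gamma (#|G j|%:R / 2))
     / (2 ^+ #|S| * \prod_(j in S) Gamma #|G j|%:R))
  * expR (- lam%:num * norm21 S (extend v)).

(* Law of b given S, as a measure on R^d carried by the b with b_{S^c} = 0. *)
Definition slab (S : {set 'I_p}) (B : set 'cV[R]_d) : \bar R :=
  \int[vec_lebesgue _]_(v in @extend S @^-1` B) (slab_density v)%:E.

Lemma Gamma_ge0 (x : R) : 0 <= Gamma x.
Proof.
rewrite /Gamma; apply: Rintegral_ge0 => t _.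
by rewrite mulr_ge0 ?powR_ge0 ?expR_ge0.
Qed.

Lemma slab_density_ge0 S (v : 'cV[R]_#|coords S|) : 0 <= slab_density v.
Proof.
rewrite /slab_density mulr_ge0 ?expR_ge0//.
have pG (F : 'I_p -> R) : 0 <= \prod_(j in S) Gamma (F j).
  by apply: prodr_ge0 => j _; exact: Gamma_ge0.
apply: mulr_ge0; first by rewrite exprn_ge0// divr_ge0// sqrtr_ge0.
by rewrite divr_ge0// mulr_ge0// exprn_ge0.
Qed.

Lemma measurable_norm2 k : measurable_fun setT (@norm2 R k).
Proof.
rewrite /norm2; apply: measurableT_comp.
  by apply: continuous_measurable_fun; exact: sqrt_continuous.
by apply: measurable_sum => i; apply: measurable_funX; exact: measurable_coord.
Qed.

Lemma measurable_extend S : measurable_fun setT (@extend S).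
Proof.
apply: measurable_fun_vecP => i.
rewrite (_ : (fun _ => _) = fun v : 'cV[R]_#|coords S| =>
    \sum_k if enum_val k == i then v k ord0 else 0); last first.
  by apply/funext => v; rewrite mxE; exact: big_mkcond.
apply: measurable_sum => k; case: (enum_val k == i); last exact: measurable_cst.
exact: measurable_coord.
Qed.

Lemma measurable_slab_density S : measurable_fun setT (@slab_density S).
Proof.
rewrite /slab_density; apply: measurable_funM; first exact: measurable_cst.
apply: measurableT_comp; first exact: measurable_expR.
apply: measurable_funM; first exact: measurable_cst.
rewrite (_ : (fun _ => _) = fun v : 'cV[R]_#|coords S| =>
    \sum_j if j \in S then norm2 (group_sub (extend v) j) else 0); last first.
  by apply/funext => v; exact: big_mkcond.
apply: measurable_sum => j; case: (j \in S); last exact: measurable_cst.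
apply: measurableT_comp; first exact: measurable_norm2.
apply: measurable_fun_vecP => i; under eq_fun do rewrite mxE.
exact: measurableT_comp (measurable_coord _) (@measurable_extend S).
Qed.

Section slab_measure.
Variable S : {set 'I_p}.
Local Open Scope ereal_scope.

Let slab0 : slab S set0 = 0.
Proof. by rewrite /slab preimage_set0 integral_set0. Qed.

Let slab_ge0 B : 0 <= slab S B.
Proof. by apply: integral_ge0 => v _; rewrite lee_fin slab_density_ge0. Qed.

Let slab_sigma_additive : semi_sigma_additive (slab S).
Proof.
move=> F mF tF mUF; rewrite /slab preimage_bigcup ge0_integral_bigcup.
- apply: is_cvg_ereal_nneg_natsum_cond => i _ _.
  exact: slab_ge0.
- move=> i; rewrite -[X in measurable X]setTI; exact: measurable_extend.
- apply: measurable_funTS; apply/measurable_EFinP.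
  exact: measurable_slab_density.
- by move=> v _; rewrite lee_fin slab_density_ge0.
- apply/trivIsetP => /= i j _ _ ij; rewrite -preimage_setI.
  by move/trivIsetP : tF => /(_ _ _ _ _ ij) ->//; rewrite preimage_set0.
Qed.

HB.instance Definition _ := isMeasure.Build _ _ _ (slab S)
  slab0 slab_ge0 slab_sigma_additive.

End slab_measure.

Section prior_measure.
Variable pmf : nat -> {nonneg R}.
Local Open Scope ereal_scope.

Definition prior (B : set 'cV[R]_d) : \bar R :=
  \sum_(S : {set 'I_p}) ((pmf #|S|)%:num / 'C(p, #|S|)%:R)%:E * slab S B.

Let weight_ge0 (S : {set 'I_p}) :
  (0 <= (pmf #|S|)%:num / 'C(p, #|S|)%:R :> R)%R.
Proof. exact: divr_ge0. Qed.

Let prior0 : prior set0 = 0.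
Proof. by rewrite /prior big1// => S _; rewrite measure0 mule0. Qed.

Let prior_ge0 B : 0 <= prior B.
Proof.
by apply: sume_ge0 => S _; rewrite mule_ge0// lee_fin weight_ge0.
Qed.

Let prior_sigma_additive : semi_sigma_additive prior.
Proof.
move=> F mF tF mUF; rewrite [X in _ --> X](_ : _ =
    lim ((fun n => \sum_(0 <= i < n) prior (F i)) @ \oo)).
  by apply: is_cvg_ereal_nneg_natsum => i _; exact: prior_ge0.
rewrite nneseries_sum; last first.
  by move=> S i _; rewrite mule_ge0// lee_fin weight_ge0.
apply: eq_bigr => /= S _; rewrite nneseriesZl//.
by congr (_ * _); exact: measure_semi_bigcup.
Qed.

HB.instance Definition _ := isMeasure.Build _ _ _ prior
  prior0 prior_ge0 prior_sigma_additive.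

End prior_measure.
End prior.
End groups.

Section logit.
Context {R : realType} {m n d : nat} (X : 'I_n -> 'M[R]_(m.-1, d)).

(* (X_1^T, ..., X_n^T)^T *)
Definition stack : 'M[R]_(\sum_(i < n) m.-1, d) := \mxcol_(i < n) X i.

(* f_b^n, as a function of the blocks Y_1, ..., Y_n of Y. *)
Definition likelihood (b : 'cV[R]_d) (y : 'I_n -> 'cV[R]_m.-1) : R :=
  \prod_(i < n) (expR (((y i)^T *m X i *m b) ord0 ord0)
                 / (1 + \sum_(l < m.-1) expR ((X i *m b) l ord0))).

Definition posterior (Pi : {measure set 'cV[R]_d -> \bar R})
    (y : 'I_n -> 'cV[R]_m.-1) (B : set 'cV[R]_d) : \bar R :=
  ((\int[Pi]_(b in B) (likelihood b y)%:E)
   / (\int[Pi]_b (likelihood b y)%:E))%E.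

Section experiment.
Context {disp : measure_display} {Om : measurableType disp}.
Variables (Z : 'I_n -> Om -> 'I_m) (P : probability Om R).

Definition independent_responses : Prop :=
  (forall i k, measurable [set w | Z i w = k]) /\
  forall A : 'I_n -> set 'I_m,
    P (\bigcap_i [set w | A i (Z i w)])
    = (\prod_(i < n) P [set w | A i (Z i w)])%E.

Definition prob_response (i : 'I_n) (k : nat) : R :=
  fine (P [set w | Z i w = k :> nat]).

(* Row l of X i belongs to category l.+1. As ln is 0 outside the positive
   reals, the positivity of the probabilities has to be required. *)
Definition logit_model (b : 'cV[R]_d) : Prop :=
  forall (i : 'I_n) (l : 'I_m.-1),
    [/\ 0 < prob_response i 0, 0 < prob_response i l.+1
      & ln (prob_response i l.+1 / prob_response i 0) = (X i *m b) l ord0].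

Definition response_block (w : Om) (i : 'I_n) : 'cV[R]_m.-1 :=
  \col_l (Z i w == l.+1 :> nat)%:R.

Definition response (w : Om) : 'cV[R]_(\sum_(i < n) m.-1) :=
  \mxcol_(i < n) response_block w i.

Definition mean_mx k l (M : Om -> 'M[R]_(k, l)) : 'M[R]_(k, l) :=
  \matrix_(i, j) fine ('E_P[fun w => M w i j])%E.

Definition response_mean := mean_mx response.

Definition response_cov : 'M[R]_(\sum_(i < n) m.-1) :=
  mean_mx (fun w => (response w - response_mean)
                    *m (response w - response_mean)^T).

End experiment.

Section grouped.
Context {p : nat} (G : 'I_p -> {set 'I_d}).

Definition slab_rate : R :=
  8 * starnorm G stack * Num.sqrt (log_rate G n).

Lemma slab_rate_ge0 : 0 <= slab_rate.
Proof.
rewrite /slab_rate mulr_ge0 ?sqrtr_ge0// mulr_ge0// /starnorm.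
by elim/big_rec: _ => // j x _ x0; rewrite le_max x0 orbT.
Qed.

Definition logit_prior (pmf : nat -> {nonneg R}) :
    {measure set 'cV[R]_d -> \bar R} :=
  prior G (NngNum slab_rate_ge0) pmf.

Section truth.
Context {disp : measure_display} {Om : measurableType disp}.
Variables (Z : 'I_n -> Om -> 'I_m) (P : 'cV[R]_d -> probability Om R).
Variables (A4 : R) (b0 : 'cV[R]_d).
Local Open Scope ereal_scope.

Definition s0 : nat := #|group_supp G b0|.

Definition phi0 : \bar R :=
  phi G (response_cov Z (P b0)) stack (group_supp G b0).

(* +oo if phi0 = 0 < s0. *)
Definition xi0 : \bar R :=
  s0%:R%:E + A4^-1%:E * (4%:E + 100%:E / phi0 ^+ 2) * s0%:R%:E.

Definition psi10 : \bar R :=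
  psi1 G (response_cov Z (P b0)) stack (xi0 + s0%:R%:E).

Definition psi20 : \bar R :=
  psi2 G (response_cov Z (P b0)) stack (xi0 + s0%:R%:E).

End truth.

Definition calB2 disp (Om : measurableType disp) (Z : 'I_n -> Om -> 'I_m)
    (P : 'cV[R]_d -> probability Om R) (A4 M : R) : set 'cV[R]_d :=
  [set b0 | ((s0 b0)%:R * Num.sqrt (log_rate G n)
             * \big[Num.max/0]_(i < n) starnorm G (X i))%:E
            <= M%:E * psi10 Z P A4 b0 ^+ 2 * phi0 Z P b0 ^+ 2
               * (starnorm G stack)%:E]%E.

End grouped.
End logit.

(* Main.v *)
Require Import Defs.
From HB Require Import structures.
From mathcomp Require Import all_boot all_order all_algebra.
From mathcomp Require Import all_classical all_reals all_analysis.
From mathcomp Require Import measurable_realfun.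
From mathcomp Require Import spectral complex.
From mathcomp Require Import ring lra.

Set Implicit Arguments.
Unset Strict Implicit.
Unset Printing Implicit Defensive.

Import Order.TTheory GRing.Theory Num.Theory.
Import numFieldNormedType.Exports.

Local Open Scope classical_set_scope.
Local Open Scope ring_scope.

(* The log likelihood ratio of b against b0 is <Y - mu, X u> - D(u) with
   u = b - b0, where D is a sum over i of centred cumulant generating functions;
   D(u) >= |W^1/2 X u|^2 / (2 + 8 max_i |X_i u|), so D is quadratic near 0 and
   still grows at least linearly far away. Let N be the (2,1)-norm. Off an event
   of small probability, controlled by a Gaussian mixture of the moment
   generating function of the noise, all blocks of X^T (Y - mu) have norm at most
   lambda / 2; there the noise is dominated by the penalty lambda N, and what is
   left of it is absorbed by D: through phi for every b, at a cost proportional to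
   s0 max(log p, gbar log n) / phi^2, and through psi_1, with an arbitrarily large
   gain, for b of small support far from b0. As exp(- a N) integrates over a model
   S against the slab to (lambda / a)^(d_S), the posterior is bounded by a sum over
   model sizes: small sizes are beaten by that gain, sizes above xi_0 by the
   geometric decay of pi_p. *)

(** * Norms and groups *)

(** The constants come from one budget, counted in units of [x * rL] with [x] the star norm of the
    stacked design and [rL] the root of [log_rate]. The slab rate is 8; the noise takes 4 on the
    quiet event, and 2, a quarter of the rate, is set aside so that an exponential in N(b - b0)
    remains to be integrated. On the true groups these add up to 14; off them 8 - 4 - 2 = 2 is left,
    and 14 / 2 = 7 is the cone constant of [phi]. AM-GM inside the cone costs 99 [log_rate] s0 /
    phi^2, and the 100 in [xi0] leaves room for a geometric series. The obstacle is that D grows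
    only linearly far from b0, so that quadratic compatibility inequalities absorb the noise only if
    the star norms of the single blocks are small. This is the role of [calB2] and the reason for
    the case distinctions on the size of K N, where K is the largest of these norms. The final bound
    depends on A4 and ln n alone, once ln n passes a threshold in A1, A2, A4; hence the uniformity
    in b0. The case s0 = 0 is separate because [phi] and [psi1] are then infinite. *)

Section euclidean_norm.
Context {R : realType}.
Implicit Types k l : nat.

Definition dot k (u v : 'cV[R]_k) : R := \sum_i u i ord0 * v i ord0.

Lemma dotC k (u v : 'cV[R]_k) : dot u v = dot v u.
Proof. by apply: eq_bigr => i _; rewrite mulrC. Qed.

Lemma dotDr k (u v w : 'cV[R]_k) : dot u (v + w) = dot u v + dot u w.
Proof. by rewrite -big_split; apply: eq_bigr => i _; rewrite mxE mulrDr. Qed.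

Lemma dotDl k (u v w : 'cV[R]_k) : dot (u + v) w = dot u w + dot v w.
Proof. by rewrite !(dotC _ w) dotDr. Qed.

Lemma dotZr k (u v : 'cV[R]_k) a : dot u (a *: v) = a * dot u v.
Proof. by rewrite mulr_sumr; apply: eq_bigr => i _; rewrite mxE mulrCA. Qed.

Lemma dotZl k (u v : 'cV[R]_k) a : dot (a *: u) v = a * dot u v.
Proof. by rewrite dotC dotZr dotC. Qed.

Lemma dotNr k (u v : 'cV[R]_k) : dot u (- v) = - dot u v.
Proof. by rewrite -scaleN1r dotZr mulN1r. Qed.

Lemma dotNl k (u v : 'cV[R]_k) : dot (- u) v = - dot u v.
Proof. by rewrite dotC dotNr dotC. Qed.

Lemma dotE k (u v : 'cV[R]_k) : dot u v = (u^T *m v) ord0 ord0.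
Proof. by rewrite mxE; apply: eq_bigr => i _; rewrite mxE. Qed.

Lemma dot_mulmxr k l (A : 'M[R]_(k, l)) u v : dot u (A *m v) = dot (A^T *m u) v.
Proof. by rewrite !dotE trmx_mul trmxK mulmxA. Qed.

Lemma norm2_ge0 k (v : 'cV[R]_k) : 0 <= norm2 v.
Proof. exact: sqrtr_ge0. Qed.

Lemma sqr_norm2 k (v : 'cV[R]_k) : norm2 v ^+ 2 = \sum_i v i ord0 ^+ 2.
Proof. by rewrite sqr_sqrtr// sumr_ge0// => i _; rewrite sqr_ge0. Qed.

Lemma dot_norm2 k (v : 'cV[R]_k) : dot v v = norm2 v ^+ 2.
Proof. by rewrite sqr_norm2; apply: eq_bigr => i _; rewrite expr2. Qed.

Lemma norm2_0 k : norm2 (0 : 'cV[R]_k) = 0.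
Proof. by rewrite /norm2 big1 ?sqrtr0// => i _; rewrite mxE expr0n. Qed.

Lemma coord_le_norm2 k (v : 'cV[R]_k) i : `|v i ord0| <= norm2 v.
Proof.
rewrite -sqrtr_sqr ler_wsqrtr// (bigD1 i)//= lerDl sumr_ge0// => j _.
exact: sqr_ge0.
Qed.

Lemma norm2_eq0 k (v : 'cV[R]_k) : (norm2 v == 0) = (v == 0).
Proof.
apply/eqP/eqP => [v0|->]; last exact: norm2_0.
apply/colP => i; rewrite mxE; apply/eqP; rewrite -normr_le0 -v0.
exact: coord_le_norm2.
Qed.

Lemma norm2_gt0 k (v : 'cV[R]_k) : (0 < norm2 v) = (v != 0).
Proof. by rewrite lt_def norm2_ge0 andbT norm2_eq0. Qed.

Lemma norm2Z k (v : 'cV[R]_k) a : norm2 (a *: v) = `|a| * norm2 v.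
Proof.
rewrite /norm2 -sqrtr_sqr -sqrtrM ?sqr_ge0// mulr_sumr; congr Num.sqrt.
by apply: eq_bigr => i _; rewrite mxE exprMn.
Qed.

Lemma norm2N k (v : 'cV[R]_k) : norm2 (- v) = norm2 v.
Proof. by rewrite -scaleN1r norm2Z normrN1 mul1r. Qed.

Lemma dot_le_norm2 k (u v : 'cV[R]_k) : dot u v <= norm2 u * norm2 v.
Proof.
have [->|u0] := eqVneq u 0.
  by rewrite norm2_0 mul0r /dot big1// => i _; rewrite mxE mul0r.
have [->|v0] := eqVneq v 0.
  by rewrite norm2_0 mulr0 /dot big1// => i _; rewrite mxE mulr0.
have {}u0 : 0 < norm2 u by rewrite norm2_gt0.
have {}v0 : 0 < norm2 v by rewrite norm2_gt0.
have : 0 <= norm2 (norm2 v *: u - norm2 u *: v) ^+ 2 by exact: sqr_ge0.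
rewrite -dot_norm2 dotDl !dotDr !dotNr !dotNl !dotZr !dotZl.
rewrite !dot_norm2 (dotC v u) => h.
have : 0 <= (norm2 u * norm2 v) * (norm2 u * norm2 v - dot u v) by nra.
by rewrite pmulr_rge0 ?mulr_gt0// subr_ge0.
Qed.

Lemma norm_dot_le k (u v : 'cV[R]_k) : `|dot u v| <= norm2 u * norm2 v.
Proof.
by rewrite ler_norml dot_le_norm2 lerNl -dotNr -(norm2N v) dot_le_norm2.
Qed.

Lemma norm2D k (u v : 'cV[R]_k) : norm2 (u + v) <= norm2 u + norm2 v.
Proof.
rewrite -(@ler_pXn2r _ 2) ?nnegrE ?addr_ge0 ?norm2_ge0//.
rewrite -dot_norm2 dotDl !dotDr !dot_norm2 (dotC v u).
have := dot_le_norm2 u v; nra.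
Qed.

Lemma norm2_sum k (I : Type) (r : seq I) (Q : pred I) (F : I -> 'cV[R]_k) :
  norm2 (\sum_(i <- r | Q i) F i) <= \sum_(i <- r | Q i) norm2 (F i).
Proof.
elim/big_rec2: _ => [|i x y _ h]; first by rewrite norm2_0.
by rewrite (le_trans (norm2D _ _))// lerD2l.
Qed.

(** [sup] is meaningful only on a nonempty bounded set. The sum of the column norms bounds this one,
    so [spnorm] is a genuine operator norm. *)
Lemma norm2_mulmx_bounded k l (A : 'M[R]_(k, l)) :
  has_sup [set norm2 (A *m v) | v in [set v : 'cV[R]_l | norm2 v <= 1]].
Proof.
split; first by exists (norm2 (A *m 0)), 0 => //=; rewrite norm2_0.
exists (\sum_i norm2 (col i A)) => _ [v /= v1 <-].
have -> : A *m v = \sum_i v i ord0 *: col i A.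
  apply/colP => i; rewrite mxE summxE; apply: eq_bigr => j _.
  by rewrite !mxE mulrC.
apply: (le_trans (norm2_sum _ _ _)); apply: ler_sum => i _.
rewrite norm2Z ler_piMl ?norm2_ge0//.
exact: le_trans (coord_le_norm2 v i) v1.
Qed.

Lemma norm2_mulmx k l (A : 'M[R]_(k, l)) v :
  norm2 (A *m v) <= spnorm A * norm2 v.
Proof.
have [->|v0] := eqVneq v 0; first by rewrite mulmx0 !norm2_0 mulr0.
have v_gt0 : 0 < norm2 v by rewrite norm2_gt0.
rewrite -ler_pdivrMr//; apply: ub_le_sup; first exact: (norm2_mulmx_bounded A).2.
exists ((norm2 v)^-1 *: v) => /=.
  by rewrite norm2Z ger0_norm ?invr_ge0 ?norm2_ge0// mulVf ?gt_eqF.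
by rewrite -scalemxAr norm2Z ger0_norm ?invr_ge0 ?norm2_ge0// mulrC.
Qed.

(* Choosing the signs one after another: by the parallelogram law, one of
   u + v and u - v has norm2 square at most norm2 u ^ 2 + norm2 v ^ 2. *)
Lemma norm2_sign_sum k (I : eqType) (r : seq I) (F : I -> 'cV[R]_k) :
  uniq r ->
  exists2 e : I -> R, (forall i, `|e i| = 1) &
    norm2 (\sum_(i <- r) e i *: F i) ^+ 2 <= \sum_(i <- r) norm2 (F i) ^+ 2.
Proof.
elim: r => [_|i r ih /= /andP[ir /ih[e e1 he]]].
  by exists (fun=> 1) => [i|]; rewrite ?normr1// !big_nil norm2_0 expr0n.
set u := \sum_(i <- r) e i *: F i in he.
have [s s1 hs] : exists2 s : R, `|s| = 1 &
    norm2 (s *: F i + u) ^+ 2 <= norm2 (F i) ^+ 2 + norm2 u ^+ 2.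
  have [h|h] := leP 0 (dot (F i) u).
    exists (-1); first by rewrite normrN1.
    by rewrite -!dot_norm2 scaleN1r dotDl !dotDr !dotNr !dotNl (dotC u); lra.
  exists 1; first by rewrite normr1.
  by rewrite -!dot_norm2 scale1r dotDl !dotDr (dotC u); lra.
exists (fun j => if j == i then s else e j) => [j|]; first by case: ifP.
rewrite !big_cons eqxx.
have -> : \sum_(j <- r) (if j == i then s else e j) *: F j = u.
  rewrite /u big_seq [RHS]big_seq; apply: eq_bigr => j jr.
  by rewrite ifN//; apply: contraNneq ir => <-.
by rewrite (le_trans hs)// lerD2l.
Qed.

End euclidean_norm.

Section group_norm.
Context {R : realType} {d p : nat} (G : 'I_p -> {set 'I_d}).
Hypothesis GP : group_partition G.

Lemma norm21_ge0 (S : {set 'I_p}) (b : 'cV[R]_d) : 0 <= norm21 G S b.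
Proof. by apply: sumr_ge0 => j _; exact: norm2_ge0. Qed.

Lemma group_subD (b c : 'cV[R]_d) j :
  group_sub G (b + c) j = group_sub G b j + group_sub G c j.
Proof. by apply/matrixP => i k; rewrite !mxE. Qed.

Lemma group_subZ (b : 'cV[R]_d) a j :
  group_sub G (a *: b) j = a *: group_sub G b j.
Proof. by apply/matrixP => i k; rewrite !mxE. Qed.

Lemma group_subN (b : 'cV[R]_d) j : group_sub G (- b) j = - group_sub G b j.
Proof. by apply/matrixP => i k; rewrite !mxE. Qed.

Lemma group_sub0 j : group_sub G (0 : 'cV[R]_d) j = 0.
Proof. by apply/matrixP => i k; rewrite !mxE. Qed.

Lemma norm21_setT (S : {set 'I_p}) (b : 'cV[R]_d) :
  norm21 G [set: 'I_p]%SET b = norm21 G S b + norm21 G (~: S)%SET b.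
Proof.
rewrite /norm21 (bigID (mem S))/=; congr (_ + _).
  by apply: eq_bigl => j; rewrite finset.inE.
by apply: eq_bigl => j; rewrite !finset.inE.
Qed.

Lemma norm21N (S : {set 'I_p}) (b : 'cV[R]_d) : norm21 G S (- b) = norm21 G S b.
Proof. by apply: eq_bigr => j _; rewrite group_subN norm2N. Qed.

Lemma norm21D (S : {set 'I_p}) (b c : 'cV[R]_d) :
  norm21 G S (b + c) <= norm21 G S b + norm21 G S c.
Proof.
by rewrite -big_split ler_sum// => j _; rewrite group_subD norm2D.
Qed.

Lemma norm21B (S : {set 'I_p}) (b c : 'cV[R]_d) :
  norm21 G S b - norm21 G S c <= norm21 G S (b - c).
Proof. by have := norm21D S (b - c) c; rewrite subrK; lra. Qed.

Lemma norm21_subset (S T : {set 'I_p}) (b : 'cV[R]_d) : S \subset T ->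
  norm21 G S b <= norm21 G T b.
Proof.
move=> ST; rewrite /norm21 [leRHS](bigID (mem S))/=.
rewrite [X in _ <= X + _](_ : _ = norm21 G S b); last first.
  apply: eq_bigl => j; case: (boolP (j \in S)) => [|_]; last by rewrite andbF.
  by move=> /(fintype.subsetP ST) ->.
by rewrite lerDl sumr_ge0// => j _; exact: norm2_ge0.
Qed.

Lemma group_supp_subset0 (S : {set 'I_p}) (b : 'cV[R]_d) :
  group_supp G b \subset S -> norm21 G (~: S)%SET b = 0.
Proof.
move=> bS; rewrite /norm21 big1// => j; rewrite finset.inE => jS.
suff /eqP -> : group_sub G b j == 0 by rewrite norm2_0.
by apply: contraNT jS => h; apply: (fintype.subsetP bS); rewrite finset.inE.
Qed.

Let in_group (i : 'I_d) : exists j, i \in G j.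
Proof.
case: GP => _ _ GT; have : i \in (\bigcup_j G j)%SET by rewrite GT finset.inE.
by move/finset.bigcupP => [j _ ij]; exists j.
Qed.

(** The partition as a labelling of indices, so that sums over indices can be regrouped along the
    fibres of a map. *)
Definition group_of (i : 'I_d) : 'I_p := xchoose (in_group i).

Lemma group_ofP i j : (i \in G j) = (group_of i == j).
Proof.
have h := xchooseP (in_group i); rewrite -/(group_of i) in h.
apply/idP/eqP => [ij|<-//]; apply/eqP; apply: contraT => ne.
case: GP => _ /(_ _ _ ne) G0 _.
have : i \in (G (group_of i) :&: G j)%SET by rewrite finset.inE h ij.
by rewrite G0 finset.inE.
Qed.

Lemma sum_groups (F : 'I_d -> R) : \sum_i F i = \sum_j \sum_(i in G j) F i.
Proof.
rewrite (partition_big group_of predT)//=; apply: eq_bigr => j _.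
by apply: eq_bigl => i; rewrite group_ofP.
Qed.

Lemma sum_enum_val (A : {set 'I_d}) (F : 'I_d -> R) :
  \sum_(i in A) F i = \sum_(k < #|A|) F (enum_val k).
Proof. by rewrite big_enum_val. Qed.

Lemma dot_groups (u v : 'cV[R]_d) :
  dot u v = \sum_j dot (group_sub G u j) (group_sub G v j).
Proof.
rewrite /dot sum_groups; apply: eq_bigr => j _; rewrite sum_enum_val.
by apply: eq_bigr => k _; rewrite !mxE.
Qed.

Lemma mulmx_groups k (A : 'M[R]_(k, d)) (b : 'cV[R]_d) :
  A *m b = \sum_j colsub (enum_val : 'I_#|G j| -> 'I_d) A *m group_sub G b j.
Proof.
apply/colP => i; rewrite mxE summxE sum_groups; apply: eq_bigr => j _.
by rewrite sum_enum_val mxE; apply: eq_bigr => l _; rewrite !mxE.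
Qed.

Lemma starnorm_ge0 k (A : 'M[R]_(k, d)) : 0 <= starnorm G A.
Proof.
rewrite /starnorm; elim/big_rec: _ => // j x _ x0; by rewrite le_max x0 orbT.
Qed.

Lemma spnorm_le_starnorm k (A : 'M[R]_(k, d)) j :
  spnorm (colsub (enum_val : 'I_#|G j| -> 'I_d) A) <= starnorm G A.
Proof. by rewrite /starnorm (bigmaxD1 j)//= le_max lexx. Qed.

Lemma starnorm_le k (A : 'M[R]_(k, d)) c : 0 <= c ->
  (forall j, spnorm (colsub (enum_val : 'I_#|G j| -> 'I_d) A) <= c) ->
  starnorm G A <= c.
Proof. by move=> c0 h; apply: bigmax_le. Qed.

Lemma norm2_mulmx_starnorm k (A : 'M[R]_(k, d)) (b : 'cV[R]_d) :
  norm2 (A *m b) <= starnorm G A * norm21 G [set: 'I_p]%SET b.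
Proof.
rewrite mulmx_groups (le_trans (norm2_sum _ _ _))// /norm21 mulr_sumr.
rewrite [leRHS](eq_bigl predT); last by move=> j; rewrite finset.inE.
apply: ler_sum => j _; rewrite (le_trans (norm2_mulmx _ _))//.
by rewrite ler_wpM2r ?norm2_ge0 ?spnorm_le_starnorm.
Qed.

Lemma norm21_eq0 (b : 'cV[R]_d) : (norm21 G [set: 'I_p]%SET b == 0) = (b == 0).
Proof.
apply/eqP/eqP => [b0|->]; last first.
  by rewrite /norm21 big1// => j _; rewrite group_sub0 norm2_0.
apply/eqP; rewrite -norm2_eq0 -sqrf_eq0 -dot_norm2 dot_groups.
apply/eqP/big1 => j _; move/eqP: b0; rewrite psumr_eq0; last first.
  by move=> ? _; exact: norm2_ge0.
move=> /allP/(_ j); rewrite mem_index_enum finset.inE/= => /(_ isT).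
by rewrite dot_norm2 => /eqP ->; rewrite expr0n.
Qed.

Lemma starnorm_gt0 k (A : 'M[R]_(k, d)) : A != 0 -> 0 < starnorm G A.
Proof.
rewrite lt_def starnorm_ge0 andbT; apply: contraNneq => A0.
apply/eqP/matrixP => i j.
have := norm2_mulmx_starnorm A (delta_mx j ord0).
rewrite A0 mul0r => h.
have /eqP : A *m (delta_mx j ord0 : 'cV_d) == 0.
  by rewrite -norm2_eq0 eq_le h norm2_ge0.
by rewrite -colE => /colP/(_ i); rewrite !mxE.
Qed.

Lemma group_supp_eq0 (b : 'cV[R]_d) : (#|group_supp G b| == 0%N) = (b == 0).
Proof.
rewrite -norm21_eq0 psumr_eq0; last by move=> ? _; exact: norm2_ge0.
rewrite cards_eq0; apply/eqP/allP => [h j _|h].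
  rewrite finset.inE/= norm2_eq0; apply: contraT => bj.
  have : j \in group_supp G b by rewrite finset.inE.
  by rewrite h finset.inE.
apply/setP => j; rewrite !finset.inE; apply/negbTE; rewrite negbK.
by have := h j (mem_index_enum j); rewrite finset.inE/= norm2_eq0.
Qed.

Lemma group_suppB (b c : 'cV[R]_d) :
  (#|group_supp G (b - c)| <= #|group_supp G b| + #|group_supp G c|)%N.
Proof.
rewrite (leq_trans _ (leq_card_setU _ _))// subset_leq_card//.
apply/fintype.subsetP => j; rewrite !finset.inE group_subD group_subN.
apply: contraNT; rewrite negb_or !negbK => /andP[/eqP -> /eqP ->].
by rewrite subr0.
Qed.

End group_norm.

Section stacked_design.
Context {R : realType} {m n d p : nat} (G : 'I_p -> {set 'I_d}).
Variable X : 'I_n -> 'M[R]_(m.-1, d).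

Lemma norm2_mxcol (q : nat) (p_ : 'I_q -> nat) (v : forall i, 'cV[R]_(p_ i)) :
  norm2 (\mxcol_i v i) ^+ 2 = \sum_i norm2 (v i) ^+ 2.
Proof.
rewrite -dot_norm2 dotE tr_mxcol mul_mxrow_mxcol summxE; apply: eq_bigr => i _.
by rewrite -dotE dot_norm2.
Qed.

Lemma norm2_stack (b : 'cV[R]_d) :
  norm2 (stack X *m b) ^+ 2 = \sum_i norm2 (X i *m b) ^+ 2.
Proof. by rewrite /stack mxcol_mul norm2_mxcol. Qed.

Lemma norm2_block_le_stack (b : 'cV[R]_d) i :
  norm2 (X i *m b) <= norm2 (stack X *m b).
Proof.
rewrite -(@ler_pXn2r _ 2) ?nnegrE ?norm2_ge0// norm2_stack (bigD1 i)//=.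
by rewrite lerDl sumr_ge0// => j _; exact: sqr_ge0.
Qed.

End stacked_design.

(** * Lebesgue measure on R^k *)

Section vec_lebesgue_unique.
Context {R : realType} (k : nat).
Local Open Scope ereal_scope.

Definition box (A : 'I_k -> set R) : set 'cV[R]_k :=
  [set v | forall i, A i (v i ord0)].

Lemma vec_lebesgue_boxE (A : 'I_k -> set R) :
  (forall i, measurable (A i)) ->
  vec_lebesgue k (box A) = \prod_(i < k) lebesgue_measure (A i).
Proof. exact: vec_lebesgue_box. Qed.

(** Boxes are stable under intersection and generate the sigma-algebra, and the cubes [-n, n]^k
    exhaust the space with finite measure. All changes of variables below are checked on boxes
    through this uniqueness. *)
Lemma vec_lebesgue_unique (mu : {measure set 'cV[R]_k -> \bar R}) :
  (forall A : 'I_k -> set R, (forall i, measurable (A i)) ->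
     mu (box A) = \prod_(i < k) lebesgue_measure (A i)) ->
  forall B, measurable B -> vec_lebesgue k B = mu B.
Proof.
move=> muE B mB.
pose C : set (set 'cV[R]_k) :=
  [set box A | A in [set A | forall i, measurable (A i)]].
pose F (n : nat) : set R := [set` `[(- n%:R)%R, n%:R%R]].
apply: (measure_unique C (fun n => box (fun=> F n))) => //.
- rewrite (_ : measurable = g_sigma_preimage
    (fun (i : 'I_k) (v : 'cV[R]_k) => v i ord0))//.
  apply/seteqP; split; apply: smallest_sub; try exact: smallest_sigma_algebra.
  + move=> A; rewrite -bigcup_seq => -[i _ [Y mY <-]].
    apply: sub_sigma_algebra; exists (fun j => if j == i then Y else setT).
      by move=> j /=; case: ifP.
    rewrite setTI; apply/seteqP; split => v /=; first by move/(_ i); rewrite eqxx.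
    by move=> h j; case: ifP => // /eqP ->.
  + by move=> _ [A mA <-]; exact: measurable_box.
- move=> _ _ [A1 m1 <-] [A2 m2 <-]; exists (fun i => A1 i `&` A2 i).
    by move=> i; exact: measurableI.
  apply/seteqP; split => v /=; last by move=> [h1 h2] i; split.
  by move=> h; split => i; have [] := h i.
- by move=> n; exists (fun=> F n) => //= i; exact: measurable_itv.
- apply/seteqP; split => // v _.
  have [n hn] : exists n : nat, (\sum_i `|v i ord0| <= n%:R)%R.
    exists (Num.truncn (\sum_i `|v i ord0|)%R).+1.
    by apply/ltW/truncnS_gt.
  exists n => // i; rewrite /F/= in_itv/= -ler_norml (le_trans _ hn)//.
  by rewrite (bigD1 i)//= lerDl sumr_ge0.
- by move=> _ [A mA <-]; rewrite muE//; exact: vec_lebesgue_boxE.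
- move=> n; rewrite -[ltLHS]/(vec_lebesgue k (box (fun=> F n))).
  rewrite vec_lebesgue_boxE; last by move=> i; exact: measurable_itv.
  have [r ->] : exists r, lebesgue_measure (F n) = r%:E.
    by rewrite lebesgue_measure_itv/=; case: ifP => _; eexists => //; rewrite -EFinB.
  by rewrite prodEFin ltry.
Qed.

End vec_lebesgue_unique.

Section vec_lebesgue_affine.
Context {R : realType}.
Local Open Scope ereal_scope.

Lemma measurable_affineR (a c : R) : measurable_fun setT
  (fun x : measurableTypeR R => a * x + c : measurableTypeR R)%R.
Proof. by apply: measurable_funD => //; exact: measurable_funM. Qed.

(** The image of Lebesgue measure under the affine map, multiplied by [a], gives every half-open
    interval its length, hence is Lebesgue measure. *)
Lemma lebesgue_measure_affine (a c : R) (A : set R) : (0 < a)%R ->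
  measurable A ->
  lebesgue_measure [set x | A (a * x + c)%R] = a^-1%:E * lebesgue_measure A.
Proof.
move=> a0 mA.
pose aN := NngNum (ltW a0).
pose pf : {measure set (measurableTypeR R) -> \bar R} :=
  measure_function_pushforward__canonical__measure_function_Measure
    (@lebesgue_measure R) (measurable_affineR a c).
have := @lebesgue_measure_unique R (mscale aN pf) _ A mA => -> //; last first.
  move=> _ [[l r]] _ <-.
  rewrite [RHS](_ : _ = a%:E * lebesgue_measure
    ((fun x => a * x + c)%R @^-1` [set` `]l, r]]))//.
  rewrite (_ : _ @^-1` _ = [set` `](l - c) / a, (r - c) / a]%R]).
    rewrite !lebesgue_measure_itv/= !lte_fin ltr_pM2r ?invr_gt0// ltrD2r.
    case: ifP => _; last by rewrite mule0.
    rewrite -!EFinB -EFinM; congr EFin; by field; rewrite gt_eqF.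
  apply/seteqP; split => x /=; rewrite !in_itv/= ltr_pdivrMr// ler_pdivlMr//;
  by rewrite ltrBlDr lerBrDr (mulrC x).
rewrite [X in _ * X](_ : _ = a%:E * pf A)//.
by rewrite muleA -EFinM mulVf ?gt_eqF// mul1e.
Qed.

Variable k : nat.

Lemma measurable_affine (a : R) (c : 'cV[R]_k) :
  measurable_fun setT (fun v : 'cV[R]_k => a *: v + c)%R.
Proof.
apply: measurable_fun_vecP => i; under eq_fun do rewrite !mxE.
apply: measurable_funD => //; apply: measurable_funM => //.
exact: measurable_coord.
Qed.

Lemma prod_EFinM (I : Type) (r : seq I) (b : R) (F : I -> \bar R) :
  \prod_(i <- r) (b%:E * F i) = (b ^+ size r)%:E * \prod_(i <- r) F i.
Proof.
elim: r => [|i r ih]; first by rewrite !big_nil expr0 mul1e.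
by rewrite !big_cons ih/= exprS EFinM !muleA; congr (_ * _); rewrite muleAC.
Qed.

(** On a box the preimage is again a box, so the one-dimensional scaling applies side by side and
    uniqueness identifies the rescaled image measure. *)
Lemma ge0_integral_affine (a : R) (c : 'cV[R]_k) (f : 'cV[R]_k -> \bar R) :
  (0 < a)%R -> measurable_fun setT f -> (forall v, 0 <= f v) ->
  \int[vec_lebesgue k]_v f (a *: v + c)%R
  = (a^-1 ^+ k)%:E * \int[vec_lebesgue k]_v f v.
Proof.
move=> a0 mf f0.
have ak0 : (0 <= a ^+ k)%R by rewrite exprn_ge0// ltW.
have ai0 : (0 <= a^-1 ^+ k)%R by rewrite exprn_ge0// invr_ge0 ltW.
pose pf : {measure set 'cV[R]_k -> \bar R} :=
  measure_function_pushforward__canonical__measure_function_Measure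
    (vec_lebesgue k) (measurable_affine a c).
transitivity (\int[pf]_v f v).
  rewrite (@ge0_integral_pushforward _ _ _ _ _ _ (measurable_affine a c))//.
rewrite -(ge0_integral_mscale _ _ (NngNum ai0))//.
apply: eq_measure_integral => B mB _.
rewrite [RHS](_ : _ = (a^-1 ^+ k)%:E * vec_lebesgue k B)//.
rewrite (@vec_lebesgue_unique _ _ (mscale (NngNum ak0) pf))//.
  rewrite [X in _ = _ * X](_ : _ = (a ^+ k)%:E * pf B)// muleA -EFinM -exprMn mulVf ?gt_eqF//.
  by rewrite expr1n mul1e.
move=> A mA; rewrite [LHS](_ : _ = (a ^+ k)%:E
  * vec_lebesgue k ((fun v => a *: v + c)%R @^-1` box A))//.
rewrite (_ : _ @^-1` _ = box (fun i => [set x | A i (a * x + c i ord0)%R])).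
  rewrite vec_lebesgue_boxE; last first.
    move=> i; rewrite -[X in measurable X]setTI.
    by apply: (measurable_affineR a (c i ord0)) => //; exact: mA.
  rewrite (eq_bigr _ (fun i _ => lebesgue_measure_affine (c i ord0) a0 (mA i))).
  rewrite prod_EFinM muleA -EFinM /index_enum -enumT size_enum_ord -exprMn.
  by rewrite mulfV ?gt_eqF// expr1n mul1e.
by apply/seteqP; split => v /= h i; have := h i; rewrite !mxE.
Qed.

End vec_lebesgue_affine.

Section vec_lebesgue_glue.
Context {R : realType} {k l q : nat}.
Variable t : 'I_q -> 'I_k + 'I_l.
Hypothesis tbij : bijective t.
Local Open Scope ereal_scope.

(** Reassembles a vector from two complementary sets of coordinates. An arbitrary bijection [t] is
    used since the groups need not be intervals of indices. *)
Definition glue (z : 'cV[R]_k * 'cV[R]_l) : 'cV[R]_q :=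
  \col_i match t i with inl a => z.1 a ord0 | inr b => z.2 b ord0 end.

Lemma measurable_glue : measurable_fun setT glue.
Proof.
apply: measurable_fun_vecP => i; under eq_fun do rewrite mxE.
case: (t i) => j; apply: measurableT_comp (measurable_coord j) _.
  exact: measurable_fst.
exact: measurable_snd.
Qed.

Lemma prod_sum_type (F : 'I_k + 'I_l -> \bar R) :
  \prod_(i < q) F (t i) = \prod_(a < k) F (inl a) * \prod_(b < l) F (inr b).
Proof.
have [s ts st] := tbij.
rewrite (reindex s) /=; last by exists t => i _.
rewrite (eq_bigr F); last by move=> i _; rewrite st.
by rewrite big_sumType.
Qed.

Lemma ge0_integral_glue (f : 'cV[R]_q -> \bar R) :
  measurable_fun setT f -> (forall v, 0 <= f v) ->
  \int[vec_lebesgue q]_v f v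
  = \int[vec_lebesgue k]_u \int[vec_lebesgue l]_w f (glue (u, w)).
Proof.
move=> mf f0.
pose pf : {measure set 'cV[R]_q -> \bar R} :=
  measure_function_pushforward__canonical__measure_function_Measure
    (vec_lebesgue k \x vec_lebesgue l) measurable_glue.
rewrite (@eq_measure_integral _ _ _ _ pf); last first.
  move=> B mB _; apply: vec_lebesgue_unique => // A mA.
  rewrite /pf/= /pushforward.
  have [s ts st] := tbij.
  rewrite (_ : _ @^-1` _ = box (fun a => A (s (inl a)))
                           `*` box (fun b => A (s (inr b)))).
    rewrite product_measure1E; [|by apply: measurable_box => i; exact: mA..].
    transitivity (\prod_(a < k) lebesgue_measure (A (s (inl a)))
                  * \prod_(b < l) lebesgue_measure (A (s (inr b)))).
      by congr (_ * _); apply: vec_lebesgue_boxE => ?; exact: mA.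
    rewrite -(prod_sum_type (fun x => lebesgue_measure (A (s x)))).
    by apply: eq_bigr => i _; rewrite ts.
  apply/seteqP; split => -[u w] /=.
    move=> h; split => a /=; first by have := h (s (inl a)); rewrite mxE st.
    by have := h (s (inr a)); rewrite mxE st.
  move=> [h1 h2] i; rewrite mxE -[in A i](ts i).
  by case: (t i) => [a|b]; [exact: h1|exact: h2].
rewrite (@ge0_integral_pushforward _ _ _ _ _ _ measurable_glue)//.
rewrite preimage_setT fubini_tonelli1//=.
exact: measurableT_comp mf measurable_glue.
Qed.

End vec_lebesgue_glue.

Section layer_cake.
Context {R : realType}.
Local Open Scope ereal_scope.
Local Notation lambda := (@lebesgue_measure R).

Lemma measurable_expRN d (T : measurableType d) (f : T -> R) :
  measurable_fun setT f -> measurable_fun setT (fun v => (expR (- f v))%:E).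
Proof.
move=> mf; apply/measurable_EFinP; apply: measurableT_comp => //.
exact: measurableT_comp.
Qed.

Lemma measurable_sublevel d (T : measurableType d) (f : T -> R) (t : R) :
  measurable_fun setT f -> measurable [set v | (f v < t)%R].
Proof.
move=> mf; rewrite -[X in measurable X]setTI.
rewrite (_ : [set v | _] = f @^-1` [set` `]-oo, t[]).
  by apply: mf => //; exact: measurable_itv.
by apply/seteqP; split => v /=; rewrite in_itv.
Qed.

Lemma integral_expRN (r : R) :
  \int[lambda]_(t in `]r, +oo[) (expR (- t))%:E = (expR (- r))%:E.
Proof.
have cN : continuous (fun x : R => expR (- x)%R).
  move=> x; apply: (@continuous_comp _ _ _ -%R expR).
    exact: opp_continuous.
  exact: continuous_expR.
rewrite integral_itv_obnd_cbnd; last first.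
  by apply: measurable_funTS; exact: measurable_expRN.
rewrite (@ge0_continuous_FTC2y _ _ (fun t => - expR (- t))%R _ 0%R).
- by rewrite sub0e EFinN oppeK.
- by move=> x _; exact: expR_ge0.
- exact: continuous_subspaceT.
- by rewrite -[X in _ --> X]oppr0; apply: cvgN; exact: cvgr_expR.
- by move=> x _.
- by apply: cvgN; apply: cvg_at_right_filter; exact: cN.
- move=> x _; rewrite derive1E.
  have D : is_derive x 1%R (fun t => - expR (- t))%R (expR (- x)).
    by apply: is_derive_eq; rewrite /GRing.scale/=; ring.
  exact: derive_val.
Qed.

(** exp(- f) is the integral of exp(- t) over t > f; Tonelli then exchanges the two integrals. The
    weight [g] is 1 for radial integrals and a power for the functional equation of Gamma. *)
Lemma layer_cake d (T : measurableType d)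
    (mu : {sigma_finite_measure set T -> \bar R}) (f : T -> R)
    (g : T -> \bar R) :
  measurable_fun setT f -> measurable_fun setT g ->
  (forall v, 0 <= f v)%R -> (forall v, 0 <= g v) ->
  \int[mu]_v (g v * (expR (- f v))%:E)
  = \int[lambda]_(t in `]0%R, +oo[)
      ((expR (- t))%:E * \int[mu]_(v in [set v | (f v < t)%R]) g v).
Proof.
move=> mf mg f0 g0.
pose F (z : T * R) : \bar R :=
  if (f z.1 < z.2)%R then g z.1 * (expR (- z.2))%:E else 0.
have mF : measurable_fun setT F.
  apply: measurable_fun_ifT => //; last first.
    apply: emeasurable_funM; first exact: measurableT_comp mg measurable_fst.
    exact: measurable_expRN measurable_snd.
  apply: measurable_fun_ltr; last exact: measurable_snd.
  exact: measurableT_comp mf measurable_fst.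
have F0 z : 0 <= F z.
  by rewrite /F; case: ifP => // _; rewrite mule_ge0// lee_fin expR_ge0.
transitivity (\int[mu]_v \int[lambda]_t F (v, t)).
  apply: eq_integral => v _.
  rewrite -integral_expRN -ge0_integralZl//; last first.
    by apply: measurable_funTS; exact: measurable_expRN.
  rewrite integral_mkcond; apply: eq_integral => t _.
  rewrite patchE /F/=; case: ifPn.
    by rewrite in_setE/= in_itv/= andbT => ->.
  by rewrite notin_setE/= in_itv/= andbT => /negP/negbTE ->.
transitivity (\int[lambda]_t \int[mu]_v F (v, t)).
  exact: (@fubini_tonelli _ _ _ _ R mu lambda F mF F0).
rewrite [RHS]integral_mkcond; apply: eq_integral => t _.
rewrite patchE; case: ifPn => [_|].
  rewrite -ge0_integralZl//; last 2 first.
  - exact: measurable_sublevel.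
  - exact: measurable_funTS.
  rewrite [RHS]integral_mkcond; apply: eq_integral => v _.
  rewrite patchE /F/=; case: ifPn => h.
    by rewrite mem_set// muleC.
  by rewrite memNset//; exact/negP.
rewrite notin_setE/= in_itv/= andbT => /negP; rewrite -leNgt => t0.
apply: integral0_eq => v _; rewrite /F/= ifN// -leNgt.
exact: le_trans t0 (f0 v).
Qed.

End layer_cake.

(** * The Gamma function with values in the extended reals *)

Section gamma_function.
Context {R : realType}.
Local Open Scope ereal_scope.
Local Notation lambda := (@lebesgue_measure R).

(** Keeping the value +oo possible lets identities be proved before finiteness, which is only
    obtained from the Gaussian integral. *)
Definition egamma (x : R) : \bar R :=
  \int[lambda]_(t in `]0%R, +oo[) (t `^ (x - 1) * expR (- t))%:E.

Lemma GammaE (x : R) : Gamma x = fine (egamma x).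
Proof. by []. Qed.

(** For x < 1 the integrand is singular at 0, so the fundamental theorem is applied on
    [s / (n + 2), s] and the interval grows to ]0, s]. The shift by 2 keeps the left end strictly
    below s. *)
Lemma integral_powRB1 (x s : R) : (0 < x)%R -> (0 < s)%R ->
  \int[lambda]_(t in `]0%R, s]) (x * t `^ (x - 1))%:E = (s `^ x)%:E.
Proof.
move=> x0 s0.
pose F (n : nat) : set R := [set` `[(s / n.+2%:R)%R, s]].
have mF n : measurable (F n) by exact: measurable_itv.
have mp : measurable_fun setT (fun t : R => (x * t `^ (x - 1))%:E).
  by apply/measurable_EFinP; apply: measurable_funM => //; exact: measurable_powR.
have FE : \bigcup_n F n = [set` `]0%R, s]].
  apply/seteqP; split => t /=.
    move=> [n _]; rewrite /F/= !in_itv/= => /andP[h ->]; rewrite andbT.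
    by apply: lt_le_trans h; rewrite divr_gt0.
  rewrite in_itv/= => /andP[t0 ts].
  exists (Num.truncn (s / t)) => //; rewrite /F/= in_itv/= ts andbT.
  rewrite ler_pdivrMr// -ler_pdivrMl// mulrC (le_trans (ltW (truncnS_gt _)))//.
  by rewrite ler_nat.
have nF : nondecreasing_seq F.
  apply/nondecreasing_seqP => n; apply/subsetPset => t; rewrite /F/= !in_itv/=.
  move=> /andP[h ->]; rewrite andbT (le_trans _ h)// ler_pM2l//.
  by rewrite lef_pV2 ?posrE// ler_nat.
have /cvg_unique : \int[lambda]_(t in F n) (x * t `^ (x - 1))%:E
    @[n --> \oo] --> \int[lambda]_(t in `]0%R, s]) (x * t `^ (x - 1))%:E.
  rewrite -FE; apply: ge0_nondecreasing_set_cvg_integral => //.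
    by move=> n; exact: measurable_funTS.
  by move=> n t _; rewrite lee_fin mulr_ge0 ?powR_ge0// ltW.
apply => //.
have cp (y z : R) : (0 < y)%R -> {for y, continuous (fun u : R => (u `^ z)%R)}.
  move=> y0; apply/differentiable_continuous/derivable1_diffP.
  by apply: derivable_powR; rewrite in_itv/= y0.
rewrite (_ : (fun n => _) = fun n => (s `^ x - (s / n.+2%:R) `^ x)%:E).
  apply: cvg_EFin; first by near=> n.
  rewrite -[X in _ --> X]subr0; apply: cvgB; first exact: cvg_cst.
  apply: (@cvg_comp _ _ _ _ _ _ 0%R^'+ _ _ (powR_cvg0 x0)) => A [e /= e0 hA].
  near=> n; apply: hA; last by rewrite divr_gt0.
  rewrite /ball_/= sub0r normrN gtr0_norm ?divr_gt0// ltr_pdivrMr//.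
  rewrite -ltr_pdivrMl// mulrC; apply: (@lt_trans _ _ n%:R).
    by near: n; exact: nbhs_infty_gtr.
  by rewrite ltr_nat.
apply/funext => n.
have sn0 : (0 < s / n.+2%:R)%R by rewrite divr_gt0.
rewrite (continuous_FTC2 (F := @powR R ^~ x)) ?EFinB//.
- by rewrite ltr_pdivrMr// ltr_pMr// ltr1n.
- apply: continuous_in_subspaceT => t; rewrite inE/= in_itv/= => /andP[h _].
  apply: cvgM; first exact: cvg_cst.
  exact: cp (lt_le_trans sn0 h).
- split.
  + move=> t; rewrite in_itv/= => /andP[h _].
    by apply: derivable_powR; rewrite in_itv/= andbT (lt_trans sn0).
  + exact/cvg_at_right_filter/cp.
  + exact/cvg_at_left_filter/cp.
- move=> t; rewrite in_itv/= => /andP[h _]; apply: powR_derive1.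
  by rewrite in_itv/= andbT (lt_trans sn0).
Unshelve. all: by end_near. Qed.

(** Instead of an integration by parts, the layer cake formula with weight x t^(x - 1), extended by
    0 to the negative axis: its mass below t is t^x. The formula asks for a nonnegative exponent on
    the whole line, hence the absolute value. *)
Lemma egammaS (x : R) : (0 < x)%R -> x%:E * egamma x = egamma (x + 1)%R.
Proof.
move=> x0.
pose g (t : R) : \bar R := if (0 < t)%R then (x * t `^ (x - 1))%:E else 0.
have g0 t : 0 <= g t.
  by rewrite /g; case: ifP => // _; rewrite lee_fin mulr_ge0 ?powR_ge0 ?ltW.
have mg : measurable_fun setT g.
  apply: measurable_fun_ifT => //.
    by apply: measurable_fun_ltr => //; exact: measurable_cst.
  by apply/measurable_EFinP; apply: measurable_funM => //; exact: measurable_powR.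
have := @layer_cake R _ _ lambda (fun t => `|t|)%R g (@normr_measurable R setT)
  mg (fun t => normr_ge0 t) g0.
rewrite (_ : \int[lambda]_v _ = x%:E * egamma x); last first.
  rewrite /egamma -ge0_integralZl//; last 3 first.
  - apply/measurable_EFinP; apply: measurable_funTS; apply: measurable_funM.
      exact: measurable_powR.
    by apply: measurableT_comp => //.
  - by move=> t _; rewrite lee_fin mulr_ge0 ?powR_ge0 ?expR_ge0.
  - by rewrite lee_fin ltW.
  rewrite [RHS]integral_mkcond; apply: eq_integral => t _.
  rewrite patchE /g; case: ifPn => t0.
    by rewrite mem_set/= ?in_itv/= ?t0// -!EFinM mulrA gtr0_norm.
  by rewrite memNset ?mul0e//= in_itv/= andbT; exact/negP.
move=> ->; apply: eq_integral => t; rewrite inE/= in_itv/= andbT => t0.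
rewrite addrK mulrC EFinM; congr (_ * _); rewrite -(integral_powRB1 x0 t0).
rewrite -integral_itv_bndo_bndc; last first.
  apply/measurable_EFinP; apply: measurable_funTS.
  by apply: measurable_funM => //; exact: measurable_powR.
rewrite [LHS]integral_mkcond [RHS]integral_mkcond; apply: eq_integral => s _.
rewrite !patchE /g; case: (ltP 0%R s) => s0.
  case: (ltP s t) => st.
    by rewrite !mem_set//= ?in_itv/= ?s0 ?gtr0_norm.
  by rewrite !ifF//; apply/negbTE; rewrite notin_setE/= ?in_itv/= ?gtr0_norm// ?s0 ltNge st.
by rewrite (memNset (A := [set` `]0%R, t[])) ?if_same//= in_itv/= ltNge s0.
Qed.

End gamma_function.

(** * Mass of the slab *)

Section radial_integrals.
Context {R : realType}.
Local Open Scope ereal_scope.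

Lemma integral_vec_lebesgueS k (f : 'cV[R]_k.+1 -> \bar R) :
  measurable_fun setT f -> (forall v, 0 <= f v) ->
  \int[vec_lebesgue k.+1]_v f v
  = \int[lebesgue_measure]_x \int[vec_lebesgue k]_v f (vec_cons (x, v)).
Proof.
move=> mf f0.
pose mu : {measure set (measurableTypeR R * 'cV[R]_k)%type -> \bar R} :=
  (lebesgue_measure \x vec_lebesgue k)%E.
transitivity (\int[mu]_(z in @vec_cons R k @^-1` setT) (f \o @vec_cons R k) z).
  have mc : measurable_fun [set: (measurableTypeR R * 'cV[R]_k)%type]
    (@vec_cons R k) by exact: measurable_vec_cons.
  have h := ge0_integral_pushforward mc mu measurableT mf (fun v _ => f0 v).
  by rewrite -h.
rewrite preimage_setT fubini_tonelli1//=.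
exact: measurableT_comp mf (@measurable_vec_cons R k).
Qed.

Lemma sqr_norm2_cons k (x : R) (v : 'cV[R]_k) :
  (norm2 (vec_cons (x, v)) ^+ 2 = x ^+ 2 + norm2 v ^+ 2)%R.
Proof.
rewrite !sqr_norm2 big_ord_recl mxE unlift_none; congr (_ + _)%R.
by apply: eq_bigr => i _; rewrite mxE liftK.
Qed.

Lemma measurable_sqr_norm2 k : measurable_fun setT (fun v : 'cV[R]_k => norm2 v ^+ 2)%R.
Proof. by apply: measurable_funX; exact: measurable_norm2. Qed.

Lemma integral_gaussian k :
  \int[vec_lebesgue k]_v (expR (- norm2 v ^+ 2))%:E
  = (Num.sqrt pi ^+ k)%:E :> \bar R.
Proof.
elim: k => [|k ih].
  transitivity (\int[dirac (0 : 'cV[R]_0)%R]_v (expR (- norm2 v ^+ 2))%:E) => //.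
  rewrite integral_dirac//; last exact: measurable_expRN (@measurable_sqr_norm2 0).
  by rewrite diracT mul1e norm2_0 expr0n/= oppr0 expR0 expr0.
rewrite integral_vec_lebesgueS//.
  under eq_integral => x _.
    under eq_integral => v _.
      rewrite sqr_norm2_cons opprD expRD EFinM.
      over.
    rewrite ge0_integralZl ?lee_fin ?expR_ge0//.
      by rewrite ih; over.
    exact: measurable_expRN (@measurable_sqr_norm2 k).
  rewrite /= ge0_integralZr//.
  - rewrite (_ : (fun x => _) = EFin \o gauss_fun)// integralT_gauss.
    by rewrite -EFinM exprS.
  - by apply/measurable_EFinP; exact: measurable_gauss_fun.
exact: measurable_expRN (@measurable_sqr_norm2 k.+1).
Qed.

Lemma vec_lebesgue_ball k (t : R) : (0 < t)%R ->
  vec_lebesgue k [set v | (norm2 v < t)%R]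
  = (t ^+ k)%:E * vec_lebesgue k [set v | (norm2 v < 1)%R].
Proof.
move=> t0.
have ti0 : (0 < t^-1)%R by rewrite invr_gt0.
pose f : 'cV[R]_k -> \bar R := EFin \o \1_[set v : 'cV[R]_k | (norm2 v < 1)%R].
have mB s : measurable [set v : 'cV[R]_k | (norm2 v < s)%R].
  exact: measurable_sublevel (@measurable_norm2 R k).
have mf : measurable_fun setT f by apply/measurable_EFinP; exact: measurable_indic.
have f0 v : 0 <= f v by rewrite lee_fin.
have := ge0_integral_affine 0%R ti0 mf f0.
have -> : \int[vec_lebesgue k]_v f v = vec_lebesgue k [set v | (norm2 v < 1)%R].
  by rewrite /f integral_indic// setIT.
rewrite invrK => <-.
transitivity (\int[vec_lebesgue k]_v (\1_[set v | (norm2 v < t)%R] v)%:E).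
  by rewrite integral_indic// setIT.
apply: eq_integral => v _.
rewrite /f/= addr0; congr EFin; rewrite !indicE; congr (_%:R); congr nat_of_bool.
apply/idP/idP; rewrite !inE/= norm2Z gtr0_norm//.
  by rewrite mulrC ltr_pdivrMr// mul1r.
by rewrite mulrC ltr_pdivrMr// mul1r.
Qed.

Lemma egamma_ge0 (x : R) : 0 <= egamma x.
Proof.
by apply: integral_ge0 => t _; rewrite lee_fin mulr_ge0 ?powR_ge0 ?expR_ge0.
Qed.

Local Notation ball_volume k := (vec_lebesgue k [set v : 'cV[R]_k | (norm2 v < 1)%R]).

(** [g] inverts the profile [f]: the sublevel set of level t is the ball of radius [g t], of volume
    t^x times that of the unit ball, and integrating t^x exp(- t) gives [egamma (x + 1)]. It is used
    with f r = r and f r = r^2. *)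
Lemma integral_radial k (f : R -> R) (g : R -> R) (x : R) :
  measurable_fun setT f -> (forall r, 0 <= r -> 0 <= f r)%R ->
  (forall t r, 0 < t -> 0 <= r -> (f r < t) = (r < g t))%R ->
  (forall t, 0 < t -> 0 < g t /\ g t ^+ k = t `^ x)%R ->
  \int[vec_lebesgue k]_v (expR (- f (norm2 v)))%:E
  = ball_volume k * egamma (x + 1)%R.
Proof.
move=> mf f0 fg gx.
have mfn : measurable_fun setT (fun v : 'cV[R]_k => f (norm2 v)).
  exact: measurableT_comp mf (@measurable_norm2 R k).
have := @layer_cake R _ _ (vec_lebesgue k) (fun v => f (norm2 v)) (cst 1)
  mfn (@measurable_cst _ _ _ _ setT 1) (fun v => f0 _ (norm2_ge0 v)).
move=> /(_ (fun=> lee01)) h.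
transitivity (\int[vec_lebesgue k]_v (cst 1 v * (expR (- f (norm2 v)))%:E)).
  by apply: eq_integral => v _; rewrite mul1e.
rewrite h /egamma -ge0_integralZl//; last 2 first.
- apply/measurable_EFinP; apply: measurable_funTS; apply: measurable_funM.
    exact: measurable_powR.
  by apply: measurableT_comp.
- by move=> t _; rewrite lee_fin mulr_ge0 ?powR_ge0 ?expR_ge0.
apply: eq_integral => t; rewrite inE/= in_itv/= andbT => t0.
have [gt0 gtk] := gx t t0.
rewrite integral_cst; last exact: measurable_sublevel mfn.
rewrite mul1e (_ : [set v | _] = [set v | (norm2 v < g t)%R]).
  transitivity ((expR (- t))%:E * ((g t ^+ k)%:E * ball_volume k)).
    by congr (_ * _); exact: vec_lebesgue_ball.
  by rewrite gtk addrK EFinM muleC -muleA muleCA muleA muleC.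
by apply/seteqP; split => v /=; rewrite fg ?norm2_ge0.
Qed.

Lemma integral_expRN_norm2_ball k :
  \int[vec_lebesgue k]_v (expR (- norm2 v))%:E
  = ball_volume k * egamma (k%:R + 1)%R.
Proof.
apply: (@integral_radial k id id) => //.
by move=> t t0; split => //; rewrite powR_mulrn// ltW.
Qed.

Lemma integral_gaussian_ball k :
  ball_volume k * egamma (k%:R / 2 + 1)%R = (Num.sqrt pi ^+ k)%:E.
Proof.
rewrite -integral_gaussian; apply/esym.
apply: (@integral_radial k (fun r => r ^+ 2)%R (@Num.sqrt R)).
- by apply: measurable_funX.
- by move=> r _; exact: sqr_ge0.
- move=> t r t0 r0; rewrite -[in RHS](ger0_norm r0) -sqrtr_sqr.
  by rewrite ltr_sqrt.
- move=> t t0; rewrite sqrtr_gt0; split => //.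
  by rewrite -powR12_sqrt ?ltW// -powR_mulrn ?powR_ge0// -powRrM mulrC.
Qed.

Lemma sqrt_pi_gt0 : (0 < Num.sqrt pi :> R)%R.
Proof. by rewrite sqrtr_gt0 pi_gt0. Qed.

(** The Gaussian identity gives a positive finite value to the product of ball volume and [egamma];
    this lemma extracts from it that both factors are positive and finite. *)
Lemma mule_fin_gt0 (x y : \bar R) : 0 <= x -> 0 <= y ->
  0 < x * y < +oo -> exists2 r : R, (0 < r)%R & x = r%:E.
Proof.
case: x => [x| |]//; case: y => [y| |]//; rewrite ?lee_fin.
- move=> x0 y0; rewrite -EFinM lte_fin => /andP[xy _]; exists x => //.
  by rewrite lt_def x0 andbT; apply: contraTneq xy => ->; rewrite mul0r ltxx.
- rewrite le_eqVlt => /predU1P[<-|x0 _]; first by rewrite mul0e ltxx.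
  by rewrite gt0_muley ?lte_fin// ltxx andbF.
- move=> _; rewrite le_eqVlt => /predU1P[<-|y0]; first by rewrite mule0 ltxx.
  by rewrite gt0_mulye ?lte_fin// ltxx andbF.
- by move=> _ _; rewrite mulyy ltxx andbF.
Qed.

Lemma ball_volume_fin k : exists2 r : R, (0 < r)%R & ball_volume k = r%:E.
Proof.
apply: (@mule_fin_gt0 _ (egamma (k%:R / 2 + 1)%R)) => //; first exact: egamma_ge0.
by rewrite integral_gaussian_ball ltry lte_fin exprn_gt0// sqrt_pi_gt0.
Qed.

Lemma egamma_half_fin k :
  exists2 r : R, (0 < r)%R & egamma (k%:R / 2 + 1)%R = r%:E.
Proof.
apply: (@mule_fin_gt0 _ (ball_volume k)) => //; first exact: egamma_ge0.
by rewrite muleC integral_gaussian_ball ltry lte_fin exprn_gt0// sqrt_pi_gt0.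
Qed.

Lemma GammaS_half k : (0 < k)%N -> exists2 r : R, (0 < r)%R &
  Gamma (k%:R / 2)%R = r /\ egamma (k%:R / 2 + 1)%R = (k%:R / 2 * r)%:E.
Proof.
move=> k0; have k20 : (0 < k%:R / 2 :> R)%R by rewrite divr_gt0// ltr0n.
have [r r0 rE] := egamma_half_fin k.
have := egammaS k20; rewrite rE GammaE.
have := egamma_ge0 (k%:R / 2)%R.
case: (egamma (k%:R / 2)%R) => [y| |]//= _; last by rewrite gt0_muley ?lte_fin.
move=> /esym[ry]; exists y => //; last by rewrite -ry.
by rewrite -(pmulr_rgt0 _ k20) -ry.
Qed.

(** The volume of the unit ball is eliminated between the Gaussian and the exponential radial
    integrals. Gamma at the integer k is reached as Gamma at the half-integer 2k / 2. *)
Lemma integral_expRN_norm2 k : (0 < k)%N ->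
  \int[vec_lebesgue k]_v (expR (- norm2 v))%:E
  = (2 * Num.sqrt pi ^+ k * Gamma k%:R / Gamma (k%:R / 2))%:E :> \bar R.
Proof.
move=> k0; have [r r0 [-> hr]] := GammaS_half k0.
have := GammaS_half (k := k * 2); rewrite muln_gt0 k0 => /(_ isT)[s s0].
rewrite natrM mulfK// => -[-> hs].
have := integral_gaussian_ball k; rewrite hr integral_expRN_norm2_ball hs.
have [v v0 ->] := ball_volume_fin k; rewrite -!EFinM => -[vE]; congr EFin.
have kn0 : (k%:R != 0 :> R)%R by rewrite pnatr_eq0 -lt0n.
by rewrite -vE; field; rewrite gt_eqF.
Qed.

End radial_integrals.

Section split_norms.
Context {R : realType} {p : nat}.
Local Open Scope ereal_scope.

(** The norm of the subvector of coordinates labelled [j], written without changing the dimension,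
    so that the label map can be restricted during an induction on the set of labels. *)
Definition label_norm q (c : 'I_q -> 'I_p) (j : 'I_p) (v : 'cV[R]_q) : R :=
  Num.sqrt (\sum_(k | c k == j) v k ord0 ^+ 2).

Lemma measurable_label_norm q (c : 'I_q -> 'I_p) (S : {set 'I_p}) :
  measurable_fun setT (fun v : 'cV[R]_q => \sum_(j in S) label_norm c j v)%R.
Proof.
rewrite (_ : (fun _ => _) = fun v : 'cV[R]_q =>
    (\sum_j if j \in S then label_norm c j v else 0)%R); last first.
  by apply/funext => v; exact: big_mkcond.
apply: measurable_sum => j; case: (j \in S); last exact: measurable_cst.
apply: (@measurableT_comp _ _ _ _ _ _ (@Num.sqrt R) _
  (fun v : 'cV[R]_q => \sum_(k | c k == j) v k ord0 ^+ 2)%R).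
  by apply: continuous_measurable_fun; exact: sqrt_continuous.
rewrite (_ : (fun _ => _) = fun v : 'cV[R]_q =>
    (\sum_k if c k == j then v k ord0 ^+ 2 else 0)%R); last first.
  by apply/funext => v; exact: big_mkcond.
apply: measurable_sum => k; case: (c k == j); last exact: measurable_cst.
by apply: measurable_funX; exact: measurable_coord.
Qed.

(** Induction on the set of labels: the coordinates labelled [j] are separated from the others by
    [glue], the exponent splits accordingly, and Tonelli produces the factor of [j]. *)
Lemma integral_expRN_label_norm q (c : 'I_q -> 'I_p) (S : {set 'I_p}) :
  (forall k, c k \in S) ->
  \int[vec_lebesgue q]_v (expR (- \sum_(j in S) label_norm c j v))%:E
  = \prod_(j in S) \int[vec_lebesgue #|[set k | c k == j]%SET|]_v
      (expR (- norm2 v))%:E.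
Proof.
have [n] := ubnP #|S|; elim: n => // n ih in q c S *.
have [->|[j jS]] := set_0Vmem S.
  move=> _ cS; rewrite big_set0.
  (* Every coordinate has its label in [S], so an empty [S] leaves only the Dirac mass on the
     zero-dimensional space. *)
  have q0 : q = 0%N.
    by case: q c cS => // q c /(_ ord0); rewrite finset.inE.
  case: _ / (esym q0) c cS => c cS.
  transitivity (\int[dirac (0 : 'cV[R]_0)%R]_v (1 : \bar R)).
    by apply: eq_integral => v _; rewrite big_set0 oppr0 expR0.
  by rewrite integral_dirac// diracT mul1e.
rewrite (cardsD1 j) jS add1n ltnS => Sn cS.
pose A := [set k | c k == j]%SET.
pose s (x : 'I_#|A| + 'I_#|~: A|) : 'I_q :=
  match x with inl a => enum_val a | inr b => enum_val b end.
have csl a : c (s (inl a)) = j.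
  by apply/eqP; have := enum_valP a; rewrite finset.inE.
have csr b : c (s (inr b)) != j.
  by have := enum_valP b; rewrite !finset.inE.
have [t st ts] : bijective s.
  apply: inj_card_bij; last by rewrite card_sum !card_ord cardsC card_ord.
  move=> [a|b] [a'|b'] h.
  - by congr inl; exact: enum_val_inj h.
  - by have := csl a; rewrite h => /eqP; rewrite (negbTE (csr b')).
  - by have := csr b; rewrite h csl eqxx.
  - by congr inr; exact: enum_val_inj h.
have tb : bijective t by exists s.
have glueE (u : 'cV[R]__) (w : 'cV[R]__) x :
    glue t (u, w) (s x) ord0 = match x with inl a => u a ord0 | inr b => w b ord0 end.
  by rewrite mxE st.
have normj u w : label_norm c j (glue t (u, w)) = norm2 u.
  rewrite /label_norm /norm2 (reindex s) /=; last by exists t => i _.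
  rewrite big_sumType/= [X in (_ + X)%R]big1 ?addr0; last first.
    by move=> b /eqP h; have := csr b; rewrite h eqxx.
  congr Num.sqrt; rewrite (eq_bigl predT); last by move=> a; rewrite csl eqxx.
  by apply: eq_bigr => a _; rewrite (glueE u w (inl a)).
pose c' (b : 'I_#|~: A|) := c (enum_val b).
have normj' i u w : i != j -> label_norm c i (glue t (u, w)) = label_norm c' i w.
  move=> ij; rewrite /label_norm (reindex s) /=; last by exists t => k _.
  rewrite big_sumType/= big1 ?add0r; last first.
    by move=> a /eqP h; have := csl a; rewrite h => /eqP; rewrite (negbTE ij).
  by congr Num.sqrt; apply: eq_bigr => a _; rewrite (glueE u w (inr a)).
rewrite (ge0_integral_glue tb); last first.
  - by move=> v; rewrite lee_fin expR_ge0.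
  - exact: measurable_expRN (measurable_label_norm c S).
under eq_integral => u _.
  under eq_integral => w _.
    rewrite (bigD1 j)//= normj opprD expRD EFinM.
    rewrite (eq_bigl (mem (S :\ j)%SET)); last first.
      by move=> i; rewrite !finset.inE andbC.
    rewrite (eq_bigr (fun i => label_norm c' i w)); last first.
      by move=> i; rewrite !finset.inE => /andP[ij _]; exact: normj'.
    over.
  rewrite ge0_integralZl ?lee_fin ?expR_ge0//; last first.
    exact: measurable_expRN (measurable_label_norm c' _).
  rewrite (ih _ c' (S :\ j)%SET)//; last first.
    by move=> b; rewrite !finset.inE cS andbT; exact: csr.
  over.
rewrite /= ge0_integralZr//; last 2 first.
- exact: measurable_expRN (@measurable_norm2 R _).
- by apply: prode_ge0 => i _; apply: integral_ge0 => v _; rewrite lee_fin expR_ge0.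
rewrite [RHS](bigD1 j)//=; congr (_ * _).
apply: eq_big => [i|i /=]; first by rewrite !finset.inE andbC.
rewrite !finset.inE => /andP[ij _].
suff -> : #|[set k | c' k == i]%SET| = #|[set k | c k == i]%SET| by [].
rewrite -[LHS](card_imset _ (@enum_val_inj _ _)); apply: eq_card => k.
rewrite finset.inE; apply/imsetP/idP => [[b + ->]|/eqP ck].
  by rewrite finset.inE.
have kA : k \in (~: A)%SET by rewrite !finset.inE ck.
by exists (enum_rank_in kA k); rewrite ?finset.inE /c' enum_rankK_in// ck.
Qed.

End split_norms.

Section slab_mass.
Context {R : realType} {d p : nat} (G : 'I_p -> {set 'I_d}).
Hypothesis GP : group_partition G.
Local Open Scope ereal_scope.

Definition slab_constant (lam : R) (S : {set 'I_p}) : R :=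
  ((lam / Num.sqrt pi) ^+ #|coords G S|
  * ((\prod_(j in S) Gamma (#|G j|%:R / 2))
     / (2 ^+ #|S| * \prod_(j in S) Gamma #|G j|%:R)))%R.

Lemma card_group_gt0 j : (0 < #|G j|)%N.
Proof. by rewrite card_gt0; case: GP. Qed.

Lemma Gamma_half_gt0 k : (0 < k)%N -> (0 < Gamma (k%:R / 2) :> R)%R.
Proof. by move=> k0; have [r r0 [-> _]] := @GammaS_half R k k0. Qed.

Lemma Gamma_nat_gt0 k : (0 < k)%N -> (0 < Gamma k%:R :> R)%R.
Proof.
move=> k0; have := @Gamma_half_gt0 (k * 2); rewrite natrM mulfK//.
by apply; rewrite muln_gt0 k0.
Qed.

Lemma slab_constant_ge0 lam S : (0 <= lam)%R -> (0 <= slab_constant lam S)%R.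
Proof.
move=> lam0; rewrite mulr_ge0// ?exprn_ge0 ?divr_ge0 ?sqrtr_ge0//.
- by apply: prodr_ge0 => j _; exact: Gamma_ge0.
- by rewrite mulr_ge0 ?exprn_ge0// prodr_ge0// => j _; exact: Gamma_ge0.
Qed.

Lemma card_coords S : #|coords G S| = (\sum_(j in S) #|G j|)%N.
Proof.
rewrite /coords -sum1_card -(eq_bigr _ (fun j _ => sum1_card (mem (G j)))).
rewrite (partition_big (group_of GP) (mem S)) /=; last first.
  by move=> i /bigcupP[j jS]; rewrite group_ofP => /eqP ->.
apply: eq_bigr => j jS; apply: eq_bigl => i; rewrite -(group_ofP GP).
apply/andP/idP => [[]//|ij]; split => //; apply/bigcupP; by exists j.
Qed.

Lemma extend_enum_val (S : {set 'I_p}) (v : 'cV[R]_#|coords G S|) k :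
  extend v (enum_val k) ord0 = v k ord0.
Proof.
rewrite mxE (bigD1 k)//= big1 ?addr0// => l /andP[/eqP /enum_val_inj ->].
by rewrite eqxx.
Qed.

(** For a = lam and b = 0 this is the normalisation of h_S. Scaling yields the power of lam / a, and
    translation invariance any centre, even one not supported on [S], since only the groups of [S]
    are measured. *)
Lemma integral_expRN_norm21 (S : {set 'I_p}) (a lam : R) (b : 'cV[R]_d) :
  (0 < a)%R -> (0 <= lam)%R ->
  (slab_constant lam S)%:E * \int[vec_lebesgue #|coords G S|]_v
    (expR (- (a * norm21 G S (extend v - b))))%:E
  = ((lam / a) ^+ #|coords G S|)%:E.
Proof.
move=> a0 lam0.
pose c (k : 'I_#|coords G S|) := group_of GP (enum_val k).
pose b' : 'cV[R]_#|coords G S| := \col_k b (enum_val k) ord0.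
have cS k : c k \in S.
  have /bigcupP[j jS] := enum_valP k.
  by rewrite (group_ofP GP) /c => /eqP ->.
have normE v : (a * norm21 G S (extend v - b)
    = \sum_(j in S) label_norm c j (a *: v + (- (a *: b'))))%R.
  rewrite /norm21 mulr_sumr; apply: eq_bigr => j jS.
  rewrite -[X in (X * _)%R](gtr0_norm a0) -norm2Z /norm2 /label_norm; congr Num.sqrt.
  transitivity (\sum_(i in G j) (a * (extend v i ord0 - b i ord0)) ^+ 2)%R.
    rewrite sum_enum_val; apply: eq_bigr => l _.
    have E (u : 'cV[R]_d) :
      ((a *: group_sub G (u - b) j) l ord0 = a * (u (enum_val l) ord0 - b (enum_val l) ord0))%R.
      by rewrite !mxE.
    by rewrite E.
  rewrite (eq_bigl (fun i => (i \in coords G S) && (group_of GP i == j))); last first.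
    move=> i; rewrite (group_ofP GP); case: eqP => [ij|_]; last by rewrite andbF.
    rewrite andbT; apply/esym/bigcupP; exists j => //.
    by rewrite (group_ofP GP); exact/eqP.
  rewrite big_enum_val_cond/=; apply: eq_bigr => k _.
  by rewrite extend_enum_val !mxE mulrBr.
under eq_integral => v _ do rewrite normE.
have mf := measurable_expRN (@measurable_label_norm R p _ c S).
have f0 (v : 'cV[R]_#|coords G S|) :
    0 <= (expR (- \sum_(j in S) label_norm c j v))%:E.
  by rewrite lee_fin expR_ge0.
have := ge0_integral_affine (- (a *: b'))%R a0 mf f0; rewrite /= => ->.
rewrite integral_expRN_label_norm//.
have cardc j : j \in S -> #|[set k | c k == j]%SET| = #|G j|.
  move=> jS; rewrite -[LHS](card_imset _ (@enum_val_inj _ _)); apply: eq_card => i.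
  rewrite (group_ofP GP); apply/imsetP/idP => [[k + ->]|/eqP ij].
    by rewrite finset.inE.
  have iS : i \in coords G S.
    by apply/bigcupP; exists j => //; rewrite (group_ofP GP) ij.
  by exists (enum_rank_in iS i); rewrite ?finset.inE /c enum_rankK_in// ij.
rewrite (eq_bigr (fun j => (2 * Num.sqrt pi ^+ #|G j| * Gamma #|G j|%:R
    / Gamma (#|G j|%:R / 2))%:E)); last first.
  by move=> j jS; rewrite cardc// integral_expRN_norm2// card_group_gt0.
rewrite prodEFin -!EFinM; congr EFin.
rewrite big_split/= prodfV big_split/= big_split/= prodr_const.
rewrite -(big_morph (fun n => Num.sqrt pi ^+ n)%R (id1 := 1%R) (op1 := *%R)
  (exprD _) (expr0 _)) -card_coords.
rewrite /slab_constant !exprMn !exprVn.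
have g1 : (\prod_(j in S) Gamma (#|G j|%:R / 2) != 0 :> R)%R.
  apply/prodf_neq0 => j _; rewrite gt_eqF// Gamma_half_gt0// card_group_gt0//.
have g2 : (\prod_(j in S) Gamma #|G j|%:R != 0 :> R)%R.
  apply/prodf_neq0 => j _; rewrite gt_eqF// Gamma_nat_gt0// card_group_gt0//.
have pi0 : (Num.sqrt pi ^+ #|coords G S| != 0 :> R)%R.
  by rewrite expf_neq0// gt_eqF// sqrt_pi_gt0.
have a0' : (a ^+ #|coords G S| != 0)%R by rewrite expf_neq0// gt_eqF.
have t0 : ((2 : R) ^+ #|S| != 0)%R by rewrite expf_neq0.
move: g1 g2 pi0 a0' t0; move: (\prod_(j in S) Gamma (#|G j|%:R / 2))%R.
move: (\prod_(j in S) Gamma #|G j|%:R)%R (Num.sqrt pi ^+ _)%R (a ^+ _)%R (2 ^+ _)%R.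
by move=> x y z t u x0 y0 z0 t0 u0; field; rewrite x0 y0 z0 t0 u0.
Qed.

End slab_mass.

(** * Exponential inequalities *)

Section exponential_inequalities.
Context {R : realType}.
Implicit Types x y z t : R.

Lemma is_derive_ge0_le (f df : R -> R) t :
  (forall x, is_derive x (1 : R) f (df x)) -> (forall x, 0 <= x -> 0 <= df x) ->
  0 <= t -> f 0 <= f t.
Proof.
move=> fdf df0; rewrite le_eqVlt => /predU1P[<-//|t0].
apply: (@ger0_derive1_le_cc _ f 0 t).
- by move=> x _; exact: ex_derive.
- move=> x; rewrite in_itv/= => /andP[x0 _]; rewrite derive1E derive_val.
  by rewrite df0// ltW.
- apply: derivable_within_continuous => x _; exact: ex_derive.
- by rewrite in_itv/= lexx ltW.
- by rewrite in_itv/= lexx ltW.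
- exact: ltW.
Qed.

Lemma expR_ge_quadratic t : 0 <= t -> 1 + t + t ^+ 2 / 2 <= expR t.
Proof.
move=> t0; rewrite -subr_ge0.
have := @is_derive_ge0_le (fun x => expR x - (1 + x + x ^+ 2 / 2))
  (fun x => expR x - (1 + x)) t.
rewrite expR0 expr0n/= mul0r !addr0 subrr; apply => // x.
  by apply: is_derive_eq; rewrite /GRing.scale/=; lra.
by move=> _; rewrite subr_ge0 expR_ge1Dx.
Qed.

(** The Padé bound exp(t) <= (2 + t) / (2 - t), cleared of its denominator so that it holds for all
    t >= 0. After multiplication by exp(- t) the difference of the sides has derivative 1 - (1 + t)
    exp(- t) >= 0. *)
Lemma expR_pade t : 0 <= t -> expR t * (2 - t) <= 2 + t.
Proof.
move=> t0; rewrite -subr_ge0.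
suff h : 0 <= (2 + t) * expR (- t) - (2 - t).
  have := mulr_ge0 h (expR_ge0 t); rewrite mulrBl -mulrA -expRD addNr expR0 mulr1.
  by rewrite (mulrC (2 - t)).
have := @is_derive_ge0_le (fun x => (2 + x) * expR (- x) - (2 - x))
  (fun x => 1 - (1 + x) * expR (- x)) t.
have -> : (2 + 0) * expR (- 0) - (2 - 0) = 0 :> R.
  by rewrite oppr0 expR0; ring.
apply => // x.
  by apply: is_derive_eq; rewrite /GRing.scale/=; ring.
move=> x0; rewrite subr_ge0 expRN ler_pdivrMr ?expR_gt0// mul1r.
exact: expR_ge1Dx.
Qed.

(** For z < 0 the left side equals (2 + z) / (2 - z), and the claim is the Padé bound at - z. The
    denominator, only linear in |z|, is the source of the linear growth of the drift. *)
Lemma expR_sub_linear_ge z : 1 + z + z ^+ 2 / (2 + `|z|) <= expR z.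
Proof.
have [z0|z0] := leP 0 z.
  rewrite (le_trans _ (expR_ge_quadratic z0))// lerD2l.
  rewrite ler_wpM2l ?sqr_ge0// lef_pV2 ?posrE//.
  by have := normr_ge0 z; lra.
rewrite ltr0_norm//.
have t0 : 0 <= - z by lra.
have := expR_pade t0; rewrite expRN opprK -ler_pdivlMl ?invr_gt0 ?expR_gt0//.
rewrite invrK => h; rewrite -(ler_pM2r (_ : 0 < 2 - z)); last by lra.
have -> : (1 + z + z ^+ 2 / (2 - z)) * (2 - z) = 2 + z.
  by field; lra.
by have := expR_gt0 z; lra.
Qed.

(** The Padé bound at t = 2 y / (2 + y), for which (2 + t) / (2 - t) = 1 + y. *)
Lemma ln1D_ge y : 0 <= y -> 2 * y / (2 + y) <= ln (1 + y).
Proof.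
move=> y0; rewrite -ler_expR lnK ?posrE; last by lra.
have y2 : 0 < 2 + y by lra.
have t0 : 0 <= 2 * y / (2 + y) by rewrite divr_ge0//; lra.
have := expR_pade t0.
have -> : 2 - 2 * y / (2 + y) = 4 / (2 + y) by field; lra.
have -> : 2 + 2 * y / (2 + y) = (4 / (2 + y)) * (1 + y) by field; lra.
by rewrite mulrC ler_pM2l// divr_gt0.
Qed.

Lemma expR_le_chord t u : 0 <= t <= 1 -> expR (t * u) <= 1 + t * (expR u - 1).
Proof.
move=> /andP[t0 t1].
have h1 := expR_ge1Dx ((1 - t) * u); have h2 := expR_ge1Dx (- (t * u)).
have e0 := expR_ge0 (t * u).
have E1 : expR u = expR (t * u) * expR ((1 - t) * u).
  by rewrite -expRD; congr expR; ring.
have E2 : 1 = expR (t * u) * expR (- (t * u)) by rewrite -expRD subrr expR0.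
rewrite (_ : 1 + _ = expR (t * u) * (t * expR ((1 - t) * u) + (1 - t) * expR (- (t * u)))).
  rewrite ler_peMr//.
  have : t * (1 + (1 - t) * u) <= t * expR ((1 - t) * u) by rewrite ler_wpM2l.
  have : (1 - t) * (1 - t * u) <= (1 - t) * expR (- (t * u)).
    by rewrite ler_wpM2l// subr_ge0.
  by lra.
transitivity (t * (expR (t * u) * expR ((1 - t) * u))
  + (1 - t) * (expR (t * u) * expR (- (t * u)))); last by ring.
by rewrite -E1 -E2; ring.
Qed.

(** Under a centred law the linear term integrates to 0, so that a bound on z^2 becomes a
    sub-Gaussian bound on the moment generating function. *)
Lemma expR_le_addsqr z : expR z <= z + expR (z ^+ 2).
Proof.
have := expR_ge1Dx (z ^+ 2) => h.
have [z1|z1] := leP 1 z.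
  have : expR z <= expR (z ^+ 2) by rewrite ler_expR expr2 ler_peMr//; lra.
  by lra.
have [z0|z0] := leP 0 z.
  have hp := expR_pade z0.
  suff : expR z <= 1 + z + z ^+ 2 by lra.
  rewrite -(ler_pM2r (_ : 0 < 2 - z)); last by lra.
  rewrite (le_trans hp)//.
  have : 0 <= z ^+ 2 * (1 - z) by rewrite mulr_ge0 ?sqr_ge0//; lra.
  by nra.
have t0 : 0 <= - z by lra.
have hq := expR_ge_quadratic t0; rewrite expRN in hq.
suff : expR z <= 1 + z + z ^+ 2 by lra.
have e0 := expR_gt0 z.
have q0 : 0 < 1 - z + z ^+ 2 / 2 by have := sqr_ge0 z; lra.
rewrite -lef_pV2 ?posrE//; last by have := sqr_ge0 z; nra.
rewrite (le_trans _ hq)// sqrrN -[leRHS]mulr1 -ler_pdivrMl//.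
rewrite mulrC -invfM -[leRHS]invr1 lef_pV2 ?posrE//; last first.
  by rewrite mulr_gt0//; have := sqr_ge0 z; nra.
have := sqr_ge0 z; nra.
Qed.

End exponential_inequalities.

Section centered_exponential_moments.
Context {R : realType} {I : finType} (w a : I -> R).
Hypothesis w0 : forall i, 0 <= w i.
Hypothesis w1 : \sum_i w i = 1.

Definition wmean : R := \sum_i w i * a i.

Lemma sum_wmeanB : \sum_i w i * (a i - wmean) = 0.
Proof.
under eq_bigr do rewrite mulrBr.
by rewrite sumrB -mulr_suml w1 mul1r subrr.
Qed.

Lemma wmean_dist c : (forall i k, `|a i - a k| <= c) ->
  forall i, `|a i - wmean| <= c.
Proof.
move=> ac i.
have -> : a i - wmean = \sum_k w k * (a i - a k).
  under eq_bigr do rewrite mulrBr.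
  by rewrite sumrB -mulr_suml w1 mul1r.
rewrite (le_trans (ler_norm_sum _ _ _))//.
rewrite -[leRHS]mul1r -w1 mulr_suml; apply: ler_sum => k _.
by rewrite normrM ger0_norm ?w0// ler_wpM2l.
Qed.

Lemma sum_expR_gt0 (z : I -> R) : 0 < \sum_i w i * expR (z i).
Proof.
rewrite lt_def sumr_ge0 ?andbT; last by move=> i _; rewrite mulr_ge0 ?expR_ge0.
apply/negP; rewrite psumr_eq0; last by move=> i _; rewrite mulr_ge0 ?expR_ge0.
move=> /allP h; suff : \sum_i w i = 0 by rewrite w1 => /eqP; rewrite oner_eq0.
rewrite big1// => i _; have := h i (mem_index_enum i).
by rewrite /= mulf_eq0 expR_eq0 orbF => /eqP.
Qed.

(** Convexity of the cumulant generating function, which vanishes at 0. Subtracting ln M normalises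
    the exponential moment at t = 1, and the chord inequality applies termwise. *)
Lemma ln_sum_expR_scale (z : I -> R) t : 0 <= t <= 1 ->
  ln (\sum_i w i * expR (t * z i)) <= t * ln (\sum_i w i * expR (z i)).
Proof.
move=> t01; set M := \sum_i w i * expR (z i).
have M0 : 0 < M by exact: sum_expR_gt0.
rewrite -ler_expR lnK ?posrE ?sum_expR_gt0//.
have -> : \sum_i w i * expR (t * z i) =
    expR (t * ln M) * \sum_i w i * expR (t * (z i - ln M)).
  rewrite mulr_sumr; apply: eq_bigr => i _.
  by rewrite mulrCA -expRD; congr (_ * expR _); ring.
rewrite ler_piMr ?expR_ge0//.
apply: (@le_trans _ _ (\sum_i w i * (1 + t * (expR (z i - ln M) - 1)))).
  by apply: ler_sum => i _; rewrite ler_wpM2l// expR_le_chord.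
have -> : \sum_i w i * (1 + t * (expR (z i - ln M) - 1)) =
    (1 - t) * \sum_i w i + t / M * \sum_i w i * expR (z i).
  rewrite !mulr_sumr -big_split/=; apply: eq_bigr => i _.
  rewrite expRB lnK ?posrE//; field; lra.
by rewrite w1 -/M mulfVK ?gt_eqF//; lra.
Qed.

(** Summing the quadratic minorant of exp kills the linear term; then the logarithm is bounded below
    by a Padé fraction, and the variance in its denominator by r^2. *)
Lemma ln_sum_expR_bernstein (z : I -> R) r : 0 <= r ->
  (forall i, `|z i| <= r) -> \sum_i w i * z i = 0 ->
  (\sum_i w i * z i ^+ 2) / (2 + r + r ^+ 2 / 2) <= ln (\sum_i w i * expR (z i)).
Proof.
move=> r0 zr z0; set V := \sum_i w i * z i ^+ 2.
have V0 : 0 <= V by apply: sumr_ge0 => i _; rewrite mulr_ge0 ?sqr_ge0.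
have Vr : V <= r ^+ 2.
  rewrite -[leRHS]mul1r -w1 mulr_suml; apply: ler_sum => i _.
  by rewrite ler_wpM2l// -real_normK ?num_real// lerXn2r ?nnegrE.
have y0 : 0 <= V / (2 + r) by rewrite divr_ge0//; lra.
have E : 1 + V / (2 + r) <= \sum_i w i * expR (z i).
  apply: (@le_trans _ _ (\sum_i w i * (1 + z i + z i ^+ 2 / (2 + r)))).
    under eq_bigr do rewrite !mulrDr mulrA mulr1.
    by rewrite !big_split/= w1 z0 addr0 -mulr_suml.
  apply: ler_sum => i _; rewrite ler_wpM2l// (le_trans _ (expR_sub_linear_ge _))//.
  rewrite lerD2l ler_wpM2l ?sqr_ge0// lef_pV2 ?posrE; last 2 first.
  - by lra.
  - by have := normr_ge0 (z i); lra.
  by rewrite lerD2l.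
apply: (@le_trans _ _ (ln (1 + V / (2 + r)))); last first.
  by rewrite ler_ln ?posrE ?sum_expR_gt0//; lra.
apply: le_trans (ln1D_ge y0).
have -> : 2 * (V / (2 + r)) / (2 + V / (2 + r)) = V / (2 + r + V / 2).
  by field; rewrite !gt_eqF//; lra.
by rewrite ler_wpM2l// lef_pV2 ?posrE//; lra.
Qed.

(** The denominator above is quadratic in r, which is harmless for r <= 1. For larger r the variable
    is shrunk to radius 1 and convexity scales the bound back, leaving the linear denominator 7 r /
    2. *)
Lemma ln_sum_expR_ge (z : I -> R) r : 0 <= r ->
  (forall i, `|z i| <= r) -> \sum_i w i * z i = 0 ->
  (\sum_i w i * z i ^+ 2) / (2 + 4 * r) <= ln (\sum_i w i * expR (z i)).
Proof.
move=> r0 zr z0; set V := \sum_i w i * z i ^+ 2.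
have V0 : 0 <= V by apply: sumr_ge0 => i _; rewrite mulr_ge0 ?sqr_ge0.
have [r1|r1] := leP r 1.
  rewrite (le_trans _ (ln_sum_expR_bernstein r0 zr z0))//.
  by rewrite ler_wpM2l// lef_pV2 ?posrE//; nra.
have rp : 0 < r by lra.
have ti : 0 <= r^-1 <= 1 by rewrite invr_ge0 r0/= invf_le1// ltW.
have := ln_sum_expR_scale z ti; rewrite ler_pdivlMl// => h.
rewrite (le_trans _ h)//.
have zr' i : `|r^-1 * z i| <= 1.
  by rewrite normrM gtr0_norm ?invr_gt0// ler_pdivrMl// mulr1.
have z0' : \sum_i w i * (r^-1 * z i) = 0.
  by under eq_bigr do rewrite mulrCA; rewrite -mulr_sumr z0 mulr0.
have := ln_sum_expR_bernstein ler01 zr' z0'.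
rewrite -(ler_pM2l rp) => /(le_trans _); apply.
have -> : \sum_i w i * (r^-1 * z i) ^+ 2 = V / r ^+ 2.
  by rewrite mulr_suml; apply: eq_bigr => i _; rewrite exprMn exprVn; ring.
have -> : r * (V / r ^+ 2 / (2 + 1 + 1 ^+ 2 / 2)) = V / (r * (7 / 2)).
  by field; rewrite gt_eqF.
by rewrite ler_wpM2l// lef_pV2 ?posrE//; lra.
Qed.

Lemma sum_expR_le (z : I -> R) c :
  (forall i, z i ^+ 2 <= c) -> \sum_i w i * z i = 0 ->
  \sum_i w i * expR (z i) <= expR c.
Proof.
move=> zc z0; apply: (@le_trans _ _ (\sum_i w i * (z i + expR c))).
  apply: ler_sum => i _; rewrite ler_wpM2l// (le_trans (expR_le_addsqr _))//.
  by rewrite lerD2l ler_expR.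
under eq_bigr do rewrite mulrDr.
by rewrite big_split/= z0 add0r -mulr_suml w1 mul1r.
Qed.

End centered_exponential_moments.

(** * Square roots of positive semidefinite matrices *)

Section psd_square_root.
Local Open Scope complex_scope.
Context {R : realType}.

Lemma poly_interpolation (F : fieldType) (s : seq F) (f : F -> F) :
  exists q : {poly F}, {in s, forall x, q.[x] = f x}.
Proof.
elim: s => [|x s [q qs]]; first by exists 0.
have [xs|xs] := boolP (x \in s).
  by exists q => y; rewrite in_cons => /predU1P[->|]; exact: qs.
pose w : {poly F} := \prod_(y <- s) ('X - y%:P).
have wx : w.[x] != 0 by rewrite -/(root w x) root_prod_XsubC.
exists (q + ((f x - q.[x]) / w.[x]) *: w) => y; rewrite in_cons hornerD hornerZ.
move=> /predU1P[->|ys]; first by rewrite divfK// subrKC.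
have /eqP -> : w.[y] == 0 by rewrite -/(root w y) root_prod_XsubC.
by rewrite mulr0 addr0 qs.
Qed.

Lemma trmx_horner_mx n (A : 'M[R]_n.+1) (q : {poly R}) :
  (horner_mx A q)^T = horner_mx A^T q.
Proof.
elim/poly_ind: q => [|q c ih]; first by rewrite !rmorph0 trmx0.
rewrite !(rmorphD, rmorphM)/= !(horner_mx_X, horner_mx_C).
rewrite linearD/= trmx_mul ih tr_scalar_mx; congr (_ + _).
transitivity (horner_mx A^T ('X * q)); first by rewrite rmorphM/= horner_mx_X.
by rewrite mulrC rmorphM/= horner_mx_X.
Qed.

Lemma psd_eigenvalue_ge0 n (W : 'M[R]_n) (x : R) :
  psd W -> eigenvalue W x -> 0 <= x.
Proof.
move=> [_ W0] /eigenvalueP[v vW v0].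
have := W0 v^T; rewrite trmxK vW -scalemxAl mxE.
have -> : (v *m v^T) ord0 ord0 = norm2 v^T ^+ 2.
  by rewrite -dot_norm2 dotE trmxK.
rewrite pmulr_lge0// exprn_gt0// norm2_gt0.
by apply: contra_neq v0 => v0; rewrite -(trmxK v) v0 trmx0.
Qed.

Lemma horner_mx_diagonalizable (C : fieldType) n (A P : 'M[C]_n.+1)
    (D : 'rV[C]_n.+1) (q : {poly C}) :
  P \in unitmx -> A = invmx P *m diag_mx D *m P ->
  (forall i, q.[D ord0 i] = D ord0 i) -> horner_mx A q = A.
Proof.
move=> Pu -> qD; rewrite horner_mx_uconjC// horner_mx_diag.
by congr (_ *m diag_mx _ *m _); apply/rowP => i; rewrite mxE.
Qed.

(* The square root is obtained as r(W)^2 for a real polynomial r that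
   interpolates the fourth root on the spectrum: it is then both symmetric and
   positive. *)
Lemma psd_sqrt_exists n (W : 'M[R]_n) : psd W ->
  exists B, psd B /\ B *m B = W.
Proof.
case: n W => [|n] W psdW.
  exists 0; split; last by apply/matrixP => -[].
  by split => [|v]; [exact: trmx0|rewrite mulmx0 mul0mx mxE].
(* The spectral theorem is applied over R[i]; the eigenvalues are then identified with nonnegative
   reals, which makes the interpolating polynomial real. *)
pose Wc : 'M[R[i]]_n.+1 := map_mx (real_complex R) W.
have Wher : Wc \is hermsymmx.
  apply: realsym_hermsym.
    apply/is_hermitianmxP; rewrite expr0 scale1r.
    by apply/matrixP => i j; rewrite !mxE/= -{1}psdW.1 mxE.
  by apply/mxOverP => i j; rewrite mxE; apply/complex_realP; exists (W i j).
have Wnor := hermitian_normalmx Wher.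
have WE := orthomx_spectralP Wnor.
set P := spectralmx Wc in WE; set D := spectral_diag Wc in WE.
have Pu : P \in unitmx by exact: spectral_unit.
have DR i : exists k, D ord0 i = k%:C.
  by apply/complex_realP; exact: (mxOverP (hermitian_spectral_diag_real Wher)).
pose l i := xget 0 [set k : R | D ord0 i = k%:C].
have lE i : D ord0 i = (l i)%:C.
  by have [k kE] := DR i; apply: (@xgetPex _ 0 [set k : R | D ord0 i = k%:C]); exists k.
have l0 i : 0 <= l i.
  apply: (psd_eigenvalue_ge0 psdW); rewrite -(eigenvalue_map (real_complex R)).
  apply/eigenvalueP; exists (row i P); last first.
    apply/negP => /eqP ri0.
    have : row i (P *m invmx P) = 0 by rewrite row_mul ri0 mul0mx.
    rewrite mulmxV// => /rowP/(_ i); rewrite !mxE eqxx => /eqP.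
    by rewrite oner_eq0.
  rewrite -/Wc -row_mul {1}WE !mulmxA mulmxV// mul1mx.
  by rewrite row_mul row_diag_mx -scalemxAl -rowE lE.
have [q qE] := poly_interpolation [seq l i | i : 'I_n.+1] (fun x => Num.sqrt (Num.sqrt x)).
pose S := horner_mx W q.
have ST : S^T = S by rewrite /S trmx_horner_mx psdW.1.
have S4 : S *m S *m (S *m S) = W.
  apply: (map_mx_inj (f := real_complex R)); rewrite -/Wc.
  have -> : S *m S *m (S *m S) = horner_mx W (q ^+ 4).
    by rewrite rmorphXn/= !exprS expr0 mulr1 -!mulmxA.
  rewrite map_horner_mx -/Wc.
  apply: (horner_mx_diagonalizable Pu WE) => i.
  rewrite lE horner_map/= horner_exp qE; last first.
    by apply/mapP; exists i => //; rewrite mem_enum.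
  by rewrite (exprM _ 2 2) sqr_sqrtr ?sqrtr_ge0// sqr_sqrtr.
exists (S *m S); split => //; split; first by rewrite trmx_mul ST.
move=> v; rewrite mulmxA -mulmxA -{1}ST -trmx_mul -dotE dot_norm2.
exact: sqr_ge0.
Qed.

(** Existence of a root rules out the default value 0 of [sqrtmx]; the square norm is then the
    quadratic form of W, whichever root was selected. *)
Lemma norm2_sqrtmx n (W : 'M[R]_n) (u : 'cV[R]_n) : psd W ->
  norm2 (sqrtmx W *m u) ^+ 2 = (u^T *m W *m u) ord0 ord0.
Proof.
move=> /psd_sqrt_exists WB.
have [[BT _] BB] : [set B | psd B /\ B *m B = W] (sqrtmx W) by exact: xgetPex.
rewrite -dot_norm2 dotE trmx_mul BT mulmxA.
by rewrite -(mulmxA u^T (sqrtmx W) (sqrtmx W)) BB.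
Qed.

End psd_square_root.

(** * Noise and likelihood ratio *)

Section product_law.
Context {R : realType} {n m : nat} (q : 'I_n -> 'I_m -> R).
Hypothesis q0 : forall i k, 0 <= q i k.
Hypothesis q1 : forall i, \sum_k q i k = 1.
Implicit Types (i : 'I_n) (k : 'I_m) (y : {ffun 'I_n -> 'I_m}).

Definition law y : R := \prod_i q i (y i).

(** Only finitely many outcomes occur, so expectations over the probability space turn into these
    finite sums. *)
Definition law_mean (f : {ffun 'I_n -> 'I_m} -> R) : R := \sum_y law y * f y.

Lemma law_ge0 y : 0 <= law y.
Proof. exact: prodr_ge0. Qed.

Lemma law_mean_le (f g : {ffun 'I_n -> 'I_m} -> R) : (forall y, f y <= g y) ->
  law_mean f <= law_mean g.
Proof. by move=> fg; apply: ler_sum => y _; rewrite ler_wpM2l ?law_ge0. Qed.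

Lemma law_meanZ a f : law_mean (fun y => a * f y) = a * law_mean f.
Proof. by rewrite mulr_sumr; apply: eq_bigr => y _; rewrite mulrCA. Qed.

Lemma law_mean_sum (I : Type) (r : seq I) (Q : pred I) F :
  law_mean (fun y => \sum_(i <- r | Q i) F i y) = \sum_(i <- r | Q i) law_mean (F i).
Proof. by rewrite exchange_big/=; apply: eq_bigr => y _; rewrite mulr_sumr. Qed.

Lemma law_mean_prod (F : 'I_n -> 'I_m -> R) :
  law_mean (fun y => \prod_i F i (y i)) = \prod_i \sum_k q i k * F i k.
Proof.
by rewrite bigA_distr_bigA/=; apply: eq_bigr => y _; rewrite -big_split.
Qed.

Lemma law_mean1 : law_mean (fun=> 1) = 1.
Proof.
transitivity (law_mean (fun y => \prod_(i < n) 1)).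
  by apply: eq_bigr => y _; rewrite big1.
rewrite (law_mean_prod (fun _ _ => 1)) big1// => i _.
by under eq_bigr do rewrite mulr1; exact: q1.
Qed.

Lemma law_mean_single i (f : 'I_m -> R) :
  law_mean (fun y => f (y i)) = \sum_k q i k * f k.
Proof.
have := law_mean_prod (fun j k => if j == i then f k else 1).
rewrite (bigD1 i)//= eqxx [X in _ = _ * X -> _]big1 ?mulr1 => [<-|j /negbTE ji]; last first.
  by rewrite ji; under eq_bigr do rewrite mulr1; exact: q1.
apply: eq_bigr => y _; congr (_ * _); rewrite (bigD1 i)//= eqxx big1 ?mulr1//.
by move=> j /negbTE ->.
Qed.

Lemma law_mean_pair i j (f g : 'I_m -> R) : i != j ->
  law_mean (fun y => f (y i) * g (y j))
  = (\sum_k q i k * f k) * \sum_k q j k * g k.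
Proof.
move=> ij; have ji : j != i by rewrite eq_sym.
have := law_mean_prod (fun l k => if l == i then f k else if l == j then g k else 1).
rewrite (bigD1 i)//= (bigD1 j)//= eqxx (negbTE ji) eqxx.
rewrite [X in _ = _ * (_ * X) -> _]big1 ?mulr1; last first.
  move=> l /andP[/negbTE -> /negbTE ->].
  by under eq_bigr do rewrite mulr1; exact: q1.
move=> <-; apply: eq_bigr => y _; congr (_ * _).
rewrite (bigD1 i)//= (bigD1 j)//= eqxx (negbTE ji) eqxx big1 ?mulr1//.
by move=> l /andP[/negbTE -> /negbTE ->].
Qed.

Lemma law_mean_sqr_centered (z : 'I_n -> 'I_m -> R) :
  (forall i, \sum_k q i k * z i k = 0) ->
  law_mean (fun y => (\sum_i z i (y i)) ^+ 2) = \sum_i \sum_k q i k * z i k ^+ 2.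
Proof.
move=> z0.
transitivity (\sum_i \sum_j law_mean (fun y => z i (y i) * z j (y j))).
  under [RHS]eq_bigr do rewrite -law_mean_sum.
  rewrite -law_mean_sum; apply: eq_bigr => y _; congr (_ * _).
  by rewrite expr2 mulr_suml; apply: eq_bigr => i _; rewrite mulr_sumr.
apply: eq_bigr => i _; rewrite (bigD1 i)//= big1 ?addr0; last first.
  by move=> j ji; rewrite law_mean_pair 1?eq_sym// z0 mul0r.
by rewrite -(law_mean_single i (fun k => z i k ^+ 2)).
Qed.

End product_law.

Section gaussian_mixture.
Context {R : realType} {k : nat}.

(* Completing the square: a Gaussian mixture of the exponentials of <v, u>
   is the exponential of a multiple of the square norm of u. *)
Lemma integral_expR_dot_gaussian (a : R) (u : 'cV[R]_k) : 0 < a ->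
  (\int[vec_lebesgue k]_v (expR (dot v u - a ^+ 2 * norm2 v ^+ 2))%:E
   = (expR (norm2 u ^+ 2 / (4 * a ^+ 2)) * ((a^-1) ^+ k * Num.sqrt pi ^+ k))%:E)%E.
Proof.
move=> a0; pose f (v : 'cV[R]_k) : \bar R := (expR (- norm2 v ^+ 2))%:E.
have mf : measurable_fun setT f by exact: measurable_expRN (@measurable_sqr_norm2 R k).
have f0 v : (0 <= f v)%E by rewrite lee_fin expR_ge0.
pose c := expR (norm2 u ^+ 2 / (4 * a ^+ 2)).
transitivity (\int[vec_lebesgue k]_v (c%:E * f (a *: v + (- ((2 * a)^-1 *: u)))%R))%E.
  apply: eq_integral => v _; rewrite /f /c -EFinM -expRD; congr (expR _)%:E.
  rewrite -(dot_norm2 (_ + _)) dotDl !dotDr !dotNl !dotNr !dotZl !dotZr.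
  rewrite (dotC u v) !dot_norm2; field; by rewrite gt_eqF.
rewrite ge0_integralZl ?lee_fin ?expR_ge0//; last first.
  exact: measurableT_comp mf (measurable_affine a _).
by rewrite (ge0_integral_affine _ a0 mf f0) integral_gaussian -!EFinM.
Qed.

End gaussian_mixture.

Section category_encoding.
Context {R : realType} {m : nat}.

(** The value of Y_i when Z_i = k: the zero vector for the reference category 0, a basis vector
    otherwise. *)
Definition category (k : nat) : 'cV[R]_m.-1 := \col_l (k == l.+1)%:R.

Lemma dot_category0 (u : 'cV[R]_m.-1) : dot (category 0) u = 0.
Proof. by rewrite /dot big1// => l _; rewrite mxE mul0r. Qed.

Lemma dot_categoryS (u : 'cV[R]_m.-1) (l : 'I_m.-1) :
  dot (category l.+1) u = u l ord0.
Proof.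
rewrite /dot (bigD1 l)//= mxE eqxx mul1r big1 ?addr0// => l' l'l.
by rewrite mxE eqSS eq_sym -[(_ == _ :> nat)]/(l' == l) (negbTE l'l) mul0r.
Qed.

Lemma sum_category (F : nat -> R) : (0 < m)%N ->
  \sum_(k < m) F k = F 0%N + \sum_(l < m.-1) F l.+1.
Proof. by case: m => // m' _; rewrite big_ord_recl. Qed.

Lemma sum_category_indicator (k : nat) : \sum_(l < m.-1) (k == l.+1)%:R <= 1 :> R.
Proof.
case: (pickP (fun l : 'I_m.-1 => k == l.+1)) => [l /eqP kl|h]; last first.
  by rewrite big1// => l _; rewrite h.
rewrite (bigD1 l)//= kl eqxx big1 ?addr0// => l' l'l.
by rewrite eqSS eq_sym -[(_ == _ :> nat)]/(l' == l) (negbTE l'l).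
Qed.

Lemma norm2_categoryB (k l : nat) : norm2 (category k - category l) ^+ 2 <= 2.
Proof.
rewrite sqr_norm2.
apply: (@le_trans _ _ (\sum_(i < m.-1) ((k == i.+1)%:R + (l == i.+1)%:R))).
  apply: ler_sum => i _; rewrite !mxE.
  by case: (k == _); case: (l == _); rewrite /=; lra.
by rewrite big_split/=; have := sum_category_indicator k; have := sum_category_indicator l; lra.
Qed.

Variables (n : nat) (q : 'I_n -> 'I_m -> R).
Hypothesis q0 : forall i k, 0 <= q i k.
Hypothesis q1 : forall i, \sum_k q i k = 1.
Implicit Types (i : 'I_n) (k : 'I_m) (y : {ffun 'I_n -> 'I_m}).

Definition category_mean i : 'cV[R]_m.-1 := \sum_k q i k *: category k.

(** The linear form (Y_i - mu_i)^T u on the event Z_i = k. *)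
Definition deviation i (u : 'cV[R]_m.-1) k : R := dot (category k - category_mean i) u.

Lemma dot_sumZl (I : Type) (r : seq I) (c : I -> R) l (F : I -> 'cV[R]_l) u :
  dot (\sum_(j <- r) c j *: F j) u = \sum_(j <- r) c j * dot (F j) u.
Proof.
elim: r => [|j r ih]; last by rewrite !big_cons dotDl dotZl ih.
by rewrite !big_nil /dot big1// => l' _; rewrite mxE mul0r.
Qed.

Lemma deviationE i u k :
  deviation i u k = dot (category k) u - wmean (q i) (fun l : 'I_m => dot (category l) u).
Proof.
by rewrite /deviation dotDl dotNl /category_mean dot_sumZl.
Qed.

Lemma sum_deviation i u : \sum_k q i k * deviation i u k = 0.
Proof.
under eq_bigr do rewrite deviationE.
exact: (sum_wmeanB (fun l : 'I_m => dot (category l) u) (q1 i)).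
Qed.

Lemma deviation_le i u k : `|deviation i u k| <= Num.sqrt 2 * norm2 u.
Proof.
rewrite deviationE; apply: (wmean_dist (q0 i) (q1 i) _ k) => {k} k l.
rewrite -dotNl -dotDl (le_trans (norm_dot_le _ _))// ler_wpM2r ?norm2_ge0//.
rewrite -(ler_pXn2r (n := 2)) ?nnegrE ?norm2_ge0 ?sqrtr_ge0//.
by rewrite [leRHS]sqr_sqrtr// norm2_categoryB.
Qed.

Definition noise y : 'cV[R]_(\sum_(i < n) m.-1) :=
  \mxcol_i (category (y i) - category_mean i).

Lemma dot_mxcol (p_ : 'I_n -> nat) (u v : forall i, 'cV[R]_(p_ i)) :
  dot (\mxcol_i u i) (\mxcol_i v i) = \sum_i dot (u i) (v i).
Proof.
rewrite dotE tr_mxcol mul_mxrow_mxcol summxE.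
by apply: eq_bigr => i _; rewrite dotE.
Qed.

Lemma dot_noise y (u : 'I_n -> 'cV[R]_m.-1) :
  dot (noise y) (\mxcol_i u i) = \sum_i deviation i (u i) (y i).
Proof. exact: dot_mxcol. Qed.

(** Sub-Gaussian noise: a deviation has square at most 2 |u_i|^2, because two values of Y_i are at
    distance at most sqrt 2, and the factors are independent. *)
Lemma noise_mgf (u : 'cV[R]_(\sum_(i < n) m.-1)) :
  law_mean q (fun y => expR (dot (noise y) u)) <= expR (2 * norm2 u ^+ 2).
Proof.
rewrite -[u]submxcolK; set v := submxcol u.
have -> : (fun y => expR (dot (noise y) (\mxcol_i v i)))
    = (fun y => \prod_i expR (deviation i (v i) (y i))).
  by apply/funext => y; rewrite dot_noise expR_sum.
rewrite (law_mean_prod q (fun i k => expR (deviation i (v i) k))).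
rewrite norm2_mxcol mulr_sumr expR_sum; apply: ler_prod => i _.
rewrite sumr_ge0/=; last by move=> k _; rewrite mulr_ge0 ?expR_ge0.
apply: (sum_expR_le (q0 i) (q1 i)); last exact: sum_deviation.
move=> k; rewrite -real_normK ?num_real//.
rewrite (@le_trans _ _ ((Num.sqrt 2 * norm2 (v i)) ^+ 2))//.
  by rewrite lerXn2r ?nnegrE ?mulr_ge0 ?sqrtr_ge0 ?norm2_ge0 ?deviation_le.
by rewrite exprMn sqr_sqrtr.
Qed.

(** The exponential of a square norm is a Gaussian mixture of exponentials of linear forms, so
    Tonelli reduces this moment to [noise_mgf]. *)
Lemma noise_square_exponential (k : nat) (A : 'M[R]_(\sum_(i < n) m.-1, k)) (x : R) :
  0 < x -> spnorm A <= x ->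
  law_mean q (fun y => expR (norm2 (A^T *m noise y) ^+ 2 / (12 * x ^+ 2)))
  <= Num.sqrt 3 ^+ k.
Proof.
(* The moment bound costs 2 x^2 |v|^2, so a^2 has to exceed 2 x^2. With 3 x^2 there remains x^2
   |v|^2, whence the ratio (a / x)^k of the two Gaussian integrals, and 4 a^2 = 12 x^2. *)
move=> x0 Ax; pose a := Num.sqrt 3 * x.
have s3 : 0 < Num.sqrt 3 :> R by rewrite sqrtr_gt0.
have a0 : 0 < a by rewrite mulr_gt0.
have a2 : a ^+ 2 = 3 * x ^+ 2 by rewrite exprMn sqr_sqrtr.
pose C := a^-1 ^+ k * Num.sqrt pi ^+ k : R.
have pk : 0 < Num.sqrt pi ^+ k :> R by rewrite exprn_gt0// sqrt_pi_gt0.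
have C0 : 0 < C by rewrite mulr_gt0// exprn_gt0// invr_gt0.
rewrite -(ler_pM2r C0) -lee_fin.
have mg (u : 'cV[R]_k) (b : R) :
    measurable_fun setT (fun v : 'cV[R]_k => (expR (dot v u - b * norm2 v ^+ 2))%:E).
  apply/measurable_EFinP; apply: measurableT_comp => //; apply: measurable_funB.
    apply: measurable_sum => i; apply: measurable_funM => //.
    exact: measurable_coord.
  by apply: measurable_funM => //; exact: (@measurable_sqr_norm2 R k).
apply: (@le_trans _ _ (\int[vec_lebesgue k]_v
    (law_mean q (fun y => expR (dot v (A^T *m noise y) - a ^+ 2 * norm2 v ^+ 2)))%:E)%E).
  under eq_integral => v _.
    rewrite -sumEFin; under eq_bigr do rewrite EFinM; over.
  rewrite /= ge0_integral_sum//; last 2 first.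
  - move=> y; apply: emeasurable_funM; first exact: measurable_cst.
    exact: mg.
  - by move=> y v _; rewrite -EFinM lee_fin mulr_ge0 ?law_ge0 ?expR_ge0.
  rewrite mulr_suml -sumEFin; apply: lee_sum => y _.
  rewrite ge0_integralZl//; last by rewrite lee_fin law_ge0.
  rewrite integral_expR_dot_gaussian// -EFinM lee_fin a2.
  by rewrite (_ : 4 * (3 * x ^+ 2) = 12 * x ^+ 2) ?mulrA//; ring.
apply: (@le_trans _ _ (\int[vec_lebesgue k]_v
    (expR (dot v 0 - x ^+ 2 * norm2 v ^+ 2))%:E)%E).
  apply: ge0_le_integral => //.
  - by move=> v _; rewrite lee_fin sumr_ge0// => y _; rewrite mulr_ge0 ?law_ge0 ?expR_ge0.
  - apply/measurable_EFinP; apply: measurable_sum => y; apply: measurable_funM => //.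
    by apply/measurable_EFinP; exact: mg.
  move=> v _; rewrite lee_fin.
  rewrite (_ : (fun y => _) = fun y =>
      expR (- (a ^+ 2 * norm2 v ^+ 2)) * expR (dot (noise y) (A *m v))); last first.
    by apply/funext => y; rewrite -expRD addrC dotC -dot_mulmxr.
  rewrite law_meanZ (le_trans (ler_wpM2l (expR_ge0 _) (noise_mgf _)))//.
  rewrite -expRD ler_expR a2.
  have -> : dot v 0 = 0 by rewrite /dot big1// => i _; rewrite mxE mulr0.
  have h := norm2_mulmx A v.
  have : norm2 (A *m v) ^+ 2 <= x ^+ 2 * norm2 v ^+ 2.
    rewrite -exprMn lerXn2r ?nnegrE ?mulr_ge0 ?norm2_ge0 ?(ltW x0)//.
    by rewrite (le_trans h)// ler_wpM2r ?norm2_ge0.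
  by lra.
rewrite integral_expR_dot_gaussian// lee_fin norm2_0 expr0n/= mul0r expR0 mul1r.
rewrite /C /a mulrA ler_wpM2r ?(ltW pk)// invfM exprMn mulrA exprVn.
by rewrite -exprMn mulfV ?gt_eqF// expr1n mul1r.
Qed.

Lemma noise_tail (k : nat) (A : 'M[R]_(\sum_(i < n) m.-1, k)) (x t : R) :
  0 < x -> spnorm A <= x -> 0 <= t ->
  law_mean q (fun y => (t < norm2 (A^T *m noise y))%R%:R)
  <= Num.sqrt 3 ^+ k * expR (- (t ^+ 2 / (12 * x ^+ 2))).
Proof.
move=> x0 Ax t0.
rewrite expRN ler_pdivlMr ?expR_gt0// mulrC -law_meanZ.
apply: le_trans (noise_square_exponential x0 Ax); apply: law_mean_le => // y.
case: ltP => [tn|_]; last by rewrite mulr0 expR_ge0.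
rewrite mulr1 ler_expR ler_wpM2r ?invr_ge0 ?mulr_ge0 ?sqr_ge0 ?(ltW x0)//.
by rewrite lerXn2r ?nnegrE ?norm2_ge0// ltW.
Qed.

End category_encoding.

Section outcome_law.
Context {R : realType} {m n : nat}.
Context {disp : measure_display} {Om : measurableType disp}.
Variables (Z : 'I_n -> Om -> 'I_m) (P : probability Om R).
Hypothesis indep : independent_responses Z P.
Implicit Types (y : {ffun 'I_n -> 'I_m}).

Definition outcome (w : Om) : {ffun 'I_n -> 'I_m} := [ffun i => Z i w].

Definition category_prob (i : 'I_n) (k : 'I_m) : R := prob_response Z P i k.

Local Notation q := category_prob.

Lemma category_prob_ge0 i k : 0 <= q i k.
Proof. exact: fine_ge0. Qed.

Lemma response_set i (k : 'I_m) :
  [set w | Z i w = k :> nat] = [set w | Z i w = k].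
Proof. by apply/seteqP; split => w /= => [/val_inj|->]. Qed.

Lemma category_probE i k : (q i k)%:E = P [set w | Z i w = k].
Proof.
rewrite /category_prob /prob_response response_set fineK//.
by rewrite fin_num_measure//; exact: indep.1.
Qed.

Lemma sum_category_prob i : \sum_k q i k = 1.
Proof.
apply: EFin_inj; rewrite -sumEFin -(@probability_setT _ _ _ P).
transitivity (\int[P]_w (cst 1 w : \bar R))%E; last first.
  by rewrite integral_cst// mul1e.
transitivity (\int[P]_w (\sum_k (\1_[set w | Z i w = k] w)%:E : \bar R))%E.
  rewrite ge0_integral_sum//; last first.
    move=> k; apply/measurable_EFinP; apply: measurable_indic; exact: indep.1.
  apply: eq_bigr => k _; rewrite integral_indic//; last exact: indep.1.
  by rewrite setIT category_probE.
apply: eq_integral => w _; rewrite sumEFin (bigD1 (Z i w))//= indicE mem_set//.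
rewrite big1 ?addr0// => k /eqP kZ; rewrite indicE memNset//= => h.
exact: kZ.
Qed.

Definition outcome_event y : set Om := [set w | outcome w = y].

Lemma outcome_eventE y : outcome_event y = \bigcap_i [set w | [set y i] (Z i w)].
Proof.
apply/seteqP; split => w /=.
  by move=> wy i _ /=; rewrite -wy ffunE.
by move=> h; apply/ffunP => i; rewrite ffunE; exact: (h i).
Qed.

Lemma measurable_outcome_event y : measurable (outcome_event y).
Proof.
rewrite outcome_eventE; apply: fin_bigcap_measurable; first exact: finite_finset.
move=> i _; exact: indep.1.
Qed.

Lemma prob_outcome_event y : P (outcome_event y) = (law q y)%:E.
Proof.
rewrite outcome_eventE.
transitivity (\prod_(i < n) P [set w | [set y i] (Z i w)])%E.
  exact: (indep.2 (fun i => [set y i])).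
by rewrite /law -prodEFin; apply: eq_bigr => i _; rewrite category_probE.
Qed.

Lemma outcome_indicE (V : nmodType) (f : {ffun 'I_n -> 'I_m} -> V) w :
  f (outcome w) = \sum_y if y == outcome w then f y else 0.
Proof. by rewrite -big_mkcond big_pred1_eq. Qed.

(** The integrand is a finite combination of indicators of measurable events. This is how the
    posterior is integrated as a function of Y. *)
Lemma ge0_integral_outcome (g : {ffun 'I_n -> 'I_m} -> \bar R) :
  (forall y, 0 <= g y)%E ->
  (\int[P]_w g (outcome w) = \sum_y (law q y)%:E * g y)%E.
Proof.
move=> g0.
transitivity (\int[P]_w \sum_y (g y * (\1_(outcome_event y) w)%:E))%E.
  apply: eq_integral => w _; rewrite outcome_indicE; apply: eq_bigr => y _.
  rewrite indicE; case: eqVneq => [->|yw].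
    by rewrite mem_set ?mule1.
  by rewrite memNset ?mule0// => /eqP; rewrite /= eq_sym (negbTE yw).
rewrite ge0_integral_sum//; last 2 first.
- move=> y; apply: emeasurable_funM; first exact: measurable_cst.
  apply/measurable_EFinP; apply: measurable_indic.
  exact: measurable_outcome_event.
- by move=> y w _; rewrite mule_ge0// lee_fin.
apply: eq_bigr => y _; rewrite ge0_integralZl//; last first.
  apply/measurable_EFinP; apply: measurable_indic.
  exact: measurable_outcome_event.
rewrite integral_indic ?setIT//; last exact: measurable_outcome_event.
by rewrite muleC; congr (_ * _)%E; exact: prob_outcome_event.
Qed.

Lemma expectation_outcome (f : {ffun 'I_n -> 'I_m} -> R) :
  fine 'E_P[fun w => f (outcome w)] = law_mean q f.
Proof.
rewrite unlock.
transitivity (fine (\int[P]_w \sum_y ((f y)%:E * (\1_(outcome_event y) w)%:E)))%E.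
  congr fine; apply: eq_integral => w _; rewrite outcome_indicE -sumEFin.
  apply: eq_bigr => y _.
  rewrite indicE; case: eqVneq => [->|yw].
    by rewrite mem_set ?mule1.
  by rewrite memNset ?mule0// => /eqP; rewrite /= eq_sym (negbTE yw).
have int1 y : P.-integrable setT (fun w => (\1_(outcome_event y) w)%:E).
  by apply: integrable_indic => //; exact: measurable_outcome_event.
rewrite integral_sum//; last by move=> y; exact: integrableZl.
rewrite /law_mean -[RHS]/(fine (_%:E)) -sumEFin; congr fine.
apply: eq_bigr => y _; rewrite integralZl// integral_indic ?setIT//.
  by rewrite muleC EFinM; congr (_ * _)%E; exact: prob_outcome_event.
exact: measurable_outcome_event.
Qed.

Lemma responseE w : response Z w = \mxcol_i category (outcome w i) :> 'cV[R]__.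
Proof. by apply: eq_mxcol => i; rewrite ffunE. Qed.

Lemma response_meanE : response_mean Z P = \mxcol_i category_mean q i.
Proof.
apply/matrixP => s j; rewrite mxE.
transitivity (fine 'E_P[fun w => (\mxcol_i category (outcome w i) : 'cV[R]__) s j]).
  by congr (fine 'E_P[_]); apply/funext => w; rewrite responseE.
rewrite (expectation_outcome (fun y => (\mxcol_i category (y i) : 'cV[R]__) s j)).
transitivity (law_mean q (fun y =>
    category (y (tagnat.sig1 s)) (tagnat.sig2 s) j : R)).
  by apply: eq_bigr => y _; rewrite mxE.
rewrite (law_mean_single sum_category_prob _ (fun k => category k _ j)).
rewrite mxE /category_mean summxE; apply: eq_bigr => k _; by rewrite [RHS]mxE.
Qed.

Lemma response_centered w :
  response Z w - response_mean Z P = noise q (outcome w).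
Proof.
rewrite response_meanE responseE; apply/matrixP => s j.
by rewrite !mxE.
Qed.

Lemma response_covE s t : response_cov Z P s t
  = law_mean q (fun y => noise q y s ord0 * noise q y t ord0).
Proof.
rewrite mxE -expectation_outcome; congr (fine 'E_P[_]); apply/funext => w.
by rewrite response_centered mxE big_ord1 [X in _ * X]mxE.
Qed.

Lemma response_cov_quadratic u : (u^T *m response_cov Z P *m u) ord0 ord0
  = law_mean q (fun y => dot (noise q y) u ^+ 2).
Proof.
transitivity (\sum_t \sum_s (u s ord0 * u t ord0) * response_cov Z P s t).
  rewrite mxE; apply: eq_bigr => t _; rewrite mxE mulr_suml.
  by apply: eq_bigr => s _; rewrite mxE mulrAC.
under eq_bigr => t _ do under eq_bigr => s _ do rewrite response_covE -law_meanZ.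
under eq_bigr => t _ do rewrite -law_mean_sum.
rewrite -law_mean_sum; apply: eq_bigr => y _; congr (_ * _).
rewrite expr2 /dot mulr_suml exchange_big/=; apply: eq_bigr => s _.
by rewrite mulr_sumr; apply: eq_bigr => t _; ring.
Qed.

Lemma response_cov_psd : psd (response_cov Z P).
Proof.
split=> [|u].
  apply/matrixP => s t; rewrite mxE !response_covE.
  by apply: eq_bigr => y _; rewrite [X in _ * X]mulrC.
rewrite response_cov_quadratic; apply: sumr_ge0 => y _.
by rewrite mulr_ge0 ?sqr_ge0//; apply: law_ge0; exact: category_prob_ge0.
Qed.

(** The quadratic form of W is the variance of the noise along u; by independence the cross terms
    between blocks vanish. *)
Lemma norm2_sqrt_cov (u : 'I_n -> 'cV[R]_m.-1) :
  norm2 (sqrtmx (response_cov Z P) *m (\mxcol_i u i)) ^+ 2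
  = \sum_i \sum_k q i k * deviation q i (u i) k ^+ 2.
Proof.
rewrite norm2_sqrtmx; last exact: response_cov_psd.
rewrite response_cov_quadratic.
transitivity (law_mean q (fun y => (\sum_i deviation q i (u i) (y i)) ^+ 2)).
  by apply: eq_bigr => y _; rewrite dot_noise.
have dev0 i : \sum_k q i k * deviation q i (u i) k = 0.
  exact: (sum_deviation sum_category_prob).
exact: (law_mean_sqr_centered sum_category_prob dev0).
Qed.

(** A variance is at most the second moment, and [category k] has norm at most 1. This will bound
    the compatibility numbers by 1. *)
Lemma norm2_sqrt_cov_le (u : 'cV[R]_(\sum_(i < n) m.-1)) :
  norm2 (sqrtmx (response_cov Z P) *m u) <= norm2 u.
Proof.
rewrite -(@ler_pXn2r _ 2) ?nnegrE ?norm2_ge0//.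
rewrite -[u]submxcolK norm2_sqrt_cov norm2_mxcol; apply: ler_sum => i _.
set v := submxcol u i; set c := fun k : 'I_m => dot (category k) v.
set a := wmean (q i) c.
have -> : \sum_k q i k * deviation q i v k ^+ 2
    = \sum_k q i k * c k ^+ 2 - a ^+ 2.
  under eq_bigr do rewrite deviationE -/c -/a sqrrB mulrDr mulrBr.
  rewrite big_split/= sumrB -mulr_suml sum_category_prob mul1r.
  under [X in _ - X + _]eq_bigr do rewrite mulrnAr mulrA.
  rewrite sumrMnl -mulr_suml (_ : \sum_(k < m) q i k * dot (category k) v = a)//.
  by rewrite /c; ring.
apply: (@le_trans _ _ (\sum_k q i k * norm2 v ^+ 2)); last first.
  by rewrite -mulr_suml sum_category_prob mul1r.
rewrite lerBlDr ler_wpDr ?sqr_ge0//; apply: ler_sum => k _.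
rewrite ler_wpM2l ?category_prob_ge0// -real_normK ?num_real//.
rewrite lerXn2r ?nnegrE ?norm2_ge0// (le_trans (norm_dot_le _ _))//.
rewrite ler_piMl ?norm2_ge0// -[leRHS]sqrtr1 ler_wsqrtr//.
apply: le_trans (sum_category_indicator (m := m) k); apply: ler_sum => l _.
by rewrite mxE; case: eqP => _; rewrite ?expr1n ?expr0n.
Qed.

End outcome_law.

Section loglikelihood.
Context {R : realType} {m n d : nat} (X : 'I_n -> 'M[R]_(m.-1, d)).
Context {disp : measure_display} {Om : measurableType disp}.
Variables (Z : 'I_n -> Om -> 'I_m) (P : probability Om R) (b0 : 'cV[R]_d).
Hypothesis m0 : (0 < m)%N.
Hypothesis indep : independent_responses Z P.
Hypothesis model : logit_model X Z P b0.

Local Notation q := (category_prob Z P).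

Let norm_const (b : 'cV[R]_d) i : R := 1 + \sum_(l < m.-1) expR ((X i *m b) l ord0).

Lemma norm_const_gt0 b i : 0 < norm_const b i.
Proof. by rewrite ltr_pwDl// sumr_ge0// => l _; exact: expR_ge0. Qed.

Lemma norm_constE b i :
  norm_const b i = \sum_(k < m) expR (dot (category k) (X i *m b)).
Proof.
rewrite (sum_category (fun k => expR (dot (category k) (X i *m b))))//.
rewrite dot_category0 expR0; congr (_ + _).
by apply: eq_bigr => l _; rewrite dot_categoryS.
Qed.

(** The model prescribes odds against category 0; total mass 1 fixes the probability of category 0
    itself. *)
Lemma category_prob_logit i (k : 'I_m) :
  q i k = expR (dot (category k) (X i *m b0)) / norm_const b0 i.
Proof.
pose r (k : nat) := prob_response Z P i k.
have rE (l : 'I_m.-1) : r l.+1 = r 0%N * expR (dot (category l.+1) (X i *m b0)).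
  have [r0 rl] := model i l; rewrite dot_categoryS => <-.
  rewrite lnK ?posrE ?divr_gt0// mulrCA mulfV ?mulr1//.
  by rewrite gt_eqF.
have {}rE (j : 'I_m) : r j = r 0%N * expR (dot (category j) (X i *m b0)).
  case: j => -[|j] jm /=; first by rewrite dot_category0 expR0 mulr1.
  have jm1 : (j < m.-1)%N by rewrite -ltnS prednK.
  exact: (rE (Ordinal jm1)).
have : \sum_(j < m) r j = 1 by exact: (sum_category_prob indep i).
under eq_bigr do rewrite rE.
rewrite -mulr_sumr -norm_constE => /(canRL (mulfK _)); rewrite mul1r => r0E.
rewrite -[q i k]/(r k) rE r0E ?gt_eqF ?norm_const_gt0//.
by rewrite mulrC.
Qed.

(** Since the noise is centred, this is the expected log likelihood ratio of b0 against b0 + u, that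
    is the Kullback-Leibler divergence. *)
Definition loglik_drift (u : 'cV[R]_d) : R :=
  \sum_i ln (\sum_k q i k * expR (deviation q i (X i *m u) k)).

Lemma norm_const_ratio b i : norm_const b i / norm_const b0 i
  = \sum_k q i k * expR (dot (category k) (X i *m (b - b0))).
Proof.
rewrite norm_constE mulr_suml; apply: eq_bigr => k _.
rewrite category_prob_logit mulrAC -expRD -dotDr -mulmxDr; congr (expR (dot _ (_ *m _)) / _).
by rewrite subrKC.
Qed.

Lemma likelihood_gt0 b (y : 'I_n -> 'cV[R]_m.-1) : 0 < likelihood X b y.
Proof.
by apply: prodr_gt0 => i _; rewrite divr_gt0 ?expR_gt0 ?norm_const_gt0.
Qed.

(** [norm_const_ratio] reads the ratio of normalisers as a moment generating function under b0. The
    mean of the linear form is subtracted in noise and drift alike, and cancels. *)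
Lemma likelihood_ratio b (y : {ffun 'I_n -> 'I_m}) :
  likelihood X b (fun i => category (y i))
  = likelihood X b0 (fun i => category (y i))
    * expR (dot (noise q y) (stack X *m (b - b0)) - loglik_drift (b - b0)).
Proof.
rewrite /stack mxcol_mul dot_noise /loglik_drift -sumrB expR_sum -big_split/=.
apply: eq_bigr => i _.
rewrite -/(norm_const b i) -/(norm_const b0 i) -!mulmxA -!dotE.
set u := X i *m (b - b0).
have n0 c : norm_const c i != 0 by rewrite gt_eqF ?norm_const_gt0.
have -> : norm_const b i = norm_const b0 i * \sum_k q i k * expR (dot (category k) u).
  by rewrite -norm_const_ratio mulrC divfK.
rewrite expRB lnK; last first.
  rewrite posrE; apply: sum_expR_gt0; first exact: category_prob_ge0.
  exact: sum_category_prob.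
set a := wmean (q i) (fun l : 'I_m => dot (category l) u).
have -> : \sum_k q i k * expR (deviation q i u k)
    = expR (- a) * \sum_k q i k * expR (dot (category k) u).
  rewrite mulr_sumr; apply: eq_bigr => k _.
  by rewrite deviationE -/a expRD; ring.
rewrite deviationE -/a expRD.
have -> : X i *m b = X i *m b0 + u by rewrite -mulmxDr subrKC.
rewrite dotDr expRD.
have s0 : \sum_k q i k * expR (dot (category k) u) != 0.
  rewrite gt_eqF//; apply: sum_expR_gt0; first exact: category_prob_ge0.
  exact: sum_category_prob.
by field; rewrite n0 s0 expR_eq0.
Qed.

Lemma deviation_norm i (u : 'cV[R]_m.-1) k : `|deviation q i u k| <= 2 * norm2 u.
Proof.
have h := deviation_le (category_prob_ge0 Z P) (sum_category_prob indep) i u k.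
rewrite (le_trans h)// ler_wpM2r ?norm2_ge0//.
rewrite -(ler_pXn2r (n := 2)) ?nnegrE ?sqrtr_ge0// sqr_sqrtr//; lra.
Qed.

(** Deviations are at most 2 r, which turns the 4 of [ln_sum_expR_ge] into 8. *)
Lemma loglik_drift_ge (u : 'cV[R]_d) r : 0 <= r ->
  (forall i, norm2 (X i *m u) <= r) ->
  norm2 (sqrtmx (response_cov Z P) *m (stack X *m u)) ^+ 2 / (2 + 8 * r)
  <= loglik_drift u.
Proof.
move=> r0 Xr; rewrite /stack mxcol_mul norm2_sqrt_cov// mulr_suml.
apply: ler_sum => i _.
have -> : 8 * r = 4 * (2 * r) by ring.
apply: ln_sum_expR_ge.
- exact: category_prob_ge0.
- exact: sum_category_prob.
- by rewrite mulr_ge0.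
- move=> k; rewrite (le_trans (deviation_norm _ _ _))//.
  by rewrite ler_wpM2l.
- exact: sum_deviation (sum_category_prob indep) _ _.
Qed.

Lemma loglik_drift_ge0 u : 0 <= loglik_drift u.
Proof.
have r0 : 0 <= norm2 (stack X *m u) := norm2_ge0 _.
apply: le_trans (loglik_drift_ge r0 (norm2_block_le_stack X u)).
by rewrite divr_ge0 ?sqr_ge0// addr_ge0// mulr_ge0.
Qed.

(* Both terms are sums over i of a deviation of size at most 2 |X_i u|. *)
Lemma loglik_ge (u : 'cV[R]_d) y r : (forall i, norm2 (X i *m u) <= r) ->
  - (4 * n%:R * r) <= dot (noise q y) (stack X *m u) - loglik_drift u.
Proof.
move=> Xr; rewrite /stack mxcol_mul dot_noise /loglik_drift -sumrB.
have -> : - (4 * n%:R * r) = \sum_(i < n) - (4 * r).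
  by rewrite sumr_const card_ord -mulr_natr; ring.
apply: ler_sum => i _.
have ub k : `|deviation q i (X i *m u) k| <= 2 * r.
  by rewrite (le_trans (deviation_norm _ _ _))// ler_wpM2l.
have : ln (\sum_k q i k * expR (deviation q i (X i *m u) k)) <= 2 * r.
  rewrite -ler_expR lnK; last first.
    rewrite posrE; apply: sum_expR_gt0; first exact: category_prob_ge0.
    exact: sum_category_prob.
  rewrite -[leRHS]mul1r -[X in _ <= X * _](sum_category_prob indep i) mulr_suml.
  apply: ler_sum => k _; rewrite ler_wpM2l ?category_prob_ge0// ler_expR.
  exact: le_trans (ler_norm _) (ub k).
have := ub (y i); rewrite ler_norml => /andP[+ _]; lra.
Qed.

End loglikelihood.

(** * Prior and posterior *)

Section integral_density.
Context {R : realType}.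
Local Open Scope ereal_scope.
Import HBNNSimple.

(** [nu] is the image under [phi] of the measure of density [h]. The formula holds for indicators by
    assumption, for simple functions by linearity, and in general by monotone convergence. *)
Lemma ge0_integral_density d1 d2 (T : measurableType d1) (U : measurableType d2)
    (nu : {measure set T -> \bar R}) (mu : {measure set U -> \bar R})
    (phi : U -> T) (h : U -> R) (f : T -> \bar R) :
  measurable_fun setT phi -> measurable_fun setT h -> (forall v, 0 <= h v)%R ->
  (forall B, measurable B -> nu B = \int[mu]_(v in phi @^-1` B) (h v)%:E) ->
  measurable_fun setT f -> (forall x, 0 <= f x) ->
  \int[nu]_x f x = \int[mu]_v (f (phi v) * (h v)%:E).
Proof.
move=> mphi mh h0 nuE mf f0; pose g := nnsfun_approx measurableT mf.
have mhE : measurable_fun setT (EFin \o h) by exact/measurable_EFinP.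
have mg n : measurable_fun setT (fun v => (g n (phi v))%:E * (h v)%:E).
  apply: emeasurable_funM => //; apply/measurable_EFinP.
  exact: measurableT_comp (measurable_funP (g n)) mphi.
have -> : \int[nu]_x f x = lim (\int[nu]_x (g n x)%:E @[n --> \oo]).
  rewrite -monotone_convergence//.
  - apply: eq_integral => x _; apply/esym/cvg_lim => //.
    exact: cvg_nnsfun_approx.
  - by move=> n; exact/measurable_EFinP/measurable_funP.
  - by move=> n x _; rewrite lee_fin.
  - by move=> x _ a b ab; rewrite lee_fin; exact/lefP/nd_nnsfun_approx.
have -> : \int[mu]_v (f (phi v) * (h v)%:E)
    = lim (\int[mu]_v ((g n (phi v))%:E * (h v)%:E) @[n --> \oo]).
  rewrite -monotone_convergence//.
  - apply: eq_integral => v _; apply/esym/cvg_lim => //.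
    by apply: cvgeZr => //; exact: (@cvg_nnsfun_approx _ _ _ _ measurableT _ mf).
  - by move=> n v _; rewrite -EFinM lee_fin mulr_ge0.
  - move=> v _ a b ab; rewrite lee_wpmul2r ?lee_fin//.
    exact/lefP/nd_nnsfun_approx.
apply: congr_lim; apply/funext => n /=.
have ind (r : R) (x : T) : (0 <= (r * \1_(g n @^-1` [set r]) x)%:E)%E.
  exact: nnfun_muleindic_ge0.
transitivity (\int[nu]_x (\sum_(y \in range (g n))
    (y * \1_(g n @^-1` [set y]) x)%:E)).
  by apply: eq_integral => x _; rewrite /= fimfunE -fsumEFin.
have mind (r : R) : measurable_fun setT
    (fun x : T => (r * \1_(g n @^-1` [set r]) x)%:E).
  by apply/measurable_EFinP; exact: measurable_funM.
rewrite ge0_integral_fsum//.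
transitivity (\int[mu]_v (\sum_(y \in range (g n))
    (y * \1_(g n @^-1` [set y]) (phi v))%:E * (h v)%:E)); last first.
  apply: eq_integral => v _; rewrite -ge0_mule_fsuml// fsumEFin//.
  by rewrite -(fimfunE (g n) (phi v)).
rewrite ge0_integral_fsum//; last 2 first.
- move=> y; apply: emeasurable_funM => //.
  exact: measurableT_comp (mind y) mphi.
- by move=> y v _; rewrite mule_ge0// lee_fin.
apply: eq_fsbigr => r; rewrite inE/= => -[x _ gxr].
have r0 : (0 <= r)%R by rewrite -gxr.
have mB : measurable (g n @^-1` [set r]) by exact: measurable_funPTI.
have mB' : measurable (phi @^-1` (g n @^-1` [set r])).
  by rewrite -[X in measurable X]setTI; exact: mphi.
under eq_integral do rewrite EFinM.
rewrite ge0_integralZl//; last first.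
  by apply/measurable_EFinP; exact: measurable_indic.
rewrite integral_indic// setIT nuE//.
under [RHS]eq_integral do rewrite EFinM -muleA.
rewrite ge0_integralZl//; last 2 first.
- apply: emeasurable_funM => //; apply/measurable_EFinP.
  by apply: measurableT_comp mphi; exact: measurable_indic.
- by move=> v _; rewrite mule_ge0 ?lee_fin.
congr (_ * _); rewrite integral_mkcond; apply: eq_integral => v _.
rewrite patchE indicE; have -> : (phi v \in g n @^-1` [set r])
    = (v \in phi @^-1` (g n @^-1` [set r])) by apply/idP/idP; rewrite !inE.
by case: ifP => _; rewrite ?mul1e ?mul0e.
Qed.

End integral_density.

Section prior_integral.
Context {R : realType} {d p : nat} (G : 'I_p -> {set 'I_d}).
Variables (lam : {nonneg R}) (pmf : nat -> {nonneg R}).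
Local Open Scope ereal_scope.

Definition model_weight (S : {set 'I_p}) : R :=
  ((pmf #|S|)%:num / 'C(p, #|S|)%:R)%R.

Lemma model_weight_ge0 S : (0 <= model_weight S)%R.
Proof. exact: divr_ge0. Qed.

Lemma ge0_integral_slab (S : {set 'I_p}) (f : 'cV[R]_d -> \bar R) :
  measurable_fun setT f -> (forall b, 0 <= f b) ->
  \int[slab G lam S]_b f b
  = \int[vec_lebesgue #|coords G S|]_v (f (extend v) * (slab_density lam v)%:E).
Proof.
move=> mf f0; apply: ge0_integral_density => //.
- exact: measurable_extend.
- exact: measurable_slab_density.
- exact: slab_density_ge0.
Qed.

Lemma ge0_integral_prior (f : 'cV[R]_d -> \bar R) :
  measurable_fun setT f -> (forall b, 0 <= f b) ->
  \int[prior G lam pmf]_b f b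
  = \sum_(S : {set 'I_p}) (model_weight S)%:E *
      \int[vec_lebesgue #|coords G S|]_v (f (extend v) * (slab_density lam v)%:E).
Proof.
(* The models are enumerated so that the prior becomes a finite sum of scaled slab measures. *)
move=> mf f0; pose e := index_enum {set 'I_p}; pose S_ i := nth finset.set0 e i.
pose m_ i : {measure set 'cV[R]_d -> \bar R} :=
  mscale (NngNum (model_weight_ge0 (S_ i))) (slab G lam (S_ i)).
transitivity (\int[msum m_ (size e)]_b f b).
  apply: eq_measure_integral => B mB _.
  by rewrite /= /msum/= /prior -/e (big_nth finset.set0) big_mkord.
rewrite ge0_integral_measure_sum// -[in RHS]/e (big_nth finset.set0) big_mkord.
apply: eq_bigr => i _; rewrite ge0_integral_mscale//.
by rewrite ge0_integral_slab.
Qed.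

End prior_integral.

(** * Absorbing linear terms into the drift *)

Section curvature_inequalities.
Context {R : realType}.
(** For u = b - b0: [x] is the star norm of the stacked design, [K] the largest star norm of a
    block, [rL] the root of the log rate, [N] the (2,1)-norm of u, [Q] the norm of W^1/2 X u, [D]
    the drift. *)
Variables (x K rL N Q D : R).
Hypotheses (x0 : 0 < x) (K0 : 0 <= K) (rL0 : 0 < rL) (N0 : 0 <= N) (Q0 : 0 <= Q).
Hypothesis DQ : Q ^+ 2 / (2 + 8 * (K * N)) <= D.

Let KN0 : 0 <= K * N.
Proof. exact: mulr_ge0. Qed.

Let DQ_le c : 0 < c -> 2 + 8 * (K * N) <= c -> Q ^+ 2 / c <= D.
Proof.
have KNp := KN0; move=> c0 hc; apply: le_trans DQ; rewrite ler_wpM2l ?sqr_ge0//.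
by rewrite lef_pV2 ?posrE//; lra.
Qed.

(* If 8 K N <= 1/49 the quadratic lower bound on D absorbs the linear term by
   AM-GM; otherwise D grows at least linearly in N. *)
Lemma curvature_cone (Phi : R) : 0 <= Phi -> x ^+ 2 * N ^+ 2 <= Q ^+ 2 * Phi ->
  11088 * (Phi * K * rL) <= x ->
  14 * (x * rL * N) <= D + 99 * (rL ^+ 2 * Phi).
Proof.
move=> Phi0 QPhi Kx; have KNge := KN0.
have D0 : 0 <= D.
  by apply: le_trans DQ; rewrite divr_ge0 ?sqr_ge0//; lra.
have L0 : 0 <= 99 * (rL ^+ 2 * Phi) by rewrite mulr_ge0// mulr_ge0 ?sqr_ge0.
have [N00|Nn0] := eqVneq N 0; first by rewrite N00 !mulr0 addr_ge0.
have Np : 0 < N by rewrite lt_def Nn0.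
have Pp : 0 < Phi.
  rewrite lt_def Phi0 andbT; apply: contraTneq QPhi => ->; rewrite mulr0 -ltNge.
  by rewrite mulr_gt0 ?exprn_gt0.
have QE : x ^+ 2 * N ^+ 2 / Phi <= Q ^+ 2 by rewrite ler_pdivrMr.
have [h|h] := leP (8 * (K * N)) (1 / 49).
  (* 2 + 1/49 = 99/49, so D >= (49/99) Q^2. The square [sq] is the AM-GM inequality with middle term
     2 * 7 = 14 and remainder 99 rL^2 Phi. *)
  clear Kx; have c0 : 0 < 99 / 49 :> R by rewrite divr_gt0.
  have := DQ_le c0; move=> /(_ ltac:(lra)) h1.
  have sq : 0 <= (7 * (x * N) - 99 * (rL * Phi)) ^+ 2 / (99 * Phi).
    by rewrite divr_ge0 ?sqr_ge0// mulr_ge0.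
  have E : (7 * (x * N) - 99 * (rL * Phi)) ^+ 2 / (99 * Phi)
     = 49 / 99 * (x ^+ 2 * N ^+ 2 / Phi) - 14 * (x * rL * N) + 99 * (rL ^+ 2 * Phi).
    by field; rewrite gt_eqF.
  rewrite E in sq; have h2 : Q ^+ 2 / (99 / 49) = 49 / 99 * Q ^+ 2 by field.
  rewrite h2 in h1.
  have h3 : 49 / 99 * (x ^+ 2 * N ^+ 2 / Phi) <= 49 / 99 * Q ^+ 2 by rewrite ler_wpM2l.
  move: sq h1 h3; move: (49 / 99 * _) (49 / 99 * _) (14 * _) (99 * _) => u v w z.
  by clear E h2 QE QPhi h KNge D0 L0; lra.
(* Now K N > 1/392, so the denominator is at most (784 + 8) K N = 792 K N; the bias constant is
   11088 = 14 * 792. *)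
have [KNp KN98] : 0 < K * N /\ 2 <= 784 * (K * N) by clear Kx; split; lra.
have Kp : 0 < K by move: KNp; rewrite pmulr_lgt0.
have c0 : 0 < 792 * (K * N) by rewrite pmulr_rgt0 ?ltr0n.
have := DQ_le c0; have -> : 792 * (K * N) = 784 * (K * N) + 8 * (K * N) by ring.
rewrite lerD2r => /(_ KN98); rewrite -mulrDl -natrD => h1.
suff h2 : 14 * (x * rL * N) <= Q ^+ 2 / (792 * (K * N)).
  by rewrite (le_trans (le_trans h2 h1))// lerDl.
rewrite ler_pdivlMr//.
apply: le_trans QE.
rewrite ler_pdivlMr// [leLHS](_ : _ = (x * N ^+ 2) * (11088 * (Phi * K * rL))); last by ring.
rewrite [leRHS](_ : _ = (x * N ^+ 2) * x); last by ring.
by rewrite ler_wpM2l// mulr_ge0 ?sqr_ge0// ltW.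
Qed.

(** [rho] is the estimation radius, and [h] compares x rL N with rho Q on small supports. Since Q >=
    M4 rho, each product rho Q is at most Q^2 / M4, so a large [M4] yields the gain C rho^2; a small
    [M3] controls K where the drift is only linear. *)
Lemma curvature_estimation (h rho C M3 M4 : R) :
  0 < h -> 0 <= rho -> 0 <= C -> 0 < M3 -> 0 < M4 ->
  672 * h ^+ 2 * M3 <= 1 -> 84 * h <= M4 -> 6 * C <= M4 -> 1 <= M4 ->
  48 * C * h * M3 <= M4 ->
  x * rL * N <= h * rho * Q -> M4 * rho <= Q -> K * rho ^+ 2 <= M3 * (x * rL) ->
  14 * (x * rL * N) + C * rho ^+ 2 <= D.
Proof.
move=> h0 rho0 C0 M30 M40 hM3 M4h M4C M41 M4Ch NQ MQ Krho; have KNge := KN0.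
have Qr : rho <= Q / M4 by rewrite ler_pdivlMr// mulrC.
have xr0 : 0 < x * rL by exact: mulr_gt0.
have rQ : 0 <= rho * Q by exact: mulr_ge0.
have Q20 := sqr_ge0 Q.
have MrQ : M4 * (rho * Q) <= Q ^+ 2 by rewrite mulrA expr2 ler_wpM2r.
have [KN1|KN1] := leP (8 * (K * N)) 1.
  have h1 := DQ_le (_ : 0 < 3) (_ : _ <= 3).
  have {}h1 := h1 ltac:(lra) ltac:(lra).
  (* The bound Q^2 / 3 is shared equally: 84 = 6 * 14 serves the linear term and 6 C the gain. *)
  have a1 : 14 * (x * rL * N) <= Q ^+ 2 / 6.
    have : 84 * h * (rho * Q) <= M4 * (rho * Q) by rewrite ler_wpM2r.
    by lra.
  have a2 : C * rho ^+ 2 <= Q ^+ 2 / 6.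
    have e1 : rho * rho <= rho * Q.
      rewrite ler_wpM2l//; apply: le_trans MQ; by rewrite ler_peMl.
    have e2 : 6 * C * (rho * Q) <= M4 * (rho * Q) by rewrite ler_wpM2r.
    have e3 : C * (rho * rho) <= C * (rho * Q) by rewrite ler_wpM2l.
    by rewrite expr2; lra.
  by lra.
have KNp : 0 < K * N by lra.
(* Here 2 < 16 K N, whence the denominator 24 K N. Once multiplied by it, each of the two terms
   takes half of Q^2: 672 is twice 14 * 24, and 48 twice 24. *)
have h1 := DQ_le (_ : 0 < 24 * (K * N)) (_ : _ <= 24 * (K * N)).
have {}h1 := h1 ltac:(lra) ltac:(lra).
apply: le_trans h1; rewrite ler_pdivlMr; last by lra.
have e1 : K * (x * rL * N) ^+ 2 <= (h ^+ 2 * M3 * Q ^+ 2) * (x * rL).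
  have : (x * rL * N) ^+ 2 <= (h * rho * Q) ^+ 2.
    by rewrite lerXn2r ?nnegrE ?mulr_ge0 ?(ltW x0) ?(ltW rL0) ?(ltW h0).
  move=> /(ler_wpM2l K0) /le_trans; apply.
  have -> : K * (h * rho * Q) ^+ 2 = (h ^+ 2 * Q ^+ 2) * (K * rho ^+ 2) by ring.
  have -> : h ^+ 2 * M3 * Q ^+ 2 * (x * rL) = (h ^+ 2 * Q ^+ 2) * (M3 * (x * rL)) by ring.
  by rewrite ler_wpM2l// mulr_ge0 ?sqr_ge0.
have {}e1 : K * (x * rL) * N ^+ 2 <= h ^+ 2 * M3 * Q ^+ 2.
  rewrite -(ler_pM2r xr0); apply: le_trans e1; rewrite le_eqVlt; apply/orP; left.
  by apply/eqP; ring.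
have e2 : K * rho ^+ 2 * (x * rL * N) <= h * M3 * (rho * Q) * (x * rL).
  apply: (@le_trans _ _ (K * rho ^+ 2 * (h * rho * Q))).
    by rewrite ler_wpM2l// mulr_ge0 ?sqr_ge0.
  have -> : h * M3 * (rho * Q) * (x * rL) = (M3 * (x * rL)) * (h * rho * Q) by ring.
  by rewrite ler_wpM2r// mulr_ge0// mulr_ge0// ltW.
have {}e2 : K * rho ^+ 2 * N <= h * M3 * (rho * Q).
  rewrite -(ler_pM2r xr0); apply: le_trans e2; rewrite le_eqVlt; apply/orP; left.
  by apply/eqP; ring.
have e3 : 672 * h ^+ 2 * M3 * Q ^+ 2 <= 1 * Q ^+ 2 by rewrite ler_wpM2r.
have e4 : C * (K * rho ^+ 2 * N) <= C * (h * M3 * (rho * Q)) by rewrite ler_wpM2l.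
have e5 : 48 * C * h * M3 * (rho * Q) <= M4 * (rho * Q) by rewrite ler_wpM2r.
have -> : (14 * (x * rL * N) + C * rho ^+ 2) * (24 * (K * N))
  = 336 * (K * (x * rL) * N ^+ 2) + 24 * (C * (K * rho ^+ 2 * N)) by ring.
by lra.
Qed.

End curvature_inequalities.

(** * Integrals over a single model *)

Section model_integrals.
Context {R : realType} {d p : nat} (G : 'I_p -> {set 'I_d}).
Hypothesis GP : group_partition G.
Variables (lam : {nonneg R}) (b0 : 'cV[R]_d) (LL : 'cV[R]_d -> R).
Hypothesis lam0 : 0 < lam%:num.
Hypothesis mLL : measurable_fun setT LL.
Local Notation N := (norm21 G [set: 'I_p]%SET).

(** The likelihood enters through its ratio to the likelihood at the truth; the omitted factor
    cancels in the posterior. *)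
Definition model_integral (B : set 'cV[R]_d) (S : {set 'I_p}) : \bar R :=
  (\int[vec_lebesgue #|coords G S|]_v
    ((\1_B (extend v) * expR (LL (extend v)))%:E * (slab_density lam v)%:E))%E.

Lemma group_supp_extend (S : {set 'I_p}) (v : 'cV[R]_#|coords G S|) :
  group_supp G (extend v) \subset S.
Proof.
apply/fintype.subsetP => j; rewrite finset.inE; apply: contraNT => jS.
apply/eqP/colP => k; rewrite !mxE big1// => l /eqP lk.
have /bigcupP[i iS] := enum_valP l; rewrite lk => ki.
have kj := enum_valP k.
have ij : i = j.
  by move: ki kj; rewrite !(group_ofP GP) => /eqP <- /eqP.
by move: jS; rewrite -ij iS.
Qed.

Lemma norm21_extend_compl (S : {set 'I_p}) (v : 'cV[R]_#|coords G S|) :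
  norm21 G (~: S)%SET (extend v) = 0.
Proof. exact: group_supp_subset0 (group_supp_extend v). Qed.

Lemma slab_densityE (S : {set 'I_p}) (v : 'cV[R]_#|coords G S|) :
  slab_density lam v
  = slab_constant G lam%:num S * expR (- (lam%:num * N (extend v))).
Proof.
rewrite /slab_density -/(slab_constant G lam%:num S) mulNr.
by rewrite (norm21_setT _ S) norm21_extend_compl addr0.
Qed.

Lemma measurable_norm21_affine (S : {set 'I_p}) (a : R) (b : 'cV[R]_d) :
  measurable_fun setT (fun v : 'cV[R]_#|coords G S| =>
    a * norm21 G S (extend v - b)).
Proof.
apply: measurable_funM => //.
rewrite (_ : (fun _ => _) = fun v : 'cV[R]_#|coords G S| =>
    \sum_j if j \in S then norm2 (group_sub G (extend v - b) j) else 0); last first.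
  by apply/funext => v; exact: big_mkcond.
apply: measurable_sum => j; case: (j \in S); last exact: measurable_cst.
apply: measurableT_comp; first exact: measurable_norm2.
apply: measurable_fun_vecP => i; under eq_fun do rewrite !mxE.
apply: measurable_funB => //.
have -> : (fun v : 'cV[R]_#|coords G S| => \sum_(l | enum_val l == enum_val i) v l ord0)
   = (fun v => (extend v) (enum_val i) ord0) by apply/funext => v; rewrite mxE.
exact: measurableT_comp (measurable_coord _) (@measurable_extend R d p G S).
Qed.

Lemma measurable_model_integrand (B : set 'cV[R]_d) (S : {set 'I_p}) :
  measurable B ->
  measurable_fun setT (fun v : 'cV[R]_#|coords G S| =>
    ((\1_B (extend v) * expR (LL (extend v)))%:E * (slab_density lam v)%:E)%E).
Proof.
move=> mB; apply: emeasurable_funM; apply/measurable_EFinP.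
  have me := @measurable_extend R d p G S.
  apply: measurable_funM.
    by apply: measurableT_comp me; exact: measurable_indic.
  by apply: measurableT_comp => //; exact: measurableT_comp me.
exact: measurable_slab_density.
Qed.

(** The quarter of the slab rate left in the exponent integrates to 4 to the power d_S, at the cost
    of the constant [kappa]. *)
Lemma model_integral_le (B : set 'cV[R]_d) (S : {set 'I_p}) (kappa : R) :
  measurable B ->
  (forall v : 'cV[R]_#|coords G S|, B (extend v) ->
    LL (extend v) + lam%:num * N b0 - lam%:num * N (extend v)
    <= kappa - lam%:num / 4 * N (extend v - b0)) ->
  (model_integral B S
   <= (expR (kappa - lam%:num * N b0) * 4 ^+ #|coords G S|)%:E)%E.
Proof.
move=> mB LLB.
have l4 : 0 < lam%:num / 4 by rewrite divr_gt0.
have lE : lam%:num / (lam%:num / 4) = 4 by field; rewrite gt_eqF.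
have := integral_expRN_norm21 GP S b0 l4 (ltW lam0); rewrite lE => IE.
have c0 : 0 <= slab_constant G lam%:num S by apply: slab_constant_ge0; exact: ltW.
have mf := measurable_expRN (@measurable_norm21_affine S (lam%:num / 4) b0).
have mg := measurable_expRN (@measurable_norm21_affine S (lam%:num / 4) b0).
rewrite EFinM -IE -ge0_integralZl ?lee_fin//.
rewrite -ge0_integralZl ?lee_fin ?expR_ge0//; last 2 first.
- exact: emeasurable_funM.
- by move=> v _; rewrite mule_ge0 ?lee_fin ?expR_ge0.
apply: ge0_le_integral => //.
- by move=> v _; rewrite -EFinM lee_fin mulr_ge0 ?slab_density_ge0.
- exact: measurable_model_integrand.
- by apply: emeasurable_funM => //; exact: emeasurable_funM.
move=> v _; rewrite -!EFinM lee_fin indicE.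
have [vB|vB] := boolP (extend v \in B); last first.
  by rewrite mulr0n !mul0r mulr_ge0 ?expR_ge0// mulr_ge0 ?expR_ge0.
rewrite mulr1n mul1r slab_densityE mulrCA [leRHS]mulrCA ler_wpM2l// -!expRD ler_expR.
have := LLB v (set_mem vB).
have : norm21 G S (extend v - b0) <= N (extend v - b0).
  by apply: norm21_subset; apply/fintype.subsetP => j; rewrite finset.inE.
by move=> /(ler_wpM2l (ltW l4)); lra.
Qed.

(** For the denominator, [c] bounds the decrease of the log likelihood per unit of (2,1)-norm, and
    the exponential of rate lam + c is integrated exactly. *)
Lemma model_integral_ge (c : R) : 0 <= c ->
  (forall v : 'cV[R]_#|coords G (group_supp G b0)|,
    - (c * N (extend v - b0)) <= LL (extend v)) ->
  ((expR (- (lam%:num * N b0))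
    * (lam%:num / (lam%:num + c)) ^+ #|coords G (group_supp G b0)|)%:E
   <= model_integral setT (group_supp G b0))%E.
Proof.
move=> c0 LLv; set S := group_supp G b0.
have lc : 0 < lam%:num + c by rewrite ltr_wpDr.
have := integral_expRN_norm21 GP S b0 lc (ltW lam0) => IE.
have c0' : 0 <= slab_constant G lam%:num S by apply: slab_constant_ge0; exact: ltW.
have mg := measurable_expRN (@measurable_norm21_affine S (lam%:num + c) b0).
rewrite EFinM -IE -ge0_integralZl ?lee_fin//.
rewrite -ge0_integralZl ?lee_fin ?expR_ge0//; last 2 first.
- exact: emeasurable_funM.
- by move=> v _; rewrite mule_ge0 ?lee_fin ?expR_ge0.
apply: ge0_le_integral => //.
- by move=> v _; rewrite !mule_ge0 ?lee_fin ?expR_ge0.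
- by apply: emeasurable_funM => //; exact: emeasurable_funM.
- exact: measurable_model_integrand.
move=> v _; rewrite -!EFinM lee_fin indicT mul1r.
rewrite slab_densityE mulrCA [leRHS]mulrCA ler_wpM2l// -!expRD ler_expR.
(* Both vectors live on the true groups, so the full norm is the one that [integral_expRN_norm21]
   handles. *)
have NS : N (extend v - b0) = norm21 G S (extend v - b0).
  rewrite (norm21_setT _ S) [X in _ + X](_ : _ = 0) ?addr0//; apply/eqP.
  rewrite eq_le norm21_ge0 andbT (le_trans (norm21D _ _ _ _))// norm21N.
  by rewrite norm21_extend_compl (group_supp_subset0 (subxx _)) addr0.
have := LLv v; rewrite NS => h1.
have := norm21D G [set: 'I_p]%SET (extend v - b0) b0; rewrite subrK NS.
move=> /(ler_wpM2l (ltW lam0)); lra.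
Qed.

End model_integrals.

Section posterior_bounds.
Context {R : realType} {m n d p : nat} (X : 'I_n -> 'M[R]_(m.-1, d)).
Variable G : 'I_p -> {set 'I_d}.

Lemma lee_div_bound (num den : \bar R) (a b : R) : (0 <= num)%E -> 0 < b ->
  (num <= a%:E)%E -> (b%:E <= den)%E -> (num / den <= (a / b)%:E)%E.
Proof.
move=> num0 b0 numa bden.
have den0 : (0 <= den)%E by apply: le_trans bden; rewrite lee_fin ltW.
have := bden; rewrite -lee_pV2 ?inE ?lee_fin ?(ltW b0)// inver gt_eqF// => h.
by rewrite EFinM lee_pmul// inve_ge0.
Qed.

Lemma likelihood_ge0 (b : 'cV[R]_d) y : 0 <= likelihood X b y.
Proof.
by apply: prodr_ge0 => i _; rewrite divr_ge0 ?expR_ge0 ?addr_ge0 ?sumr_ge0.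
Qed.

Lemma posterior_ge0 (Pi : {measure set 'cV[R]_d -> \bar R}) y B :
  (0 <= posterior X Pi y B)%E.
Proof.
rewrite mule_ge0 ?inve_ge0//; apply: integral_ge0 => b _;
by rewrite lee_fin likelihood_ge0.
Qed.

Lemma measurable_dot_mulmx k (u : 'cV[R]_k) (A : 'M[R]_(k, d)) (c : 'cV[R]_d) :
  measurable_fun setT (fun b : 'cV[R]_d => dot u (A *m (b - c))).
Proof.
rewrite (_ : (fun _ => _) = fun b : 'cV[R]_d =>
    \sum_i (A^T *m u) i ord0 * (b i ord0 - c i ord0)); last first.
  apply/funext => b; rewrite dot_mulmxr; apply: eq_bigr => i _.
  by rewrite [(b - c) _ _]mxE [(- c) _ _]mxE.
apply: measurable_sum => i; apply: measurable_funM => //.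
by apply: measurable_funB => //; exact: measurable_coord.
Qed.

Lemma posterior_le1 (Pi : {measure set 'cV[R]_d -> \bar R}) y B :
  measurable B -> measurable_fun setT (fun b => likelihood X b y) ->
  (posterior X Pi y B <= 1)%E.
Proof.
move=> mB mL; have L0 b : (0 <= (likelihood X b y)%:E)%E.
  by rewrite lee_fin likelihood_ge0.
rewrite /posterior; set num := (\int[Pi]_(b in B) _)%E; set den := (\int[Pi]_b _)%E.
have nd : (num <= den)%E.
  by apply: ge0_subset_integral => //; exact/measurable_EFinP.
have num0 : (0 <= num)%E by exact: integral_ge0.
(* The quotient is total: a nonpositive denominator forces a zero numerator, and an infinite one has
   inverse 0. *)
case: den nd => [r| |] nd.
- have [r0|r0] := ltP 0 r; first by rewrite inver gt_eqF// lee_pdivrMr// mul1e.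
  have -> : num = 0%E.
    by apply/eqP; rewrite eq_le num0 andbT (le_trans nd)// lee_fin.
  by rewrite mul0e.
- by rewrite invey mule0.
- by move: nd; rewrite leeNy_eq => /eqP h; move: num0; rewrite h.
Qed.

Variables (lam : {nonneg R}) (pmf : nat -> {nonneg R}) (b0 : 'cV[R]_d).
Variables (y : 'I_n -> 'cV[R]_m.-1) (LL : 'cV[R]_d -> R).
Hypothesis mLL : measurable_fun setT LL.
Hypothesis LLE : forall b, likelihood X b y = likelihood X b0 y * expR (LL b).
Hypothesis lik0 : 0 < likelihood X b0 y.

Lemma measurable_likelihood : measurable_fun setT (fun b => likelihood X b y).
Proof.
rewrite (_ : (fun _ => _) = fun b => likelihood X b0 y * expR (LL b)); last first.
  by apply/funext => b; exact: LLE.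
by apply: measurable_funM => //; apply: measurableT_comp.
Qed.

Lemma integral_prior_likelihood B : measurable B ->
  (\int[prior G lam pmf]_(b in B) (likelihood X b y)%:E
   = (likelihood X b0 y)%:E * \sum_(S : {set 'I_p}) (model_weight pmf S)%:E
       * model_integral G lam LL B S)%E.
Proof.
move=> mB; rewrite integral_mkcond.
transitivity (\int[prior G lam pmf]_b
    ((likelihood X b0 y)%:E * (\1_B b * expR (LL b))%:E))%E.
  apply: eq_integral => b _; rewrite patchE indicE; case: ifP => _.
    by rewrite mul1r LLE EFinM.
  by rewrite mul0r mule0.
have mi : measurable_fun setT (fun b => (\1_B b * expR (LL b))%:E).
  apply/measurable_EFinP; apply: measurable_funM; first exact: measurable_indic.
  exact: measurableT_comp.
have i0 b : (0 <= (\1_B b * expR (LL b))%:E)%E.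
  by rewrite lee_fin mulr_ge0 ?expR_ge0.
rewrite ge0_integralZl//; last by rewrite lee_fin ltW.
by rewrite ge0_integral_prior.
Qed.

(** The numerator is bounded model by model, while the denominator keeps the single model [S0]. *)
Lemma posterior_le (U : {set 'I_p} -> R) (l : R) (B : set 'cV[R]_d) S0 :
  measurable B -> 0 < l -> 0 < model_weight pmf S0 -> (forall S, 0 <= U S) ->
  (forall S, (model_integral G lam LL B S <= (U S)%:E)%E) ->
  (l%:E <= model_integral G lam LL setT S0)%E ->
  (posterior X (prior G lam pmf) y B
   <= ((\sum_S model_weight pmf S * U S) / (model_weight pmf S0 * l))%:E)%E.
Proof.
move=> mB l0 w0 U0 BU lS.
have mi0 B' (S : {set 'I_p}) : (0 <= model_integral G lam LL B' S)%E.
  apply: integral_ge0 => v _.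
  by rewrite mule_ge0 ?lee_fin ?slab_density_ge0 ?mulr_ge0 ?expR_ge0.
rewrite /posterior !integral_prior_likelihood//.
set c := likelihood X b0 y.
have -> : (\sum_S model_weight pmf S * U S) / (model_weight pmf S0 * l)
  = (c * \sum_S model_weight pmf S * U S) / (c * (model_weight pmf S0 * l)).
  by rewrite -mulf_div mulfV ?mul1r// gt_eqF.
apply: lee_div_bound.
- rewrite mule_ge0 ?lee_fin ?(ltW lik0)//; apply: sume_ge0 => S _.
  by rewrite mule_ge0// lee_fin model_weight_ge0.
- by rewrite mulr_gt0// mulr_gt0.
- rewrite EFinM lee_pmul2l ?lte_fin// -sumEFin; apply: lee_sum => S _.
  by rewrite [leRHS]EFinM lee_wpmul2l// lee_fin model_weight_ge0.
- rewrite EFinM lee_pmul2l ?lte_fin// (bigD1 S0)//=.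
  rewrite -[leLHS]adde0 leeD//; last first.
    by apply: sume_ge0 => S _; rewrite mule_ge0// lee_fin model_weight_ge0.
  by rewrite EFinM lee_wpmul2l// lee_fin ltW.
Qed.

End posterior_bounds.

(** * The event on which the noise is dominated by the penalty *)

Section noise_event.
Context {R : realType} {m n d p : nat} (X : 'I_n -> 'M[R]_(m.-1, d)).
Variable G : 'I_p -> {set 'I_d}.
Hypothesis GP : group_partition G.
Context {disp : measure_display} {Om : measurableType disp}.
Variables (Z : 'I_n -> Om -> 'I_m) (P : probability Om R) (b0 : 'cV[R]_d).
Hypothesis m0 : (0 < m)%N.
Hypothesis indep : independent_responses Z P.
Hypothesis model : logit_model X Z P b0.

Local Notation q := (category_prob Z P).
Local Notation x := (starnorm G (stack X)).
Local Notation N := (norm21 G [set: 'I_p]%SET).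

(** The largest block norm is dual to [norm21]: on this event the noise term is at most [t] times
    the norm. *)
Definition quiet (t : R) (y : {ffun 'I_n -> 'I_m}) : bool :=
  [forall j, norm2 (group_sub G ((stack X)^T *m noise q y) j) <= t].

Definition loglik (y : {ffun 'I_n -> 'I_m}) (b : 'cV[R]_d) : R :=
  dot (noise q y) (stack X *m (b - b0)) - loglik_drift X Z P (b - b0).

Lemma measurable_loglik y : measurable_fun setT (loglik y).
Proof.
apply: measurable_funB; first exact: measurable_dot_mulmx.
apply: measurable_sum => i; apply: measurableT_comp; first exact: measurable_ln.
apply: measurable_sum => k; apply: measurable_funM => //.
apply: measurableT_comp => //; exact: measurable_dot_mulmx.
Qed.

Lemma noise_dot_le t y (u : 'cV[R]_d) : quiet t y ->
  dot (noise q y) (stack X *m u) <= t * N u.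
Proof.
move=> /forallP qt; rewrite dot_mulmxr (dot_groups GP) /norm21 mulr_sumr.
rewrite [leRHS](eq_bigl predT); last by move=> j; rewrite finset.inE.
apply: ler_sum => j _; rewrite (le_trans (dot_le_norm2 _ _))//.
by rewrite ler_wpM2r ?norm2_ge0.
Qed.

(** Union bound over the groups, each of dimension at most [max_group G]. *)
Lemma noisy_le t : 0 < x -> 0 <= t ->
  law_mean q (fun y => (~~ quiet t y)%:R)
  <= p%:R * (Num.sqrt 3 ^+ max_group G * expR (- (t ^+ 2 / (12 * x ^+ 2)))).
Proof.
move=> x0 t0.
apply: (@le_trans _ _ (law_mean q (fun y => \sum_j
    (t < norm2 (group_sub G ((stack X)^T *m noise q y) j))%R%:R))).
  apply: law_mean_le; first exact: category_prob_ge0.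
  move=> y; case: (boolP (quiet t y)) => [_|]; first by rewrite sumr_ge0.
  rewrite negb_forall => /existsP[j]; rewrite -ltNge => tj.
  by rewrite (bigD1 j)//= tj lerDl sumr_ge0.
rewrite law_mean_sum.
set c := Num.sqrt 3 ^+ max_group G * _.
have -> : p%:R * c = \sum_(j < p) c by rewrite sumr_const card_ord mulr_natl.
rewrite {}/c; apply: ler_sum => j _.
pose A := colsub (enum_val : 'I_#|G j| -> 'I_d) (stack X).
have AE y : group_sub G ((stack X)^T *m noise q y) j = A^T *m noise q y.
  apply/colP => i; rewrite mxE [LHS]mxE [RHS]mxE; apply: eq_bigr => k _.
  by rewrite ![(_^T) _ _]mxE [A _ _]mxE.
under [X in X <= _]eq_bigr do rewrite AE.
apply: le_trans (noise_tail (category_prob_ge0 Z P) (sum_category_prob indep)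
  x0 (spnorm_le_starnorm G (stack X) j) t0) _.
rewrite ler_wpM2r ?expR_ge0// ler_weXn2l//.
  by rewrite -[leLHS]sqrtr1 ler_wsqrtr// ler1n.
exact: leq_bigmax.
Qed.

Lemma likelihood_loglik (y : {ffun 'I_n -> 'I_m}) b :
  likelihood X b (fun i => category (y i))
  = likelihood X b0 (fun i => category (y i)) * expR (loglik y b).
Proof. exact: (likelihood_ratio m0 indep model). Qed.

(** Off the quiet event the posterior is bounded by 1, and the probability of that event is
    added. *)
Lemma expected_posterior_le (Pi : {measure set 'cV[R]_d -> \bar R}) B t (e : R) :
  measurable B -> 0 < x -> 0 <= t -> 0 <= e ->
  (forall y, quiet t y ->
    (posterior X Pi (fun i => category (y i)) B <= e%:E)%E) ->
  (\int[P]_w posterior X Pi (response_block Z w) B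
   <= (p%:R * (Num.sqrt 3 ^+ max_group G * expR (- (t ^+ 2 / (12 * x ^+ 2)))) + e)%:E)%E.
Proof.
move=> mB x0 t0 e0 qe.
pose g (y : {ffun 'I_n -> 'I_m}) := posterior X Pi (fun i => category (y i)) B.
have -> : (\int[P]_w posterior X Pi (response_block Z w) B
    = \int[P]_w g (outcome Z w))%E.
  apply: eq_integral => w _.
  rewrite /g; congr (posterior X Pi _ B); apply/funext => i; by rewrite ffunE.
rewrite ge0_integral_outcome//; last by move=> y; exact: posterior_ge0.
apply: (@le_trans _ _ (law_mean q (fun y => (~~ quiet t y)%:R + e))%:E); last first.
  rewrite lee_fin.
  have -> : law_mean q (fun y => (~~ quiet t y)%:R + e)
      = law_mean q (fun y => (~~ quiet t y)%:R) + law_mean q (fun=> e * 1).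
    by rewrite -big_split; apply: eq_bigr => y _; rewrite mulr1 mulrDr.
  rewrite law_meanZ law_mean1; last exact: sum_category_prob.
  by rewrite mulr1 lerD2r noisy_le.
rewrite -sumEFin; apply: lee_sum => y _; rewrite EFinM lee_wpmul2l//.
  by rewrite lee_fin law_ge0//; exact: category_prob_ge0.
case: (boolP (quiet t y)) => [h|_]; first by rewrite add0r; exact: qe.
apply: (@le_trans _ _ 1%E); last by rewrite lee_fin lerDl.
apply: posterior_le1 => //.
exact: measurable_likelihood (measurable_loglik y) (likelihood_loglik y).
Qed.

End noise_event.

(** * Model sizes *)

Section model_size_prior.
Context {R : realType} {p : nat} (pmf : nat -> {nonneg R}) (r1 r2 : R).
Hypothesis p0 : (0 < p)%N.
Hypothesis r10 : 0 < r1.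
Hypothesis pmf_ratio : forall s, (1 <= s <= p)%N ->
  r1 <= (pmf s)%:num / (pmf s.-1)%:num <= r2.
Hypothesis pmf_sum : \sum_(k < p.+1) (pmf k)%:num = 1.

(** As division by 0 gives 0, a positive ratio forces numerator and denominator to be nonzero; the
    size 0 is reached as denominator of the first ratio, which exists because p > 0. *)
Lemma pmf_gt0 s : (s <= p)%N -> 0 < (pmf s)%:num.
Proof.
have pos t : (1 <= t <= p)%N -> 0 < (pmf t)%:num / (pmf t.-1)%:num.
  by move=> /pmf_ratio/andP[h _]; exact: lt_le_trans h.
case: s => [_|s sp].
  have := pos 1%N; rewrite p0 => /(_ isT) /=; rewrite lt_def mulf_eq0 invr_eq0.
  by rewrite negb_or => /andP[/andP[_ h] _]; rewrite lt_def h /=.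
have := pos s.+1; rewrite sp => /(_ isT) /=; rewrite lt_def mulf_eq0.
by rewrite negb_or => /andP[/andP[h _] _]; rewrite lt_def h /=.
Qed.

Lemma pmf_step s : (s < p)%N ->
  r1 * (pmf s)%:num <= (pmf s.+1)%:num <= r2 * (pmf s)%:num.
Proof.
move=> sp; have /pmf_ratio : (1 <= s.+1 <= p)%N by rewrite sp.
by rewrite /= ler_pdivlMr ?ler_pdivrMr ?pmf_gt0// ltnW.
Qed.

Lemma pmf_le s k : (s + k <= p)%N -> (pmf (s + k))%:num <= r2 ^+ k * (pmf s)%:num.
Proof.
elim: k => [|k ih] skp; first by rewrite addn0 expr0 mul1r.
rewrite addnS in skp *; have /andP[_ h] := pmf_step skp.
have r20 : 0 <= r2.
  have := le_trans (ltW r10) (le_trans (andP (pmf_ratio (_ : (1 <= 1 <= p)%N))).1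
    (andP (pmf_ratio (_ : (1 <= 1 <= p)%N))).2); by apply; rewrite p0.
by rewrite (le_trans h)// exprS -mulrA ler_wpM2l// ih// ltnW.
Qed.

Lemma pmf_ge s : (s <= p)%N -> r1 ^+ s * (pmf 0)%:num <= (pmf s)%:num.
Proof.
elim: s => [|s ih] sp; first by rewrite expr0 mul1r.
have /andP[h _] := pmf_step sp; rewrite (le_trans _ h)// exprS -mulrA.
by rewrite ler_wpM2l ?(ltW r10)// ih// ltnW.
Qed.

(** The subtracted term is what carries the induction through. *)
Lemma geometric_half_le (q : R) k : 0 <= q <= 1 / 2 ->
  \sum_(j < k) q ^+ j <= 2 - 2 * q ^+ k.
Proof.
move=> /andP[q0 q2]; elim: k => [|k ih]; first by rewrite big_ord0 expr0; lra.
rewrite big_ord_recr/= exprS; have := exprn_ge0 k q0 => qk.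
have : q * q ^+ k <= 1 / 2 * q ^+ k by rewrite ler_wpM2r.
by lra.
Qed.

Lemma geometric_shift_le (q : R) s k : 0 <= q <= 1 / 2 ->
  \sum_(j < k | (s < j)%N) q ^+ (j - s) <= 2 * q.
Proof.
move=> q01; have /andP[q0 q2] := q01.
apply: (@le_trans _ _ (\sum_(i < k) q * q ^+ i)); last first.
  rewrite -mulr_sumr mulrC ler_wpM2r//.
  by have := geometric_half_le k q01; have := exprn_ge0 k q0; lra.
have [sk|ks] := ltnP s k; last first.
  rewrite big1; first by rewrite sumr_ge0// => i _; rewrite mulr_ge0 ?exprn_ge0.
  by move=> j sj; have := ltn_trans sj (ltn_ord j); rewrite ltnNge ks.
have -> : k = (s.+1 + (k - s.+1))%N by rewrite subnKC.
rewrite big_split_ord/= big_pred0 ?add0r; last first.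
  by move=> j /=; rewrite ltnNge -ltnS ltn_ord.
rewrite [leRHS]big_split_ord/= addrC.
rewrite (eq_bigl predT); last by move=> j; rewrite /= addSn ltnS leq_addr.
rewrite [X in X <= _](_ : _ = \sum_(i < k - s.+1) q * q ^+ i); last first.
  by apply: eq_bigr => i _; rewrite addSn subSn ?leq_addr// addKn exprS.
apply: (@le_trans _ _ (\sum_(i < s.+1 + (k - s.+1)) q * q ^+ i)).
  rewrite addnC big_split_ord/= lerDl sumr_ge0// => i _.
  by rewrite mulr_ge0 ?exprn_ge0.
by rewrite big_split_ord/= addrC.
Qed.

(** The total mass 1 is at most pmf 0 times a geometric series of sum at most 2. *)
Lemma pmf0_ge : r2 <= 1 / 2 -> 1 / 2 <= (pmf 0)%:num.
Proof.
move=> r2h; have r20 : 0 <= r2.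
  have := le_trans (ltW r10) (le_trans (andP (pmf_ratio (_ : (1 <= 1 <= p)%N))).1
    (andP (pmf_ratio (_ : (1 <= 1 <= p)%N))).2); by apply; rewrite p0.
have : 1 <= \sum_(k < p.+1) r2 ^+ k * (pmf 0)%:num.
  rewrite -pmf_sum; apply: ler_sum => k _.
  by have := @pmf_le 0 k; rewrite add0n -ltnS ltn_ord => /(_ isT).
rewrite -mulr_suml; have r2i : 0 <= r2 <= 1 / 2 by rewrite r20.
have := geometric_half_le p.+1 r2i; have := exprn_ge0 p.+1 r20 => h1 h2 h3.
have : 1 <= 2 * (pmf 0)%:num.
  by rewrite (le_trans h3)// ler_wpM2r//; lra.
by lra.
Qed.

(** The 'C(p, k) models of size k share the mass of that size equally. *)
Lemma sum_model_weight (F : nat -> R) :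
  \sum_(S : {set 'I_p}) model_weight pmf S * F #|S| = \sum_(k < p.+1) (pmf k)%:num * F k.
Proof.
have cS (S : {set 'I_p}) : (#|S| < p.+1)%N.
  by rewrite ltnS -[X in (_ <= X)%N]card_ord max_card.
rewrite (partition_big (fun S => Ordinal (cS S)) predT)//=; apply: eq_bigr => k _.
rewrite (eq_bigr (fun=> (pmf k)%:num / 'C(p, k)%:R * F k)); last first.
  by move=> S /eqP <-.
rewrite sumr_const (_ : #|_| = 'C(p, k)); last first.
  have := card_draws 'I_p k; rewrite card_ord => <-; rewrite cardsE.
  by apply: eq_card => S; rewrite !unfold_in.
rewrite -[LHS]mulr_natr mulrAC divfK// pnatr_eq0 -lt0n bin_gt0 -ltnS.
exact: ltn_ord.
Qed.

End model_size_prior.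

Section rate_sums.
Context {R : realType} {p : nat} (pmf : nat -> {nonneg R}).

(* Model sizes k <= xi are beaten by the separation exponent (4 + Cxi + A3) Lr v,
   larger ones by the geometric decay of the prior. The base a stands for
   4 ^ gbar, the price of integrating over one more group, and eta for
   ln 4 / ln n. *)
Lemma posterior_ratio_le (A1 A2 A3 A4 Lr eta Cxi Phi v a xi : R) (s0 : nat)
    (kappa : nat -> R) :
  (0 < p)%N -> 0 < A1 -> 0 < A2 -> 0 < A3 -> 0 < A4 -> 1 <= Lr ->
  (forall s, (1 <= s <= p)%N ->
    A1 / expR (A3 * Lr) <= (pmf s)%:num / (pmf s.-1)%:num <= A2 / expR (A4 * Lr)) ->
  \sum_(k < p.+1) (pmf k)%:num = 1 ->
  0 <= eta -> eta <= 1 -> eta <= A4 / 400 -> ln A2 <= A4 / 400 * Lr -> - ln A1 <= Lr ->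
  ln 2 <= A4 / 200 * Lr ->
  1 <= a -> a <= expR (eta * Lr) -> 0 <= Phi -> 1 <= v -> s0%:R <= v ->
  xi = s0%:R + (4 * s0%:R + 100 * Phi) / A4 -> xi <= Cxi * v -> (s0 <= p)%N ->
  (forall k, kappa k = if k%:R <= xi then - ((4 + Cxi + A3) * Lr * v)
    else 99 * (Lr * Phi)) ->
  expR (2 * Lr * s0%:R) / (pmf s0)%:num *
    \sum_(k < p.+1) (pmf k)%:num * (a ^+ k * expR (kappa k))
  <= 2 * expR (- Lr) + 2 * expR (- (A4 / 200 * Lr)).
Proof.
move=> p0 A10 A20 A30 A40 Lr1 ratio psum eta0 eta1 etaA lnA2 lnA1 ln2 a1 aE.
move=> Phi0 v1 s0v xiE xiC s0p kE.
have r10 : 0 < A1 / expR (A3 * Lr) by rewrite divr_gt0 ?expR_gt0.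
have Lr0 : 0 < Lr by lra.
set q := expR (- (A4 / 200 * Lr)).
have qi : 0 <= q <= 1 / 2.
  rewrite expR_ge0/= /q expRN div1r lef_pV2 ?posrE ?expR_gt0//.
  by rewrite -[leLHS]lnK ?posrE// ler_expR.
have r2E : A2 / expR (A4 * Lr) = expR (ln A2 - A4 * Lr) by rewrite expRB lnK ?posrE.
have r1E : A1 / expR (A3 * Lr) = expR (ln A1 - A3 * Lr) by rewrite expRB lnK ?posrE.
have pm s : (s <= p)%N -> 0 < (pmf s)%:num by exact: (pmf_gt0 p0 r10 ratio).
have r2h : A2 / expR (A4 * Lr) <= 1 / 2.
  rewrite r2E div1r -[leRHS]lnK ?posrE ?invr_gt0// ler_expR lnV ?posrE//.
  have : A4 / 400 * Lr <= A4 / 2 * Lr by rewrite ler_wpM2r ?(ltW Lr0)//; lra.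
  have : A4 / 200 * Lr <= A4 / 2 * Lr by rewrite ler_wpM2r ?(ltW Lr0)//; lra.
  by lra.
have pm0 := pmf0_ge p0 r10 ratio psum r2h.
have ak (k : nat) : a ^+ k <= expR (eta * Lr * k%:R).
  by rewrite expRM_natr lerXn2r ?nnegrE ?expR_ge0//; lra.
have a0 (k : nat) : 0 <= a ^+ k by rewrite exprn_ge0//; lra.
rewrite mulr_sumr.
(* Sizes up to xi contribute a multiple of their own prior mass, which sums to 1; larger sizes
   contribute a geometric tail starting after s0. *)
apply: (@le_trans _ _ (\sum_(k < p.+1) ((pmf k)%:num * (2 * expR (- Lr))
    + (if (s0 < k)%N then q ^+ (k - s0) else 0)))); last first.
  rewrite big_split/= -mulr_suml psum mul1r lerD2l -big_mkcond/=.
  exact: geometric_shift_le.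
apply: ler_sum => k _; have kp : (k <= p)%N by rewrite -ltnS.
rewrite kE; case: (leP k%:R xi) => [kxi|xik].
  apply: ler_wpDr; first by case: ifP => // _; rewrite exprn_ge0 ?expR_ge0.
  rewrite mulrCA ler_wpM2l//.
  (* The lower ratios are chained from size 0, which has mass at least 1/2. This price, A3 + 1 per
     true group, is why A3 enters the separation exponent. *)
  have pi : ((pmf s0)%:num)^-1 <= 2 * expR ((A3 + 1) * Lr * s0%:R).
    rewrite -[leRHS]invrK lef_pV2 ?posrE ?pm// ?invr_gt0 ?mulr_gt0 ?expR_gt0//.
    apply: le_trans (pmf_ge p0 r10 ratio s0p).
    rewrite r1E invfM -expRN mulrC.
    apply: ler_pM; rewrite ?invr_ge0 ?expR_ge0//; last by lra.
    rewrite -expRM_natr ler_expR mulrBl mulrDl mulrDl mul1r.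
    have : - ln A1 * s0%:R <= Lr * s0%:R by rewrite ler_wpM2r.
    by lra.
  apply: (@le_trans _ _ (expR (2 * Lr * s0%:R) * (2 * expR ((A3 + 1) * Lr * s0%:R))
      * (expR (eta * Lr * k%:R) * expR (- ((4 + Cxi + A3) * Lr * v))))).
    apply: ler_pM.
    - by rewrite mulr_ge0 ?expR_ge0 ?invr_ge0.
    - by rewrite mulr_ge0 ?expR_ge0.
    - by rewrite ler_wpM2l ?expR_ge0.
    - by rewrite ler_wpM2r ?expR_ge0.
  have -> : expR (2 * Lr * s0%:R) * (2 * expR ((A3 + 1) * Lr * s0%:R))
      * (expR (eta * Lr * k%:R) * expR (- ((4 + Cxi + A3) * Lr * v)))
    = 2 * (expR (2 * Lr * s0%:R) * expR ((A3 + 1) * Lr * s0%:R)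
      * (expR (eta * Lr * k%:R) * expR (- ((4 + Cxi + A3) * Lr * v)))) by ring.
  rewrite ler_wpM2l// -!expRD ler_expR.
  have h1 : (3 + A3) * Lr * s0%:R <= (3 + A3) * Lr * v.
    by rewrite ler_wpM2l// mulr_ge0 ?(ltW Lr0)//; lra.
  have h2 : eta * Lr * k%:R <= Lr * (Cxi * v).
    apply: (@le_trans _ _ (1 * Lr * k%:R)).
      by rewrite !ler_wpM2r ?ler0n ?(ltW Lr0).
    by rewrite mul1r ler_wpM2l ?(ltW Lr0)// (le_trans kxi).
  have h3 : Lr * 1 <= Lr * v by rewrite ler_wpM2l ?(ltW Lr0).
  by lra.
apply: ler_wpDl; first by rewrite !mulr_ge0 ?expR_ge0.
have s0xi : s0%:R <= xi.
  by rewrite xiE lerDl divr_ge0 ?(ltW A40)// addr_ge0// mulr_ge0.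
have s0k : (s0 < k)%N by rewrite -(ltr_nat R) (le_lt_trans s0xi).
rewrite s0k; set t := (k - s0)%N.
have stk : (s0 + t)%N = k by rewrite subnKC// ltnW.
have kt : k%:R = s0%:R + t%:R :> R by rewrite -natrD stk.
have pk : (pmf k)%:num / (pmf s0)%:num <= expR ((ln A2 - A4 * Lr) * t%:R).
  rewrite ler_pdivrMr ?pm// expRM_natr -r2E.
  have := pmf_le p0 r10 ratio (s := s0) (k := t).
  by rewrite stk => /(_ kp).
have -> : expR (2 * Lr * s0%:R) / (pmf s0)%:num
    * ((pmf k)%:num * (a ^+ k * expR (99 * (Lr * Phi))))
  = expR (2 * Lr * s0%:R) * ((pmf k)%:num / (pmf s0)%:num)
    * (a ^+ k * expR (99 * (Lr * Phi))).
  by ring.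
apply: (@le_trans _ _ (expR (2 * Lr * s0%:R) * expR ((ln A2 - A4 * Lr) * t%:R)
   * (expR (eta * Lr * k%:R) * expR (99 * (Lr * Phi))))).
  apply: ler_pM.
  - by rewrite mulr_ge0 ?expR_ge0 ?divr_ge0.
  - by rewrite mulr_ge0 ?expR_ge0.
  - by rewrite ler_wpM2l ?expR_ge0.
  - by rewrite ler_wpM2r ?expR_ge0.
rewrite -!expRD /q -expRM_natr ler_expR kt.
(* This is where the form of xi is used: 3 s0 + 99 Phi is at most 99/100 of A4 t. Half of the
   remaining hundredth pays for ln A2 and eta, A4 / 400 each; the other half is the exponent of
   q. *)
have h0 : 4 * s0%:R + 100 * Phi <= A4 * t%:R.
  have : (4 * s0%:R + 100 * Phi) / A4 <= t%:R by move: xik; rewrite xiE kt ltrD2l => /ltW.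
  by rewrite ler_pdivrMr// [t%:R * _]mulrC.
have t0 : 0 <= t%:R :> R by [].
have s00 : 0 <= s0%:R :> R by [].
have h1 : Lr * (4 * s0%:R + 100 * Phi) <= Lr * (A4 * t%:R) by rewrite ler_wpM2l ?(ltW Lr0).
have h2 : ln A2 * t%:R <= A4 / 400 * Lr * t%:R by rewrite ler_wpM2r.
have h3 : eta * (Lr * t%:R) <= A4 / 400 * (Lr * t%:R).
  by rewrite ler_wpM2r// mulr_ge0// ltW.
have h4 : eta * (Lr * s0%:R) <= 1 * (Lr * s0%:R).
  by rewrite ler_wpM2r// mulr_ge0// ltW.
have h5 : 0 <= Lr * s0%:R by rewrite mulr_ge0// ltW.
have h6 : 0 <= Lr * (A4 * t%:R) by rewrite !mulr_ge0 ?(ltW Lr0) ?(ltW A40).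
by lra.
Qed.

End rate_sums.

(** * Contraction at a fixed sample size *)

Section rate.
Context {R : realType} {d p : nat} (G : 'I_p -> {set 'I_d}).
Hypothesis GP : group_partition G.
Hypothesis p0 : (0 < p)%N.

Local Notation Lr n := (log_rate G n : R).

Lemma expR_log_rate n : (0 < n)%N ->
  expR (Lr n) = (maxn p (n ^ max_group G))%:R.
Proof.
move=> n0; rewrite natr_max natrX /log_rate.
have E k : (0 < k)%N -> expR (ln k%:R) = k%:R :> R by move=> ?; rewrite lnK ?posrE ?ltr0n.
have En : expR ((max_group G)%:R * ln n%:R) = n%:R ^+ max_group G :> R.
  by rewrite expRM_natl E.
have h : {homo (@expR R) : a b / a <= b} by move=> a b; rewrite ler_expR.
case: (leP (ln p%:R) _) => [/h|/ltW/h]; rewrite E// En.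
  by move=> /max_idPr ->.
by move=> /max_idPl ->.
Qed.

Lemma ln_natr_le_log_rate n : ln p%:R <= Lr n.
Proof. by rewrite le_max lexx. Qed.

Lemma max_group_le_log_rate n : (max_group G)%:R * ln n%:R <= Lr n.
Proof. by rewrite le_max lexx orbT. Qed.

Lemma max_group_gt0 : (0 < max_group G)%N.
Proof.
have j : 'I_p by exact: Ordinal p0.
by rewrite (leq_trans (card_group_gt0 GP j))// /max_group leq_bigmax.
Qed.

Lemma ln_le_log_rate n : ln n%:R <= Lr n.
Proof.
apply: le_trans (max_group_le_log_rate n).
case: n => [|n]; first by rewrite ln0// mulr0.
by rewrite ler_peMl ?ln_ge0 ?ler1n// max_group_gt0.
Qed.

Lemma card_coords_le (S : {set 'I_p}) : (#|coords G S| <= max_group G * #|S|)%N.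
Proof.
rewrite card_coords// mulnC -sum_nat_const; apply: leq_sum => j _.
exact: leq_bigmax.
Qed.

Lemma binomial_le_exp k s : ('C(k, s) <= k ^ s)%N.
Proof.
apply: (@leq_trans (k ^_ s)); first by rewrite -bin_ffact leq_pmulr// fact_gt0.
rewrite ffact_prod -[s in (_ ^ s)%N](card_ord s) -prod_nat_const leq_prod// => i _.
exact: leq_subr.
Qed.

End rate.

Section posterior_contraction.
Context {R : realType} {m n d p : nat} (X : 'I_n -> 'M[R]_(m.-1, d)).
Variable G : 'I_p -> {set 'I_d}.
Hypothesis GP : group_partition G.
Context {disp : measure_display} {Om : measurableType disp}.
Variables (Z : 'I_n -> Om -> 'I_m) (P : probability Om R) (b0 : 'cV[R]_d).
Hypothesis m0 : (0 < m)%N.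
Hypothesis indep : independent_responses Z P.
Hypothesis model : logit_model X Z P b0.

Local Notation q := (category_prob Z P).
Local Notation x := (starnorm G (stack X)).
Local Notation N := (norm21 G [set: 'I_p]%SET).
Local Notation S0 := (group_supp G b0).
Local Notation K := (\big[Num.max/0]_(i < n) starnorm G (X i)).
Local Notation Lr := (log_rate G n : R).
Local Notation rL := (Num.sqrt Lr).
Local Notation lam := (slab_rate X G).
Local Notation Q u := (norm2 (sqrtmx (response_cov Z P) *m (stack X *m u))).
Local Notation drift := (loglik_drift X Z P).
Local Notation LL := (loglik X Z P b0).

Hypothesis x0 : 0 < x.
Hypothesis Lr1 : 1 <= Lr.

Lemma max_starnorm_ge0 : 0 <= K.
Proof. by elim/big_rec: _ => // i y _ y0; rewrite le_max y0 orbT. Qed.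

Lemma norm2_design_le i u : norm2 (X i *m u) <= K * N u.
Proof.
rewrite (le_trans (norm2_mulmx_starnorm GP _ _))// ler_wpM2r ?norm21_ge0//.
by rewrite (bigmaxD1 i)//= le_max lexx.
Qed.

Lemma drift_ge u : Q u ^+ 2 / (2 + 8 * (K * N u)) <= drift u.
Proof.
apply: loglik_drift_ge => //; first by rewrite mulr_ge0 ?max_starnorm_ge0 ?norm21_ge0.
by move=> i; exact: norm2_design_le.
Qed.

Lemma rL_gt0 : 0 < rL.
Proof. by rewrite sqrtr_gt0 (lt_le_trans _ Lr1). Qed.

Lemma sqr_rL : rL ^+ 2 = Lr.
Proof. by rewrite sqr_sqrtr// (le_trans _ Lr1). Qed.

Section penalized.
Variables (Phi : R) (y : {ffun 'I_n -> 'I_m}).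
Hypothesis Phi0 : 0 <= Phi.
Hypothesis compat : forall u, norm21 G (~: S0)%SET u <= 7 * norm21 G S0 u ->
  x ^+ 2 * N u ^+ 2 <= Q u ^+ 2 * Phi.
Hypothesis bias : 11088 * (Phi * K * rL) <= x.
Hypothesis qy : quiet X G Z P (4 * x * rL) y.

Lemma loglik_quiet_le b : LL y b <= 4 * (x * rL * N (b - b0)) - drift (b - b0).
Proof. by rewrite lerD2r (le_trans (noise_dot_le GP _ qy))// -!mulrA. Qed.

(** b0 vanishes off the true groups, where b and b - b0 therefore agree; on them the triangle
    inequality is used. *)
Lemma norm21_true_le b :
  N b0 - N b <= norm21 G S0 (b - b0) - norm21 G (~: S0)%SET (b - b0).
Proof.
have c0 : norm21 G (~: S0)%SET b0 = 0 by exact: group_supp_subset0.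
rewrite !(norm21_setT _ S0) c0 addr0.
have := norm21B G S0 b0 b; rewrite -[leRHS]norm21N opprB.
have := norm21B G (~: S0)%SET (b - b0) (- b0).
by rewrite opprK subrK norm21N c0; lra.
Qed.

(** Valid for every b. Once the penalty, the noise and the reserved quarter of the rate are
    collected, 14 units on the true groups are set against 2 off them. *)
Lemma penalized_loglik_le b :
  LL y b + lam * N b0 - lam * N b <= 99 * (Lr * Phi) - lam / 4 * N (b - b0).
Proof.
have h1 := loglik_quiet_le b; have h2 := norm21_true_le b.
have lE : lam = 8 * (x * rL) by rewrite /slab_rate mulrA.
have xr0 : 0 < x * rL by rewrite mulr_gt0 ?rL_gt0.
have NS := norm21_setT G S0 (b - b0).
set u := b - b0 in h1 h2 NS *.
have u0 := norm21_ge0 G S0 u; have uc := norm21_ge0 G (~: S0)%SET u.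
have {}h2 : x * rL * (N b0 - N b) <= x * rL * (norm21 G S0 u - norm21 G (~: S0)%SET u).
  by rewrite ler_wpM2l// ltW.
suff h : 14 * (x * rL * norm21 G S0 u) - 2 * (x * rL * norm21 G (~: S0)%SET u)
    <= drift u + 99 * (Lr * Phi).
  by rewrite lE; move: h1; rewrite NS; lra.
(* In the cone [phi] gives curvature; outside it the linear terms are already nonpositive, because
   14 = 2 * 7. *)
have [cone|/ltW cone] := leP (norm21 G (~: S0)%SET u) (7 * norm21 G S0 u).
  have := curvature_cone x0 max_starnorm_ge0 (norm21_ge0 G [set: 'I_p]%SET u)
    (drift_ge u) Phi0 (compat cone) bias.
  rewrite sqr_rL NS.
  have : 0 <= x * rL * norm21 G (~: S0)%SET u by rewrite mulr_ge0// ltW.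
  by lra.
have D0 : 0 <= drift u by exact: loglik_drift_ge0.
have LP : 0 <= Lr * Phi by rewrite mulr_ge0// (le_trans _ Lr1).
by have := ler_wpM2l (ltW xr0) cone; lra.
Qed.

(** The plain triangle inequality charges all 8 + 4 + 2 = 14 units to the full norm; the drift is
    assumed to beat them with [c] to spare. *)
Lemma penalized_loglik_far_le b c :
  14 * (x * rL * N (b - b0)) + c <= drift (b - b0) ->
  LL y b + lam * N b0 - lam * N b <= - c - lam / 4 * N (b - b0).
Proof.
have h1 := loglik_quiet_le b.
have := norm21B G [set: 'I_p]%SET b0 b; rewrite -[leRHS]norm21N opprB => h2.
have xr0 : 0 < x * rL by rewrite mulr_gt0 ?rL_gt0.
have := ler_wpM2l (ltW xr0) h2.
have -> : lam = 8 * (x * rL) by rewrite /slab_rate mulrA.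
by lra.
Qed.

End penalized.

Variable pmf : nat -> {nonneg R}.

(** The prefactor collects two costs of the denominator, each at most exp(Lr s0): the number of
    models of the true size, at most p^s0, and the mass n^(- gbar s0) near b0. *)
Lemma posterior_model_sum_le (B : set 'cV[R]_d) y (kappa : nat -> R) :
  (0 < p)%N -> (2 <= n)%N -> measurable B -> 0 < (pmf #|S0|)%:num ->
  (forall b, B b -> forall k, (#|group_supp G b| <= k)%N ->
    LL y b + lam * N b0 - lam * N b <= kappa k - lam / 4 * N (b - b0)) ->
  (posterior X (logit_prior X G pmf) (fun i => category (y i)) B
   <= (expR (2 * Lr * #|S0|%:R) / (pmf #|S0|)%:num *
       \sum_(k < p.+1) (pmf k)%:num
         * ((4 ^+ max_group G) ^+ k * expR (kappa k)))%:E)%E.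
Proof.
move=> p0 n2 mB pm Bk.
have lam0 : 0 < lam by rewrite /slab_rate !mulr_gt0 ?rL_gt0.
set lamn := NngNum (slab_rate_ge0 X G).
have lamE : lamn%:num = lam by [].
have n1 : 0 < n%:R :> R by rewrite ltr0n (leq_trans _ n2).
have w0 : 0 < model_weight pmf S0.
  by rewrite divr_gt0// ltr0n bin_gt0 -[X in (_ <= X)%N]card_ord max_card.
pose U (S : {set 'I_p}) := expR (- (lam * N b0)) *
  ((4 ^+ max_group G) ^+ #|S| * expR (kappa #|S|)).
pose l := expR (- (lam * N b0)) * (n%:R^-1) ^+ (max_group G * #|S0|).
have l0 : 0 < l by rewrite mulr_gt0 ?expR_gt0// exprn_gt0// invr_gt0.
have g4 (S : {set 'I_p}) : 4 ^+ #|coords G S| <= (4 ^+ max_group G) ^+ #|S| :> R.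
  by rewrite -exprM ler_weXn2l ?card_coords_le// ler1n.
have mLL := measurable_loglik X Z P b0 y.
have U0 S : 0 <= U S by rewrite !mulr_ge0 ?expR_ge0 ?exprn_ge0.
have BU S : (model_integral G lamn (LL y) B S <= (U S)%:E)%E.
  apply: le_trans (model_integral_le GP (b0 := b0) (kappa := kappa #|S|) _ mLL mB _) _.
  - by [].
  - move=> v Bv; apply: Bk => //; exact: subset_leq_card (group_supp_extend GP v).
  - rewrite lee_fin expRD lamE [leRHS](_ : _ = expR (kappa #|S|)
      * expR (- (lam * N b0)) * (4 ^+ max_group G) ^+ #|S|); last by rewrite /U; ring.
    by rewrite ler_wpM2l// mulr_ge0 ?expR_ge0.
have lS : (l%:E <= model_integral G lamn (LL y) setT S0)%E.
  apply: le_trans _ (model_integral_ge GP (c := 4 * n%:R * x) _ mLL _ _).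
  - rewrite lee_fin /l lamE ler_wpM2l ?expR_ge0//.
    apply: (@le_trans _ _ ((n%:R^-1) ^+ #|coords G S0|)).
      apply: ler_wiXn2l; first by rewrite invr_ge0 ltW.
        by rewrite invf_le1// ler1n (leq_trans _ n2).
      exact: card_coords_le.
    (* The claim is lam + 4 n x <= n lam, which follows from lam = 8 x rL, rL >= 1 and n <= 2 (n -
       1). *)
    have c0 : 0 < lam + 4 * n%:R * x by rewrite addr_gt0// !mulr_gt0.
    rewrite lerXn2r ?nnegrE ?invr_ge0 ?divr_ge0 ?(ltW c0) ?(ltW n1) ?(ltW lam0)//.
    rewrite ler_pdivlMr// mulrC ler_pdivrMr//.
    have n2' : 2 <= n%:R :> R by rewrite ler_nat.
    have r1 : 1 <= rL by rewrite -sqrtr1 ler_wsqrtr.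
    have : 8 * x * (n%:R - 1) <= 8 * x * (n%:R - 1) * rL.
      rewrite ler_peMr// !mulr_ge0 ?(ltW x0)//; by lra.
    have : x * 2 <= x * n%:R by rewrite ler_wpM2l// ltW.
    by rewrite /slab_rate; lra.
  - by [].
  - by rewrite !mulr_ge0 ?(ltW x0).
  - move=> v.
    have h := loglik_ge indep y (r := x * N (extend v - b0)) (u := extend v - b0) (X := X).
    rewrite -[X in - X]mulrA; apply: h => i.
    exact: le_trans (norm2_block_le_stack _ _ _) (norm2_mulmx_starnorm GP _ _).
apply: le_trans (posterior_le mLL (likelihood_loglik m0 indep model y)
  (likelihood_gt0 _ _ _) mB l0 w0 U0 BU lS) _.
rewrite lee_fin.
have -> : \sum_S model_weight pmf S * U S = expR (- (lam * N b0)) *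
    \sum_(k < p.+1) (pmf k)%:num * ((4 ^+ max_group G) ^+ k * expR (kappa k)).
  rewrite -(sum_model_weight pmf (fun k => (4 ^+ max_group G) ^+ k * expR (kappa k))).
  by rewrite mulr_sumr; apply: eq_bigr => S _; rewrite mulrCA.
set W := \sum_(k < p.+1) _.
have W0 : 0 <= W by apply: sumr_ge0 => k _; rewrite !mulr_ge0 ?expR_ge0 ?exprn_ge0.
set E := expR (- (lam * N b0)); set g := (max_group G * #|S0|)%N.
have E0 : 0 < E by exact: expR_gt0.
set c := 'C(p, #|S0|)%:R : R.
have c0 : 0 < c.
  by rewrite ltr0n bin_gt0 -[X in (_ <= X)%N]card_ord max_card.
have ng0 : 0 < n%:R ^+ g :> R by rewrite exprn_gt0.
have -> : E * W / (model_weight pmf S0 * l) = c * n%:R ^+ g / (pmf #|S0|)%:num * W.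
  have quot (e w r k t : R) : e != 0 -> r != 0 -> k != 0 -> t != 0 ->
      e * w / (r / k * (e * t^-1)) = k * t / r * w.
    by move=> e0 r0 k0 t0; field; rewrite e0 r0 k0 t0.
  by rewrite /l exprVn quot// gt_eqF.
rewrite ler_wpM2r// ler_wpM2r ?invr_ge0//.
have -> : 2 * Lr * #|S0|%:R = Lr * #|S0|%:R + Lr * #|S0|%:R by ring.
rewrite expRD !expRM_natr; apply: ler_pM; rewrite ?(ltW c0) ?(ltW ng0)//.
  apply: (@le_trans _ _ (p%:R ^+ #|S0|)); first by rewrite -natrX ler_nat binomial_le_exp.
  rewrite lerXn2r ?nnegrE ?expR_ge0//.
  by rewrite -[leLHS]lnK ?posrE ?ltr0n// ler_expR ln_natr_le_log_rate.
rewrite exprM lerXn2r ?nnegrE ?expR_ge0 ?exprn_ge0 ?(ltW n1)//.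
rewrite -[X in X ^+ _]lnK ?posrE// -expRM_natl ler_expR.
exact: max_group_le_log_rate.
Qed.

End posterior_contraction.

Section contraction_bound.
Context {R : realType}.

(** The three terms are the probability of a loud noise, the models of size at most xi, and the
    larger models. *)
Definition contraction_bound (A4 r : R) : R :=
  expR (- (r / 4)) + 2 * expR (- r) + 2 * expR (- (A4 / 200 * r)).

(** A sum of nonnegative requirements, each of which is met once ln n exceeds the sum. It involves
    the prior constants only. *)
Definition log_threshold (A1 A2 A4 : R) : R :=
  1 + 12 * ln 2 + 400 / A4 * (`|ln A2| + ln 4) + `|ln A1|.

Lemma log_thresholdP A1 A2 A4 L : 0 < A4 -> log_threshold A1 A2 A4 <= L ->
  [/\ 1 <= L, 12 * ln 2 <= L, - ln A1 <= L, ln A2 <= A4 / 400 * L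
    & ln 4 <= A4 / 400 * L].
Proof.
move=> A40; rewrite /log_threshold.
have l2 : 0 <= ln 2 :> R by rewrite ln_ge0// ler1n.
have l4 : 0 <= ln 4 :> R by rewrite ln_ge0// ler1n.
have c0 : 0 < 400 / A4 := divr_gt0 (ltr0n _ 400) A40.
have -> : A4 / 400 = (400 / A4)^-1 by rewrite invf_div.
move: c0; move: (400 / A4) => c c0.
have := mulr_ge0 (ltW c0) (addr_ge0 (normr_ge0 (ln A2)) l4).
rewrite !ler_pdivlMl//; have := ler_norm (- ln A1); rewrite normrN.
have := ler_wpM2l (ltW c0) (ler_norm (ln A2)).
have := mulr_ge0 (ltW c0) (normr_ge0 (ln A2)); have := mulr_ge0 (ltW c0) l4.
rewrite mulrDr; have := normr_ge0 (ln A1).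
move: (c * _) (c * _) (c * _) `|ln A1| (ln A1) (ln 2) l2 => u u' u'' w z k k0.
by move=> *; split; lra.
Qed.

Lemma contraction_bound_le A4 r t : 0 < A4 -> r <= t ->
  contraction_bound A4 t <= contraction_bound A4 r.
Proof.
move=> A40 rt; have h : A4 / 200 * r <= A4 / 200 * t.
  exact: ler_wpM2l (divr_ge0 (ltW A40) (ler0n _ 200)) _ _ rt.
rewrite !lerD ?ler_wpM2l ?ler_expR//; lra.
Qed.

End contraction_bound.

Section expected_posterior.
Context {R : realType} {m n d p : nat} (X : 'I_n -> 'M[R]_(m.-1, d)).
Variable G : 'I_p -> {set 'I_d}.
Hypothesis GP : group_partition G.
Context {disp : measure_display} {Om : measurableType disp}.
Variables (Z : 'I_n -> Om -> 'I_m) (P : probability Om R) (b0 : 'cV[R]_d).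
Hypothesis m0 : (0 < m)%N.
Hypothesis indep : independent_responses Z P.
Hypothesis model : logit_model X Z P b0.

Local Notation q := (category_prob Z P).
Local Notation x := (starnorm G (stack X)).
Local Notation N := (norm21 G [set: 'I_p]%SET).
Local Notation S0 := (group_supp G b0).
Local Notation K := (\big[Num.max/0]_(i < n) starnorm G (X i)).
Local Notation Lr := (log_rate G n : R).
Local Notation rL := (Num.sqrt Lr).
Local Notation Q u := (norm2 (sqrtmx (response_cov Z P) *m (stack X *m u))).
Local Notation drift := (loglik_drift X Z P).

(** In the main case [Phi] is s0 / phi^2 and [v] is s0 / (psi_1^2 phi^2), so that [Lr * v] is the
    squared estimation radius. Only the members of [B] with at most [xi] active groups have to be
    far from b0; the prior removes the others. *)
Lemma expected_posterior_far_le (A1 A2 A3 A4 Cxi Phi v xi : R)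
    (pmf : nat -> {nonneg R}) (B : set 'cV[R]_d) :
  0 < A1 -> 0 < A2 -> 0 < A3 -> 0 < A4 -> 0 < x ->
  log_threshold A1 A2 A4 <= ln n%:R ->
  \sum_(k < p.+1) (pmf k)%:num = 1 ->
  (forall s, (1 <= s <= p)%N ->
     A1 / (maxn p (n ^ max_group G))%:R `^ A3
       <= (pmf s)%:num / (pmf s.-1)%:num
       <= A2 / (maxn p (n ^ max_group G))%:R `^ A4) ->
  0 <= Phi -> 1 <= v -> #|S0|%:R <= v ->
  xi = #|S0|%:R + (4 * #|S0|%:R + 100 * Phi) / A4 -> xi <= Cxi * v ->
  (forall u, norm21 G (~: S0)%SET u <= 7 * norm21 G S0 u ->
    x ^+ 2 * N u ^+ 2 <= Q u ^+ 2 * Phi) ->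
  11088 * (Phi * K * rL) <= x ->
  measurable B ->
  (forall b, B b -> #|group_supp G b|%:R <= xi ->
    14 * (x * rL * N (b - b0)) + (4 + Cxi + A3) * Lr * v <= drift (b - b0)) ->
  (\int[P]_w posterior X (logit_prior X G pmf) (response_block Z w) B
   <= (contraction_bound A4 (ln n%:R))%:E)%E.
Proof.
move=> A10 A20 A30 A40 x0 thr psum ratio Phi0 v1 s0v xiE xiC compat bias mB far.
have p0 : (0 < p)%N.
  rewrite lt0n; apply: contraTneq x0 => p0'; rewrite -leNgt starnorm_le// => j.
  by have := ltn_ord j; rewrite [X in (_ < X)%N]p0'.
have l2 : 0 <= ln 2 :> R by rewrite ln_ge0// ler1n.
have l4 : ln 4 = ln 2 + ln 2 :> R.
  by rewrite -lnM ?posrE//; congr ln; ring.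
have [lnn1 ln12 lnA1 lnA2 lnB] := log_thresholdP A40 thr.
have n2 : (2 <= n)%N.
  have lnk k : (k <= 1)%N -> ln k%:R = 0 :> R
    by case: k => [|[|]]// _; rewrite ?ln1// ln0.
  by rewrite ltnNge; apply/negP => /lnk n1; move: lnn1; rewrite n1 ler10.
have l4n : ln 4 <= ln n%:R :> R 
  by rewrite l4 (le_trans _ ln12)// -mulr2n -[leLHS]mulr_natl ler_wpM2r// ler_nat.
have lnn0 : 0 < ln n%:R :> R := lt_le_trans ltr01 lnn1.
have nL : ln n%:R <= Lr := ln_le_log_rate GP p0 n.
have Lr1 : 1 <= Lr by exact: le_trans nL.
have n0 : (0 < n)%N by exact: leq_trans n2.
apply: (@le_trans _ _ (contraction_bound A4 Lr)%:E); last first.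
  by rewrite lee_fin contraction_bound_le.
have sA (c : R) : 0 < c -> c * ln n%:R <= c * Lr by move=> c0; rewrite ler_wpM2l// ltW.
have nA4 := sA _ (divr_gt0 A40 (ltr0n R 400)).
have hA4 : A4 / 200 = 2 * (A4 / 400) by field.
set g := max_group G.
have gL : g%:R * ln n%:R <= Lr := max_group_le_log_rate G n.
have rL0 := rL_gt0 Lr1.
have ratio' s : (1 <= s <= p)%N ->
    A1 / expR (A3 * Lr) <= (pmf s)%:num / (pmf s.-1)%:num <= A2 / expR (A4 * Lr).
  by move=> /ratio; rewrite -expR_log_rate// -!expRM ![Lr * _]mulrC.
have pm s : (s <= p)%N -> 0 < (pmf s)%:num.
  apply: (pmf_gt0 p0 _ ratio'); by rewrite divr_gt0 ?expR_gt0.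
have s0p : (#|S0| <= p)%N by rewrite -[X in (_ <= X)%N]card_ord max_card.
pose kappa k := if k%:R <= xi then - ((4 + Cxi + A3) * Lr * v) else 99 * (Lr * Phi).
have eps := @posterior_ratio_le R p pmf A1 A2 A3 A4 Lr (ln 4 / ln n%:R) Cxi Phi v
  (4 ^+ g) xi #|S0| kappa p0 A10 A20 A30 A40 Lr1 ratio' psum.
have {}eps : expR (2 * Lr * #|S0|%:R) / (pmf #|S0|)%:num *
    (\sum_(k < p.+1) (pmf k)%:num * ((4 ^+ g) ^+ k * expR (kappa k)))
    <= 2 * expR (- Lr) + 2 * expR (- (A4 / 200 * Lr)).
  apply: eps => //.
  - by rewrite divr_ge0 ?(ltW lnn0)// l4 addr_ge0.
  - by rewrite ler_pdivrMr// mul1r.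
  - by rewrite ler_pdivrMr.
  - exact: le_trans lnA2 nA4.
  - exact: le_trans lnA1 nL.
  - rewrite hA4; apply: (@le_trans _ _ (A4 / 400 * Lr)).
      by apply: le_trans nA4; apply: le_trans lnB; rewrite l4 lerDl.
    rewrite -[leRHS]mulrA; apply: ler_peMl; last by rewrite ler1n.
    by apply: le_trans nA4; apply: le_trans lnB; rewrite l4 addr_ge0.
  - by rewrite exprn_ege1// ler1n.
  - rewrite -[X in X ^+ _](@lnK R) ?posrE// -expRM_natl ler_expR.
    by rewrite mulrC -!mulrA ler_wpM2l ?l4 ?addr_ge0// ler_pdivlMl// mulrC.
have qpost y : quiet X G Z P (4 * x * rL) y ->
    (posterior X (logit_prior X G pmf) (fun i => category (y i)) B
     <= (2 * expR (- Lr) + 2 * expR (- (A4 / 200 * Lr)))%:E)%E.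
  move=> qy; apply: le_trans (posterior_model_sum_le GP m0 indep model x0 Lr1 p0 n2 mB
    (pm _ s0p) (kappa := kappa) _) _; last by rewrite lee_fin.
  move=> b Bb k bk; rewrite /kappa; case: (leP k%:R xi) => [kxi|_].
    apply: penalized_loglik_far_le => //.
    by apply: far => //; rewrite (le_trans _ kxi)// ler_nat.
  exact: penalized_loglik_le.
apply: le_trans (expected_posterior_le m0 indep model mB x0 _ _ qpost) _.
- by rewrite !mulr_ge0// ltW.
- by apply: addr_ge0; apply: mulr_ge0; rewrite ?expR_ge0.
rewrite lee_fin /contraction_bound addrA lerD2r lerD2r -/g.
have -> : (4 * x * rL) ^+ 2 / (12 * x ^+ 2) = 4 / 3 * Lr.
  rewrite -[in RHS](sqr_rL Lr1); move: rL => r; field; by rewrite gt_eqF.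
(* The Gaussian tail gives 4/3 = 16/12 of Lr; the union bound over p groups costs Lr, and the
   dimension of a group Lr / 12. *)
have -> : - (Lr / 4) = Lr + (Lr / 12 + - (4 / 3 * Lr)) by field.
rewrite expRD expRD; apply: ler_pM => //.
  by rewrite -[leLHS]lnK ?posrE ?ltr0n// ler_expR ln_natr_le_log_rate.
rewrite ler_wpM2r ?expR_ge0//.
(* sqrt 3 <= 2, and 12 ln 2 <= ln n by the threshold. *)
apply: (@le_trans _ _ (2 ^+ g)).
  rewrite lerXn2r ?nnegrE ?sqrtr_ge0//.
  by rewrite -[leRHS]ger0_norm// -sqrtr_sqr ler_wsqrtr// -natrX ler_nat.
rewrite -[X in X ^+ _](@lnK R) ?posrE// -expRM_natl ler_expR.
rewrite ler_pdivlMr// -mulrA; apply: le_trans gL.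
by rewrite ler_wpM2l// [leLHS]mulrC.
Qed.

End expected_posterior.

Section separated_sets.
Context {R : realType} {m n d p : nat} (X : 'I_n -> 'M[R]_(m.-1, d)).
Variable G : 'I_p -> {set 'I_d}.
Hypothesis GP : group_partition G.
Context {disp : measure_display} {Om : measurableType disp}.
Variables (Z : 'I_n -> Om -> 'I_m) (P : probability Om R) (b0 : 'cV[R]_d).
Hypothesis m0 : (0 < m)%N.
Hypothesis indep : independent_responses Z P.
Hypothesis model : logit_model X Z P b0.

Local Notation x := (starnorm G (stack X)).
Local Notation N := (norm21 G [set: 'I_p]%SET).
Local Notation S0 := (group_supp G b0).
Local Notation K := (\big[Num.max/0]_(i < n) starnorm G (X i)).
Local Notation Lr := (log_rate G n : R).
Local Notation rL := (Num.sqrt Lr).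
Local Notation Q u := (norm2 (sqrtmx (response_cov Z P) *m (stack X *m u))).

Variables (A1 A2 A3 A4 : R) (pmf : nat -> {nonneg R}).
Hypotheses (A10 : 0 < A1) (A20 : 0 < A2) (A30 : 0 < A3) (A40 : 0 < A4).
Hypothesis x0 : 0 < x.
Hypothesis p0 : (0 < p)%N.
Hypothesis thr : log_threshold A1 A2 A4 <= ln n%:R.
Hypothesis psum : \sum_(k < p.+1) (pmf k)%:num = 1.
Hypothesis ratio : forall s, (1 <= s <= p)%N ->
  A1 / (maxn p (n ^ max_group G))%:R `^ A3
    <= (pmf s)%:num / (pmf s.-1)%:num
    <= A2 / (maxn p (n ^ max_group G))%:R `^ A4.

(** Here b0 = 0 and xi = 0: the only vector with so small a support is b0, which [B] excludes, and
    the cone over no groups is reduced to 0. *)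
Lemma expected_posterior_null_le (B : set 'cV[R]_d) :
  #|S0| = 0%N -> measurable B -> ~ B b0 ->
  (\int[P]_w posterior X (logit_prior X G pmf) (response_block Z w) B
   <= (contraction_bound A4 (ln n%:R))%:E)%E.
Proof.
move=> s0 mB Bb0.
have E (b : 'cV[R]_d) : #|group_supp G b| = 0%N -> b = 0.
  by move/eqP; rewrite group_supp_eq0// => /eqP.
have S00 : S0 = finset.set0 by apply/eqP; rewrite -cards_eq0 s0.
apply: (@expected_posterior_far_le _ _ _ _ _ X G GP _ _ Z P b0 m0 indep model
  A1 A2 A3 A4 0 0 1 0 pmf B) => //.
- by rewrite s0.
- by rewrite s0 !mulr0 addr0 mul0r addr0.
- move=> u; rewrite S00 finset.setC0 mulr0 => h.
  have -> : N u = 0.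
    apply/eqP; rewrite eq_le norm21_ge0 andbT; move: h.
    by rewrite {2}/norm21 big_set0 mulr0.
  by rewrite expr0n !mulr0.
- by rewrite !mul0r mulr0 ltW.
- move=> b Bb; rewrite lern0 => /eqP /E b0'; exfalso; apply: Bb0.
  by rewrite (E b0 s0) -b0'.
Qed.

(** As s <= s / f^2, both copies of s in xi + s and the fraction over A4 are bounded by this
    multiple of s / f^2. *)
Definition sparsity_const : R := 2 + 104 / A4.

Lemma sparsity_const_ge2 : 2 <= sparsity_const.
Proof. by have A4' := A40; rewrite lerDl divr_ge0 ?ler0n// ltW. Qed.

Let Cxi := sparsity_const.
Let h := Num.sqrt Cxi.
Let C := 4 + Cxi + A3.
Let s : R := #|S0|%:R.

(** The value of [xi0] when [phi0] is the positive real [f]. *)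
Definition sparsity_bound (f : R) : R := s + (4 * s + 100 * (s / f ^+ 2)) / A4.

Section positive.
Variables (M3 M4 f g : R).
Hypotheses (M30 : 0 < M3) (M3_bias : 11088 * M3 <= 1) (M3_h : 672 * Cxi * M3 <= 1).
Hypotheses (M4_h : 84 * h <= M4) (M4_C : 6 * C <= M4) (M4_1 : 1 <= M4)
  (M4_M3 : 48 * C * h * M3 <= M4).
Hypotheses (s1 : (0 < #|S0|)%N) (f01 : 0 < f <= 1) (g01 : 0 < g <= 1).
Let xi := sparsity_bound f.
Hypothesis f_compat : forall u, norm21 G (~: S0)%SET u <= 7 * norm21 G S0 u ->
  f * x * N u <= Q u * Num.sqrt s.
Hypothesis g_compat : forall u, #|group_supp G u|%:R <= xi + s ->
  g * x * N u <= Q u * Num.sqrt #|group_supp G u|%:R.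
Hypothesis small_bias : s * rL * K <= M3 * g ^+ 2 * f ^+ 2 * x.

(** The prediction rate up to its constant, with [f] for phi and [g] for psi_1. *)
Definition estimation_radius : R := Num.sqrt s * rL / (g * f).
Let rho := estimation_radius.

Let f0 : 0 < f. Proof. by case/andP: f01. Qed.
Let g0 : 0 < g. Proof. by case/andP: g01. Qed.
Let s0 : 0 < s. Proof. by rewrite ltr0n. Qed.
Let Lr1 : 1 <= Lr.
Proof.
have [l1 _ _ _ _] := log_thresholdP A40 thr; apply: le_trans l1 _.
exact: ln_le_log_rate.
Qed.

Lemma estimation_radius_gt0 : 0 < rho.
Proof.
apply: divr_gt0 (mulr_gt0 g0 f0); apply: mulr_gt0; last exact: rL_gt0.
by rewrite sqrtr_gt0 s0.
Qed.

Lemma sqr_estimation_radius : rho ^+ 2 = Lr * (s / (g ^+ 2 * f ^+ 2)).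
Proof.
rewrite /rho /estimation_radius expr_div_n exprMn sqr_rL// sqr_sqrtr ?(ltW s0)//.
by rewrite exprMn mulrAC mulrCA mulrC.
Qed.

Let sf : s <= s / f ^+ 2.
Proof.
have f0' := f0; rewrite ler_pdivlMr ?exprn_gt0// ler_piMr ?(ltW s0)//.
by case/andP: f01 => _ f1; rewrite expr_le1// ltW.
Qed.

Let xis : xi + s <= Cxi * (s / f ^+ 2).
Proof.
have A4' := A40; have sf' := sf; rewrite /xi /sparsity_bound /Cxi /sparsity_const.
move: (s / f ^+ 2) sf' => t st.
have : (4 * s + 100 * t) / A4 <= 104 * t / A4.
  by rewrite ler_wpM2r ?invr_ge0 ?(ltW A4')//; lra.
have -> : 104 * t / A4 = 104 / A4 * t by rewrite mulrAC.
move: (104 / A4) ((4 * s + 100 * t) / A4) => a b; lra.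
Qed.

(** [psi1] brings the root of the support size, and the sparsity bound replaces it by h sqrt s / f,
    which fits the definition of the radius. *)
Lemma group_norm_le u : #|group_supp G u|%:R <= xi + s ->
  x * rL * N u <= h * rho * Q u.
Proof.
move=> su; have := g_compat su; have := rL_gt0 Lr1 => r0.
have Q0 : 0 <= Q u by exact: norm2_ge0.
have C0 : 0 <= Cxi by apply: le_trans sparsity_const_ge2.
have : Num.sqrt #|group_supp G u|%:R <= h * (Num.sqrt s / f).
  have -> : Num.sqrt s / f = Num.sqrt (s / f ^+ 2).
    by rewrite sqrtrM ?(ltW s0)// sqrtrV ?sqr_ge0// sqrtr_sqr ger0_norm// ltW.
  by rewrite -sqrtrM// ler_wsqrtr// (le_trans su).
move=> /(ler_wpM2l Q0) h1 h2; have {h1 h2} h3 := le_trans h2 h1.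
have {}h3 : x * N u <= Q u * (h * (Num.sqrt s / f)) / g.
  by rewrite ler_pdivlMr ?g0// [leLHS]mulrC [leLHS]mulrA.
have := ler_wpM2l (ltW r0) h3; rewrite mulrCA mulrA => h4.
apply: (le_trans h4); rewrite le_eqVlt; apply/orP; left; apply/eqP.
rewrite /rho /estimation_radius; move: (Num.sqrt s) rL (Q u) h => a b c e.
by field; rewrite !gt_eqF ?f0 ?g0.
Qed.

(** A lower bound on the prediction error of the sparse members of [B] is converted by
    [curvature_estimation] into the drift required of them. *)
Lemma expected_posterior_separated_le (B : set 'cV[R]_d) : measurable B ->
  (forall b, B b -> #|group_supp G (b - b0)|%:R <= xi + s ->
    M4 * rho <= Q (b - b0)) ->
  (\int[P]_w posterior X (logit_prior X G pmf) (response_block Z w) B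
   <= (contraction_bound A4 (ln n%:R))%:E)%E.
Proof.
move=> mB sep; have r0 := rL_gt0 Lr1; have K0 := max_starnorm_ge0 X G.
have f2 : 0 < f ^+ 2 by rewrite exprn_gt0 ?f0.
have g2 : 0 < g ^+ 2 by rewrite exprn_gt0 ?g0.
have g21 : g ^+ 2 <= 1 by case/andP: g01 => ? ?; rewrite expr_le1// ltW ?g0.
have sg : s / f ^+ 2 <= s / (g ^+ 2 * f ^+ 2).
  by rewrite ler_wpM2l ?(ltW s0)// lef_pV2 ?posrE ?mulr_gt0// ler_piMl// ltW.
have sg0 : s <= s / (g ^+ 2 * f ^+ 2) := le_trans sf sg.
have C0 : 0 < Cxi by apply: lt_le_trans sparsity_const_ge2.
apply: (@expected_posterior_far_le _ _ _ _ _ X G GP _ _ Z P b0 m0 indep model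
  A1 A2 A3 A4 Cxi (s / f ^+ 2) (s / (g ^+ 2 * f ^+ 2)) xi pmf B) => //.
- by rewrite divr_ge0 ?(ltW s0) ?(ltW f2).
- by apply: le_trans sg0; rewrite ler1n.
- apply: le_trans (_ : Cxi * (s / f ^+ 2) <= _); last by rewrite ler_wpM2l// ltW.
  by apply: le_trans xis; rewrite lerDl ltW.
- move=> u /f_compat fu.
  have -> : Q u ^+ 2 * (s / f ^+ 2) = (Q u * Num.sqrt s / f) ^+ 2.
    by rewrite expr_div_n exprMn [Num.sqrt s ^+ 2]sqr_sqrtr ?(ltW s0)// mulrA.
  rewrite -exprMn lerXn2r ?nnegrE ?mulr_ge0 ?norm21_ge0 ?norm2_ge0 ?(ltW x0)
    ?invr_ge0 ?(ltW f0)//.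
  by rewrite ler_pdivlMr ?f0// [leLHS]mulrC [leLHS]mulrA.
- have : s / f ^+ 2 * K * rL <= M3 * x.
    have -> : s / f ^+ 2 * K * rL = s * rL * K / f ^+ 2 by ring.
    rewrite ler_pdivrMr//; apply: le_trans small_bias _.
    have -> : M3 * g ^+ 2 * f ^+ 2 * x = M3 * x * f ^+ 2 * g ^+ 2 by ring.
    exact: ler_piMr (mulr_ge0 (mulr_ge0 (ltW M30) (ltW x0)) (ltW f2)) g21.
  move=> /(ler_wpM2l (ler0n R 11088)) /le_trans; apply.
  by rewrite mulrA ler_piMl// ltW.
(* b - b0 is carried by the active groups of both vectors, which is why psi_1 is taken at xi0 +
   s0. *)
move=> b Bb bxi; have bxs : #|group_supp G (b - b0)|%:R <= xi + s.
  apply: le_trans (_ : (#|group_supp G b| + #|S0|)%:R <= _).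
    by rewrite ler_nat group_suppB.
  by rewrite natrD lerD2r.
rewrite -[(_ + A3) * Lr * _]mulrA -sqr_estimation_radius.
have h0 : 0 < h by rewrite sqrtr_gt0.
have C0' : 0 <= C := addr_ge0 (addr_ge0 (ler0n _ 4) (ltW C0)) (ltW A30).
have M3_h' : 672 * h ^+ 2 * M3 <= 1 by rewrite /h sqr_sqrtr ?(ltW C0).
have Krho : K * rho ^+ 2 <= M3 * (x * rL).
  rewrite sqr_estimation_radius mulrA.
  have -> : K * Lr * (s / (g ^+ 2 * f ^+ 2)) = s * rL * K * rL / (g ^+ 2 * f ^+ 2).
    by rewrite -[in LHS](sqr_rL Lr1); ring.
  rewrite ler_pdivrMr ?mulr_gt0//.
  have := ler_wpM2r (ltW r0) small_bias; move/le_trans; apply.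
  by rewrite le_eqVlt; apply/orP; left; apply/eqP; ring.
exact: (curvature_estimation x0 K0 r0 (norm21_ge0 G [set: 'I_p]%SET (b - b0))
  (norm2_ge0 _) (drift_ge X GP indep (b - b0)) h0 (ltW estimation_radius_gt0) C0'
  M30 (lt_le_trans ltr01 M4_1) M3_h' M4_h M4_C M4_1 M4_M3 (group_norm_le bxs)
  (sep _ Bb bxs) Krho).
Qed.

End positive.
End separated_sets.

(** * Test vectors for the compatibility numbers *)

Section signed_group_vectors.
Context {R : realType} {d p : nat} (G : 'I_p -> {set 'I_d}).
Hypothesis GP : group_partition G.

Lemma unit_group_vector (j : 'I_p) : exists u : 'cV[R]_d,
  norm2 (group_sub G u j) = 1 /\ forall k, k != j -> group_sub G u k = 0.
Proof.
case: (GP) => [/(_ j)/set0Pn[i ij] _ _]; exists (delta_mx i ord0).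
have off k : k != j -> group_sub G (delta_mx i ord0 : 'cV[R]_d) k = 0.
  move=> kj; apply/colP => l; rewrite !mxE andbT; case: eqP => // li.
  have := enum_valP l; rewrite li (group_ofP GP) => /eqP ki.
  by move: ij kj; rewrite (group_ofP GP) ki => ->.
split=> //; have h : norm2 (delta_mx i ord0 : 'cV[R]_d) ^+ 2 = 1.
  rewrite sqr_norm2 (bigD1 i)//= mxE !eqxx expr1n big1 ?addr0// => l li.
  by rewrite mxE (negbTE li) expr0n.
move: h; rewrite -dot_norm2 (dot_groups GP) (bigD1 j)//= big1 ?addr0; last first.
  by move=> k kj; rewrite off// /dot big1// => l _; rewrite mxE mul0r.
rewrite dot_norm2 => /eqP; rewrite sqrf_eq1 => /orP[/eqP//|/eqP h].
have := norm2_ge0 (group_sub G (delta_mx i ord0 : 'cV[R]_d) j).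
by rewrite h oppr_ge0 ler10.
Qed.

(** One unit vector per group, with signs chosen by [norm2_sign_sum] so that the images under A add
    up in square norm. *)
Lemma signed_group_vector (S : {set 'I_p}) k (A : 'M[R]_(k, d)) :
  exists b : 'cV[R]_d, [/\ group_supp G b = S,
    forall j, j \in S -> norm2 (group_sub G b j) = 1
    & norm2 (A *m b) <= starnorm G A * Num.sqrt #|S|%:R].
Proof.
have [u uP] := choice unit_group_vector.
have u1 j : norm2 (group_sub G (u j) j) = 1 := (uP j).1.
have uo j l : l != j -> group_sub G (u j) l = 0 := (uP j).2 l.
have [e e1 eA] := @norm2_sign_sum R k 'I_p (enum S) (fun j => A *m u j) (enum_uniq _).
pose b := \sum_(j <- enum S) e j *: u j; exists b.
have bE l : group_sub G b l = if l \in S then e l *: group_sub G (u l) l else 0.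
  have -> : group_sub G b l = \sum_(j <- enum S) e j *: group_sub G (u j) l.
    rewrite /b; elim/big_rec2: _ => [|j x y _ <-]; first exact: group_sub0.
    by rewrite group_subD group_subZ.
  case: ifPn => lS.
    rewrite big_enum_cond /= (bigD1 l) ?lS//= big1 ?addr0// => j /andP[_ jl].
    by rewrite uo ?scaler0// eq_sym.
  rewrite big_seq big1// => j; rewrite mem_enum => jS.
  by rewrite uo ?scaler0//; apply: contraNneq lS => ->.
have bS j : j \in S -> norm2 (group_sub G b j) = 1.
  by move=> jS; rewrite bE jS norm2Z e1 u1 mulr1.
split=> //.
  apply/setP => j; rewrite finset.inE; case: (boolP (j \in S)) => [/bS h|jS].
    by rewrite -norm2_eq0 h oner_neq0.
  by rewrite bE (negbTE jS) eqxx.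
rewrite -(@ler_pXn2r _ 2) ?nnegrE ?norm2_ge0 ?mulr_ge0 ?sqrtr_ge0 ?starnorm_ge0//.
have -> : A *m b = \sum_(j <- enum S) e j *: (A *m u j).
  by rewrite /b mulmx_sumr; apply: eq_bigr => j _; rewrite -scalemxAr.
apply: (le_trans eA); rewrite exprMn [Num.sqrt _ ^+ 2]sqr_sqrtr// mulrC.
rewrite mulr_natl -sumr_const -[leRHS]big_enum/=; apply: ler_sum => j _.
rewrite lerXn2r ?nnegrE ?norm2_ge0 ?starnorm_ge0//.
rewrite (le_trans (norm2_mulmx_starnorm GP _ _))// /norm21 (bigD1 j) ?finset.inE//=.
by rewrite u1 big1 ?addr0 ?mulr1// => l /andP[_ lj]; rewrite uo// norm2_0.
Qed.

Lemma norm21_unit (S : {set 'I_p}) (b : 'cV[R]_d) :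
  (forall j, j \in S -> norm2 (group_sub G b j) = 1) -> norm21 G S b = #|S|%:R.
Proof. by move=> bS; rewrite /norm21 (eq_bigr (fun=> 1)) ?sumr_const. Qed.

Lemma norm21_supp (b : 'cV[R]_d) :
  norm21 G [set: 'I_p]%SET b = norm21 G (group_supp G b) b.
Proof. by rewrite (norm21_setT _ (group_supp G b)) group_supp_subset0 ?addr0. Qed.

Lemma norm2_unit (b : 'cV[R]_d) :
  (forall j, j \in group_supp G b -> norm2 (group_sub G b j) = 1) ->
  norm2 b = Num.sqrt #|group_supp G b|%:R.
Proof.
move=> bS; rewrite -[LHS]ger0_norm ?norm2_ge0// -sqrtr_sqr -dot_norm2.
rewrite (dot_groups GP) (bigID (mem (group_supp G b)))/= [X in _ + X]big1 ?addr0.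
  rewrite (eq_bigr (fun=> 1)) ?sumr_const// => j jS.
  by rewrite dot_norm2 bS// expr1n.
move=> j; rewrite finset.inE negbK => /eqP ->.
by rewrite dot_norm2 norm2_0 expr0n.
Qed.

End signed_group_vectors.

Section compatibility_bounds.
Context {R : realType} {d p : nat} (G : 'I_p -> {set 'I_d}).
Hypothesis GP : group_partition G.
Context {k : nat} (W : 'M[R]_k) (X : 'M[R]_(k, d)).
Local Notation N := (norm21 G [set: 'I_p]%SET).
Local Notation Q u := (norm2 (sqrtmx W *m (X *m u))).
Local Notation x := (starnorm G X).

Lemma phi_ge0 S : (0 <= phi G W X S)%E.
Proof.
apply: le_ereal_inf_tmp => _ [b _ <-]; rewrite lee_fin.
by rewrite divr_ge0 ?mulr_ge0 ?norm2_ge0 ?sqrtr_ge0 ?starnorm_ge0 ?norm21_ge0.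
Qed.

Lemma psi1_ge0 s : (0 <= psi1 G W X s)%E.
Proof.
apply: le_ereal_inf_tmp => _ [b _ <-]; rewrite lee_fin.
by rewrite divr_ge0 ?mulr_ge0 ?norm2_ge0 ?sqrtr_ge0 ?starnorm_ge0 ?norm21_ge0.
Qed.

Lemma psi2_ge0 s : (0 <= psi2 G W X s)%E.
Proof.
apply: le_ereal_inf_tmp => _ [b _ <-]; rewrite lee_fin.
by rewrite divr_ge0 ?mulr_ge0 ?norm2_ge0 ?starnorm_ge0.
Qed.

Hypothesis W1 : forall u, norm2 (sqrtmx W *m u) <= norm2 u.
Hypothesis x0 : 0 < x.

(** The signed vector lies in the cone and has quotient at most x sqrt s sqrt s / (x s) = 1. Such
    bounds make the compatibility numbers finite. *)
Lemma phi_le1 (S : {set 'I_p}) : (0 < #|S|)%N -> (phi G W X S <= 1)%E.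
Proof.
move=> S0; have [b [bS b1 bX]] := signed_group_vector GP S X.
have s0 : 0 < #|S|%:R :> R by rewrite ltr0n.
apply: le_trans (ereal_inf_lbound _) _.
  exists b; last reflexivity; split=> /=.
    by rewrite group_supp_subset0 ?bS// mulr_ge0 ?norm21_ge0.
  have /card_gt0P[j jS] := S0; exists j => //.
  by rewrite -norm2_eq0 b1// oner_neq0.
rewrite lee_fin norm21_supp bS norm21_unit// ler_pdivrMr ?mulr_gt0// mul1r.
apply: le_trans (_ : x * Num.sqrt #|S|%:R * Num.sqrt #|S|%:R <= _).
  by rewrite ler_wpM2r ?sqrtr_ge0// (le_trans (W1 _)).
by rewrite -mulrA -expr2 [Num.sqrt _ ^+ 2]sqr_sqrtr// ltW.
Qed.

Lemma single_group_vector : (0 < p)%N -> exists b : 'cV[R]_d,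
  [/\ #|group_supp G b| = 1%N, N b = 1, norm2 b = 1 & Q b <= x].
Proof.
move=> p0; have [b [bS b1 bX]] := signed_group_vector GP [set Ordinal p0]%SET X.
have c1 : #|group_supp G b| = 1%N by rewrite bS cards1.
have b2 : norm2 b = 1 by rewrite (norm2_unit GP) ?bS// cards1 sqrtr1.
have bN : N b = 1 by rewrite norm21_supp bS norm21_unit// cards1.
exists b; split=> //; apply: le_trans (W1 _) _.
by move: bX; rewrite cards1 sqrtr1 mulr1.
Qed.

Lemma psi1_le1 s : (0 < p)%N -> (1 <= s)%E -> (psi1 G W X s <= 1)%E.
Proof.
move=> p0 s1; have [b [bs bN _ bQ]] := single_group_vector p0.
apply: le_trans (ereal_inf_lbound _) _.
  by exists b; last reflexivity; split=> /=; rewrite bs.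
by rewrite lee_fin bs bN sqrtr1 !mulr1 ler_pdivrMr// mul1r.
Qed.

Lemma psi2_le1 s : (0 < p)%N -> (1 <= s)%E -> (psi2 G W X s <= 1)%E.
Proof.
move=> p0 s1; have [b [bs _ b1 bQ]] := single_group_vector p0.
apply: le_trans (ereal_inf_lbound _) _.
  by exists b; last reflexivity; split=> /=; rewrite bs.
by rewrite lee_fin b1 !mulr1 ler_pdivrMr// mul1r.
Qed.

(** A nonzero u in the cone cannot vanish on all of S, so it takes part in the infimum; for u = 0
    the inequality is trivial. *)
Lemma phi_mul_le (S : {set 'I_p}) (f : R) u : (f%:E <= phi G W X S)%E ->
  norm21 G (~: S)%SET u <= 7 * norm21 G S u ->
  f * x * N u <= Q u * Num.sqrt #|S|%:R.
Proof.
move=> fphi cone; have [u0|u0] := eqVneq u 0.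
  by rewrite u0 !mulmx0 (eqP (etrans (norm21_eq0 GP 0) (eqxx 0))) norm2_0 mul0r mulr0.
have N0 : 0 < N u by rewrite lt_def norm21_ge0 andbT norm21_eq0.
rewrite -mulrA -ler_pdivlMr ?mulr_gt0// -lee_fin (le_trans fphi)//.
apply: ereal_inf_lbound; exists u => //; split=> //=.
apply/exists_inP; apply: contraT; rewrite negb_exists_in => /forall_inP h.
move: N0; rewrite (norm21_setT _ S).
have S0 : norm21 G S u = 0.
  by rewrite /norm21 big1// => j /h; rewrite negbK => /eqP ->; rewrite norm2_0.
by move: cone; rewrite S0 mulr0 add0r => /le_lt_trans h1 /h1; rewrite ltxx.
Qed.

Lemma psi1_mul_le (s : \bar R) (g : R) u : (g%:E <= psi1 G W X s)%E ->
  (#|group_supp G u|%:R%:E <= s)%E ->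
  g * x * N u <= Q u * Num.sqrt #|group_supp G u|%:R.
Proof.
move=> gpsi us; have [u0|u0] := eqVneq u 0.
  by rewrite u0 !mulmx0 (eqP (etrans (norm21_eq0 GP 0) (eqxx 0))) norm2_0 mul0r mulr0.
have N0 : 0 < N u by rewrite lt_def norm21_ge0 andbT norm21_eq0.
rewrite -mulrA -ler_pdivlMr ?mulr_gt0// -lee_fin (le_trans gpsi)//.
apply: ereal_inf_lbound; exists u => //; split=> //=.
by rewrite lt0n group_supp_eq0.
Qed.

Lemma psi2_mul_le (s : \bar R) (g : R) u : (g%:E <= psi2 G W X s)%E ->
  (#|group_supp G u|%:R%:E <= s)%E -> g * x * norm2 u <= Q u.
Proof.
move=> gpsi us; have [u0|u0] := eqVneq u 0.
  by rewrite u0 !mulmx0 !norm2_0 mulr0.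
have N0 : 0 < norm2 u by rewrite norm2_gt0.
rewrite -mulrA -ler_pdivlMr ?mulr_gt0// -lee_fin (le_trans gpsi)//.
apply: ereal_inf_lbound; exists u => //; split=> //=.
by rewrite lt0n group_supp_eq0.
Qed.

End compatibility_bounds.

(** * From the class of parameters to regular compatibility numbers *)

Section fixed_sample_size.
Context {R : realType} {m n d p : nat} (X : 'I_n -> 'M[R]_(m.-1, d)).
Variable G : 'I_p -> {set 'I_d}.
Hypothesis GP : group_partition G.
Context {disp : measure_display} {Om : measurableType disp}.
Variables (Z : 'I_n -> Om -> 'I_m) (P : 'cV[R]_d -> probability Om R) (b0 : 'cV[R]_d).
Hypothesis m0 : (0 < m)%N.
Hypothesis indep : independent_responses Z (P b0).
Hypothesis model : logit_model X Z (P b0) b0.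

Local Notation x := (starnorm G (stack X)).
Local Notation N := (norm21 G [set: 'I_p]%SET).
Local Notation S0 := (group_supp G b0).
Local Notation K := (\big[Num.max/0]_(i < n) starnorm G (X i)).
Local Notation Lr := (log_rate G n : R).
Local Notation rL := (Num.sqrt Lr).
Local Notation Q u := (norm2 (sqrtmx (response_cov Z (P b0)) *m (stack X *m u))).
Local Notation phi0 := (phi0 X G Z P b0).

Variables (A1 A2 A3 A4 : R) (pmf : nat -> {nonneg R}).
Hypotheses (A10 : 0 < A1) (A20 : 0 < A2) (A30 : 0 < A3) (A40 : 0 < A4).
Hypothesis X0 : stack X != 0.
Hypothesis thr : log_threshold A1 A2 A4 <= ln n%:R.
Hypothesis psum : \sum_(0 <= k < p.+1) (pmf k)%:num = 1.
Hypothesis ratio : forall s, (1 <= s <= p)%N ->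
  A1 / (maxn p (n ^ max_group G))%:R `^ A3
    <= (pmf s)%:num / (pmf s.-1)%:num
    <= A2 / (maxn p (n ^ max_group G))%:R `^ A4.

Local Notation psi10 := (psi10 X G Z P A4 b0).
Local Notation psi20 := (psi20 X G Z P A4 b0).
Local Notation xi0 := (xi0 X G Z P A4 b0).
Local Notation s := (#|S0|%:R : R).

Let x0 : 0 < x. Proof. exact: starnorm_gt0. Qed.

Let p0 : (0 < p)%N.
Proof.
rewrite lt0n; apply: contraTneq x0 => p0'; rewrite -leNgt starnorm_le// => j.
by have := ltn_ord j; rewrite [X in (_ < X)%N]p0'.
Qed.

Let Lr1 : 1 <= Lr.
Proof.
have [l1 _ _ _ _] := log_thresholdP A40 thr; apply: le_trans l1 _.
exact: ln_le_log_rate.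
Qed.

Lemma max_starnorm_gt0 : 0 < K.
Proof.
have /existsP[i Xi] : [exists i, X i != 0].
  apply: contraNT X0; rewrite negb_exists => /forallP X0'.
  apply/eqP/matrixP => t j; rewrite mxE [RHS]mxE.
  by have := X0' (tagnat.sig1 t); rewrite negbK => /eqP ->; rewrite mxE.
by rewrite (bigmaxD1 i)//= lt_max starnorm_gt0.
Qed.

Lemma xi0_ge0 : (0 <= xi0)%E.
Proof.
apply: adde_ge0; first by rewrite lee_fin.
apply: mule_ge0; last by rewrite lee_fin.
apply: mule_ge0; first by rewrite lee_fin invr_ge0 ltW.
apply: adde_ge0; first by rewrite lee_fin ler0n.
by apply: mule_ge0; rewrite ?lee_fin ?ler0n// inve_ge0 expe_ge0// phi_ge0.
Qed.

(** The left side of the inequality defining the class is positive when s0 > 0, since the design is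
    nonzero; hence neither [phi0] nor [psi10] vanishes, and both are reals in ]0, 1]. *)
Lemma calB2_regular (M : R) : calB2 X G Z P A4 M b0 -> (0 < #|S0|)%N ->
  exists f g : R, [/\ 0 < f <= 1, 0 < g <= 1, phi0 = f%:E & psi10 = g%:E] /\
    ((xi0 + s%:E)%E = (sparsity_bound G b0 A4 f + s)%:E
     /\ s * rL * K <= M * g ^+ 2 * f ^+ 2 * x).
Proof.
move=> B2 s1; have s0 : 0 < s by rewrite ltr0n.
have phi_0 : (0 <= phi0)%E by exact: phi_ge0.
have phi_1 : (phi0 <= 1)%E by apply: phi_le1 => //; exact: norm2_sqrt_cov_le.
have psi_0 : (0 <= psi10)%E by exact: psi1_ge0.
have psi_1 : (psi10 <= 1)%E.
  apply: psi1_le1 => //; first exact: norm2_sqrt_cov_le.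
  apply: (@le_trans _ _ s%:E); first by rewrite lee_fin ler1n.
  by rewrite leeDr// xi0_ge0.
have fE : phi0 = (fine phi0)%:E.
  by rewrite fineK// ge0_fin_numE// (le_lt_trans phi_1)// ltry.
have gE : psi10 = (fine psi10)%:E.
  by rewrite fineK// ge0_fin_numE// (le_lt_trans psi_1)// ltry.
move: (fine phi0) (fine psi10) fE gE => f g fE gE.
move: phi_0 phi_1 psi_0 psi_1; rewrite fE gE !lee_fin => f_0 f_1 g_0 g_1.
have small : s * rL * K <= M * g ^+ 2 * f ^+ 2 * x.
  by move: B2; rewrite /calB2 /mkset fE gE !expe2 -!EFinM lee_fin -!expr2.
have pos : 0 < M * g ^+ 2 * f ^+ 2 * x.
  by apply: lt_le_trans small; rewrite !mulr_gt0 ?rL_gt0// max_starnorm_gt0.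
have f0 : f != 0 by apply: contraTneq pos => ->; rewrite expr0n mulr0 mul0r ltxx.
have g0 : g != 0 by apply: contraTneq pos => ->; rewrite expr0n mulr0 !mul0r ltxx.
exists f, g; split; first by split=> //; rewrite lt_def ?f0 ?g0 ?f_0 ?g_0.
split=> //; rewrite /Defs.xi0 fE -EFin_expe inver sqrf_eq0 (negbTE f0).
rewrite -!EFinM -!EFinD; congr (_%:E).
rewrite /sparsity_bound /Defs.s0; move: (f ^+ 2)^-1 A4^-1 => a c; ring.
Qed.

(** Small enough at once for the cone inequality, 11088, and for the far regime, 672 h^2 with h^2
    the sparsity constant. *)
Definition bias_const : R := (11088 + 672 * sparsity_const A4)^-1.

Definition separation_const : R :=
  let h := Num.sqrt (sparsity_const A4) in let C := 4 + sparsity_const A4 + A3 in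
  84 * h + 6 * C + 1 + 48 * C * h * bias_const.

(** The factor h >= 1 pays for the comparison of the (2,1)-norm with the prediction error; the other
    two errors only need [separation_const]. *)
Definition radius_const : R := Num.sqrt (sparsity_const A4) * separation_const.

Lemma bias_const_gt0 : 0 < bias_const.
Proof.
rewrite invr_gt0; apply: ltr_pwDl; first by rewrite ltr0n.
apply: mulr_ge0; first by rewrite ler0n.
by apply: le_trans (sparsity_const_ge2 A40); rewrite ler0n.
Qed.

Lemma bias_constP : 11088 * bias_const <= 1 /\ 672 * sparsity_const A4 * bias_const <= 1.
Proof.
have := bias_const_gt0; rewrite /bias_const invr_gt0 => c0.
have a0 : 0 <= 11088 :> R by rewrite ler0n.
have b0' : 0 <= 672 * sparsity_const A4.
  apply: mulr_ge0; first by rewrite ler0n.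
  by apply: le_trans (sparsity_const_ge2 A40); rewrite ler0n.
by split; rewrite ler_pdivrMr// mul1r ?lerDl ?lerDr.
Qed.

Lemma separation_constP :
  let h := Num.sqrt (sparsity_const A4) in let C := 4 + sparsity_const A4 + A3 in
  [/\ 84 * h <= separation_const, 6 * C <= separation_const, 1 <= separation_const
    & 48 * C * h * bias_const <= separation_const].
Proof.
rewrite /separation_const; set h := Num.sqrt _; set C := 4 + _ + A3.
have h0 : 0 <= 84 * h by rewrite mulr_ge0 ?ler0n ?sqrtr_ge0.
have C0 : 0 <= C.
  apply: addr_ge0; last exact: ltW.
  apply: addr_ge0; first by rewrite ler0n.
  by apply: le_trans (sparsity_const_ge2 A40); rewrite ler0n.
have C6 : 0 <= 6 * C by rewrite mulr_ge0 ?ler0n.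
have b_0 := ltW bias_const_gt0.
have Ch : 0 <= 48 * C * h * bias_const.
  by rewrite !mulr_ge0 ?ler0n ?sqrtr_ge0.
move: (84 * h) (6 * C) (48 * C * h * bias_const) h0 C6 Ch => a b c a0 b_0' c0.
by split; lra.
Qed.

Hypothesis B2 : calB2 X G Z P A4 bias_const b0.

(** Common reduction of the three errors: it remains to show that a sparse b in the event has
    prediction error at least a multiple of the radius, with the comparison of norms at hand. *)
Lemma expected_posterior_calB2_le (B : set 'cV[R]_d) :
  measurable B -> ~ B b0 ->
  (forall f g : R, (0 < #|S0|)%N -> 0 < f <= 1 -> 0 < g <= 1 ->
    phi0 = f%:E -> psi10 = g%:E ->
    forall b, B b -> (#|group_supp G (b - b0)|%:R%:E <= xi0 + s%:E)%E ->
      x * rL * N (b - b0) <= Num.sqrt (sparsity_const A4)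
        * estimation_radius (n := n) G b0 f g * Q (b - b0) ->
      separation_const * estimation_radius (n := n) G b0 f g <= Q (b - b0)) ->
  (\int[P b0]_w posterior X (logit_prior X G pmf) (response_block Z w) B
   <= (contraction_bound A4 (ln n%:R))%:E)%E.
Proof.
move=> mB Bb0 sep.
have psum' : \sum_(k < p.+1) (pmf k)%:num = 1 by rewrite -psum big_mkord.
have [s0|s0] := posnP #|S0|.
  exact: (expected_posterior_null_le GP m0 indep model A10 A20 A30 A40 x0 thr
    psum' ratio).
have [f [g [[f01 g01 fE gE] [xiE small]]]] := calB2_regular B2 s0.
have [M3_1 M3_2] := bias_constP; have [M4_1 M4_2 M4_3 M4_4] := separation_constP.
have f_compat u : norm21 G (~: S0)%SET u <= 7 * norm21 G S0 u ->
    f * x * N u <= Q u * Num.sqrt s.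
  by apply: phi_mul_le => //; rewrite -fE.
have g_compat u : #|group_supp G u|%:R <= sparsity_bound G b0 A4 f + s ->
    g * x * N u <= Q u * Num.sqrt #|group_supp G u|%:R.
  rewrite -lee_fin -xiE => us; apply: psi1_mul_le us => //; by rewrite -gE.
apply: (expected_posterior_separated_le GP m0 indep model A10 A20 A30 A40 x0 p0 thr
  psum' ratio bias_const_gt0 M3_1 M3_2 M4_1 M4_2 M4_3 M4_4 s0 f01 g01
  f_compat g_compat small mB).
move=> b Bb us; apply: (sep f g) => //; first by rewrite xiE lee_fin.
exact: (group_norm_le GP A40 p0 thr s0 f01 g01 g_compat).
Qed.

End fixed_sample_size.

Section measurable_norms.
Context {R : realType} {d p : nat} (G : 'I_p -> {set 'I_d}) (c : 'cV[R]_d).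

Lemma measurable_translation i : measurable_fun setT (fun b : 'cV[R]_d => (b - c) i ord0).
Proof.
rewrite (_ : (fun _ => _) = fun b : 'cV[R]_d => b i ord0 - c i ord0); last first.
  by apply/funext => b; rewrite !mxE.
by apply: measurable_funB => //; exact: measurable_coord.
Qed.

Lemma measurable_norm2_translation :
  measurable_fun setT (fun b : 'cV[R]_d => norm2 (b - c)).
Proof.
apply: measurableT_comp; first exact: measurable_norm2.
by apply: measurable_fun_vecP => i; exact: measurable_translation.
Qed.

Lemma measurable_norm2_mulmx k (A : 'M[R]_(k, d)) :
  measurable_fun setT (fun b : 'cV[R]_d => norm2 (A *m (b - c))).
Proof.
apply: measurableT_comp; first exact: measurable_norm2.
apply: measurable_fun_vecP => i; under eq_fun do rewrite [(_ *m _) _ _]mxE.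
apply: measurable_sum => j; apply: measurable_funM => //.
exact: measurable_translation.
Qed.

Lemma measurable_norm21_translation (S : {set 'I_p}) :
  measurable_fun setT (fun b : 'cV[R]_d => norm21 G S (b - c)).
Proof.
rewrite (_ : (fun _ => _) = fun b : 'cV[R]_d =>
    \sum_j if j \in S then norm2 (group_sub G (b - c) j) else 0); last first.
  by apply/funext => b; exact: big_mkcond.
apply: measurable_sum => j; case: (j \in S); last exact: measurable_cst.
apply: measurableT_comp; first exact: measurable_norm2.
apply: measurable_fun_vecP => i; under eq_fun do rewrite [group_sub _ _ _ _ _]mxE.
exact: measurable_translation.
Qed.

Lemma measurable_superlevel (f : 'cV[R]_d -> R) (y : \bar R) :
  measurable_fun setT f -> measurable [set b | (y < (f b)%:E)%E].
Proof.
move=> mf; rewrite -[X in measurable X]setTI; apply: emeasurable_fun_o_infty => //.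
exact/measurable_EFinP.
Qed.

End measurable_norms.

Section estimation_errors.
Context {R : realType} {m n d p : nat} (X : 'I_n -> 'M[R]_(m.-1, d)).
Variable G : 'I_p -> {set 'I_d}.
Hypothesis GP : group_partition G.
Context {disp : measure_display} {Om : measurableType disp}.
Variables (Z : 'I_n -> Om -> 'I_m) (P : 'cV[R]_d -> probability Om R) (b0 : 'cV[R]_d).
Hypothesis m0 : (0 < m)%N.
Hypothesis indep : independent_responses Z (P b0).
Hypothesis model : logit_model X Z (P b0) b0.

Local Notation x := (starnorm G (stack X)).
Local Notation N := (norm21 G [set: 'I_p]%SET).
Local Notation S0 := (group_supp G b0).
Local Notation Lr := (log_rate G n : R).
Local Notation rL := (Num.sqrt Lr).
Local Notation Q u := (norm2 (sqrtmx (response_cov Z (P b0)) *m (stack X *m u))).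
Local Notation phi0 := (phi0 X G Z P b0).

Variables (A1 A2 A3 A4 : R) (pmf : nat -> {nonneg R}).
Hypotheses (A10 : 0 < A1) (A20 : 0 < A2) (A30 : 0 < A3) (A40 : 0 < A4).
Hypothesis X0 : stack X != 0.
Hypothesis thr : log_threshold A1 A2 A4 <= ln n%:R.
Hypothesis psum : \sum_(0 <= k < p.+1) (pmf k)%:num = 1.
Hypothesis ratio : forall s, (1 <= s <= p)%N ->
  A1 / (maxn p (n ^ max_group G))%:R `^ A3
    <= (pmf s)%:num / (pmf s.-1)%:num
    <= A2 / (maxn p (n ^ max_group G))%:R `^ A4.
Hypothesis B2 : calB2 X G Z P A4 (bias_const A4) b0.

Local Notation psi10 := (psi10 X G Z P A4 b0).
Local Notation psi20 := (psi20 X G Z P A4 b0).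
Local Notation s := (#|S0|%:R : R).
Local Notation rho := (estimation_radius (n := n) G b0).
Local Notation h := (Num.sqrt (sparsity_const A4)).
Local Notation M := (radius_const A3 A4).
Local Notation c := (separation_const A3 A4).

Let x0 : 0 < x. Proof. exact: starnorm_gt0. Qed.

Let p0 : (0 < p)%N.
Proof.
rewrite lt0n; apply: contraTneq x0 => p0'; rewrite -leNgt starnorm_le// => j.
by have := ltn_ord j; rewrite [X in (_ < X)%N]p0'.
Qed.

Let Lr1 : 1 <= Lr.
Proof.
have [l1 _ _ _ _] := log_thresholdP A40 thr; apply: le_trans l1 _.
exact: ln_le_log_rate.
Qed.

Let c0 : 0 < c.
Proof. by have [_ _ h1 _] := separation_constP A30 A40; exact: lt_le_trans h1. Qed.

Let h1 : 1 <= h.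
Proof.
rewrite -sqrtr1 ler_wsqrtr//; apply: le_trans (sparsity_const_ge2 A40).
by rewrite ler1n.
Qed.

Lemma radius_const_gt0 : 0 < M.
Proof. by rewrite mulr_gt0// (lt_le_trans _ h1). Qed.

Let M_ge0 : 0 <= M := ltW radius_const_gt0.

Let bound_ge0 (a : R) (y : \bar R) : 0 <= a -> (0 <= y)%E ->
  (0 <= M%:E * a%:E / y)%E.
Proof.
move=> a0 y0; apply: mule_ge0; last by rewrite inve_ge0.
by apply: mule_ge0; rewrite lee_fin; [exact: M_ge0|].
Qed.

Let sqrt_rate : Num.sqrt (s * Lr) = Num.sqrt s * rL.
Proof. by rewrite sqrtrM. Qed.

Let psi_0 : (0 <= psi10)%E. Proof. exact: psi1_ge0. Qed.
Let phi_0 : (0 <= phi0)%E. Proof. exact: phi_ge0. Qed.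

Let x_0 : (0 <= x%:E)%E. Proof. by rewrite lee_fin ltW. Qed.

Lemma prediction_error_le :
  (\int[P b0]_w posterior X (logit_prior X G pmf) (response_block Z w)
     [set b | M%:E * (Num.sqrt (s * Lr))%:E / (psi10 * phi0) < (Q (b - b0))%:E]
   <= (contraction_bound A4 (ln n%:R))%:E)%E.
Proof.
apply: (expected_posterior_calB2_le GP m0 indep model A10 A20 A30 A40 X0 thr
  psum ratio B2).
- apply: (measurable_superlevel (f := fun b => Q (b - b0))).
  under eq_fun do rewrite mulmxA; exact: (measurable_norm2_mulmx b0).
- rewrite /= subrr !mulmx0 norm2_0; apply/negP; rewrite -leNgt.
  by apply: bound_ge0; [exact: sqrtr_ge0|exact: mule_ge0 psi_0 phi_0].
move=> f g s0 /andP[f0 f1] /andP[g0 g1] fE gE b /=; rewrite fE gE => Bb _ _.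
apply: le_trans (_ : M * rho f g <= _).
  rewrite ler_wpM2r ?ler_peMl ?(ltW c0)//.
  by rewrite divr_ge0 ?mulr_ge0 ?sqrtr_ge0 ?(ltW f0) ?(ltW g0).
move: Bb; rewrite -!EFinM inver mulf_eq0 !gt_eqF//= -EFinM lte_fin sqrt_rate.
by move=> /ltW; rewrite -mulrA.
Qed.

Lemma euclidean_error_le :
  (\int[P b0]_w posterior X (logit_prior X G pmf) (response_block Z w)
     [set b | M%:E * (Num.sqrt (s * Lr))%:E / (psi10 * psi20 * phi0 * x%:E)
              < (norm2 (b - b0))%:E]
   <= (contraction_bound A4 (ln n%:R))%:E)%E.
Proof.
have psi2_0 : (0 <= psi20)%E by exact: psi2_ge0.
apply: (expected_posterior_calB2_le GP m0 indep model A10 A20 A30 A40 X0 thr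
  psum ratio B2).
- exact: (measurable_superlevel _ (measurable_norm2_translation b0)).
- rewrite /= subrr norm2_0; apply/negP; rewrite -leNgt.
  apply: bound_ge0; first exact: sqrtr_ge0.
  exact: mule_ge0 (mule_ge0 (mule_ge0 psi_0 psi2_0) phi_0) x_0.
move=> f g s0 /andP[f0 f1] /andP[g0 g1] fE gE b /=; rewrite fE gE => Bb us _.
have s00 : 0 < s by rewrite ltr0n.
have psi2_1 : (psi20 <= 1)%E.
  apply: psi2_le1 => //; first exact: norm2_sqrt_cov_le.
  apply: (@le_trans _ _ s%:E); first by rewrite lee_fin ler1n.
  by rewrite leeDr// xi0_ge0.
have kE : psi20 = (fine psi20)%:E.
  by rewrite fineK// ge0_fin_numE// (le_lt_trans psi2_1)// ltry.
move: (fine psi20) kE => k kE.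
have k0 : 0 <= k by rewrite -lee_fin -kE.
have ku : k * x * norm2 (b - b0) <= Q (b - b0).
  by apply: psi2_mul_le us => //; rewrite -kE.
move: Bb; rewrite kE -!EFinM inver.
(* psi_2 may vanish; the radius is then +oo and the event empty. *)
have [->|kn0] := eqVneq k 0.
  rewrite mulr0 !mul0r eqxx gt0_muley ?lte_fin; first by rewrite ltNge leey.
  by rewrite mulr_gt0 ?radius_const_gt0// sqrtr_gt0 mulr_gt0// (lt_le_trans _ Lr1).
have kp : 0 < k by rewrite lt_def kn0.
rewrite !mulf_eq0 !gt_eqF//= -EFinM lte_fin sqrt_rate => Bb.
apply: le_trans (_ : M * rho f g <= _).
  rewrite ler_wpM2r ?ler_peMl ?(ltW c0)//.
  by rewrite divr_ge0 ?mulr_ge0 ?sqrtr_ge0 ?(ltW f0) ?(ltW g0).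
apply: le_trans ku; have kx : 0 < k * x by rewrite mulr_gt0.
have := ltW Bb; rewrite -(ler_pM2l kx); apply: le_trans.
rewrite le_eqVlt; apply/orP; left; apply/eqP; rewrite /rho /estimation_radius.
by move: (Num.sqrt s) rL M => a b' c'; field; rewrite !gt_eqF.
Qed.

Lemma group_error_le :
  (\int[P b0]_w posterior X (logit_prior X G pmf) (response_block Z w)
     [set b | M%:E * (s * rL)%:E / (psi10 ^+ 2 * phi0 ^+ 2 * x%:E)
              < (N (b - b0))%:E]
   <= (contraction_bound A4 (ln n%:R))%:E)%E.
Proof.
apply: (expected_posterior_calB2_le GP m0 indep model A10 A20 A30 A40 X0 thr
  psum ratio B2).
- exact: (measurable_superlevel _ (measurable_norm21_translation G b0 _)).
- rewrite /= subrr; apply/negP; rewrite -leNgt.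
  have -> : N (0 : 'cV[R]_d) = 0 by apply/eqP; rewrite norm21_eq0.
  apply: bound_ge0; first by rewrite mulr_ge0 ?sqrtr_ge0.
  exact: mule_ge0 (mule_ge0 (mule_ge0 psi_0 psi_0) (mule_ge0 phi_0 phi_0)) x_0.
move=> f g s0 f01 g01 fE gE b /=; have /andP[f0 f1] := f01; have /andP[g0 g1] := g01.
rewrite fE gE -!EFinM -!expr2 inver !mulf_eq0 !gt_eqF//= -EFinM lte_fin.
move=> /ltW Bb _ Nb; have r0 := rL_gt0 Lr1.
have rho0 := estimation_radius_gt0 GP A40 p0 thr s0 f01 g01.
have rhoE := sqr_estimation_radius GP A40 p0 thr f g s0.
have xr0 : 0 < x * rL by rewrite mulr_gt0.
have hp : 0 < h * rho f g by rewrite mulr_gt0// (lt_le_trans _ h1).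
(* The event bounds the (2,1)-norm from below, while [Nb] bounds it from above by h rho Q;
   cancelling h rho gives the separation. *)
rewrite -(ler_pM2l hp); apply: le_trans Nb.
have := Bb; rewrite -(ler_pM2l xr0); apply: le_trans.
have -> : h * rho f g * (c * rho f g) = M * rho f g ^+ 2.
  by rewrite /M /radius_const; ring.
rewrite rhoE le_eqVlt; apply/orP; left; apply/eqP.
rewrite -{1}(sqr_rL Lr1); move: s rL M => a b' c'; field; by rewrite !gt_eqF.
Qed.

End estimation_errors.

(** * Limits *)

Section limits.
Context {R : realType}.

Lemma cvgn_ln : ln (n%:R : R) @[n --> \oo] --> +oo.
Proof.
apply/cvgryPge => A; near=> n.
rewrite -[leLHS]expRK ler_ln ?posrE ?expR_gt0//; last first.
  by rewrite ltr0n; near: n; exact: nbhs_infty_gt.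
by near: n; exact: nbhs_infty_ger.
Unshelve. all: by end_near. Qed.

Lemma cvgn_expRN_ln (c : R) : 0 < c -> expR (- (c * ln n%:R)) @[n --> \oo] --> (0 : R).
Proof.
move=> c0; apply: (cvg_comp (fun n : nat => c * ln (n%:R : R)) (fun z => expR (- z))
  _ (@cvgr_expR R)).
apply/cvgryPge => A; near=> n; rewrite -ler_pdivrMl//.
by near: n; move/cvgryPge : cvgn_ln; exact.
Unshelve. all: by end_near. Qed.

Lemma cvgn_contraction_bound (A4 : R) : 0 < A4 ->
  contraction_bound A4 (ln n%:R) @[n --> \oo] --> (0 : R).
Proof.
move=> A40; rewrite /contraction_bound.
have h1 : expR (- (ln n%:R / 4)) @[n --> \oo] --> (0 : R).
  under eq_fun do rewrite mulrC; exact: cvgn_expRN_ln.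
have h2 : expR (- ln n%:R) @[n --> \oo] --> (0 : R).
  under eq_fun do rewrite -[X in - X]mul1r; exact: cvgn_expRN_ln.
have h3 : expR (- (A4 / 200 * ln n%:R)) @[n --> \oo] --> (0 : R).
  exact: cvgn_expRN_ln (divr_gt0 A40 (ltr0n _ 200)).
rewrite -[X in _ --> X](_ : 0 + 2 * 0 + 2 * 0 = 0); last by rewrite !mulr0 !addr0.
by apply: cvgD; [apply: cvgD => //|]; apply: cvgM => //; exact: cvg_cst.
Qed.

(** The bound is the same for all parameters of the class. Nonemptiness of the class keeps the
    supremum from being -oo. *)
Lemma cvgn_ereal_sup (A1 A2 A4 : R) (T : nat -> Type) (D : forall n, set (T n))
    (F : forall n, T n -> \bar R) : 0 < A4 ->
  (forall n, (0 < n)%N -> exists t, D n t) -> (forall n t, (0 <= F n t)%E) ->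
  (forall n t, (0 < n)%N -> log_threshold A1 A2 A4 <= ln n%:R -> D n t ->
    (F n t <= (contraction_bound A4 (ln n%:R))%:E)%E) ->
  ereal_sup [set F n t | t in D n] @[n --> \oo] --> 0%E.
Proof.
move=> A40 D0 F0 FD.
apply: (@squeeze_cvge _ _ _ _ (fun=> 0%E) _ (fun n => (contraction_bound A4 (ln n%:R))%:E)).
- near=> n; have n0 : (0 < n)%N by near: n; exact: nbhs_infty_gt.
  apply/andP; split.
    have [t Dt] := D0 n n0; apply: le_trans (F0 n t) _.
    by apply: ereal_sup_ubound; exists t.
  apply: ge_ereal_sup => _ [t Dt <-]; apply: FD => //.
  by near: n; move/cvgryPge : cvgn_ln; exact.
- exact: cvg_cst.
- by apply: cvg_EFin; [exact: nearW|exact: cvgn_contraction_bound].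
Unshelve. all: by end_near. Qed.

End limits.
Theorem theorem2 (R : realType) (m : nat) (A1 A2 A3 A4 : R)
    (d p : nat -> nat)
    (G : forall n, 'I_(p n) -> {set 'I_(d n)})
    (X : forall n, 'I_n -> 'M[R]_(m.-1, d n))
    (pmf : nat -> nat -> {nonneg R})
    (disp : nat -> measure_display)
    (Om : forall n, measurableType (disp n))
    (Z : forall n, 'I_n -> Om n -> 'I_m)
    (P : forall n, 'cV[R]_(d n) -> probability (Om n) R) :
  (2 <= m)%N ->
  0 < A1 -> 0 < A2 -> 0 < A3 -> 0 < A4 ->
  (forall n, (0 < n)%N -> group_partition (G n)) ->
  (forall n, (0 < n)%N -> stack (X n) != 0) ->
  (forall n, (0 < n)%N -> \sum_(0 <= s < (p n).+1) (pmf n s)%:num = 1) ->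
  (forall n s, (0 < n)%N -> (1 <= s <= p n)%N ->
     A1 / (maxn (p n) (n ^ max_group (G n)))%:R `^ A3
       <= (pmf n s)%:num / (pmf n s.-1)%:num
       <= A2 / (maxn (p n) (n ^ max_group (G n)))%:R `^ A4) ->
  (forall n b, (0 < n)%N -> independent_responses (Z n) (P n b)) ->
  (forall n b, (0 < n)%N -> logit_model (X n) (Z n) (P n b) b) ->
  exists M3 M4 : R, [/\ 0 < M3, 0 < M4,
    ereal_sup [set \int[P n b0]_w
        posterior (X n) (logit_prior (X n) (G n) (pmf n))
          (response_block (Z n) w)
          [set b | M4%:E * (Num.sqrt ((s0 (G n) b0)%:R * log_rate (G n) n))%:E
                   / (psi10 (X n) (G n) (Z n) (P n) A4 b0
                      * phi0 (X n) (G n) (Z n) (P n) b0)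
                   < (norm2 (sqrtmx (response_cov (Z n) (P n b0))
                             *m (stack (X n) *m (b - b0))))%:E]
      | b0 in calB2 (X n) (G n) (Z n) (P n) A4 M3]%E
      @[n --> \oo] --> 0%E,
    ereal_sup [set \int[P n b0]_w
        posterior (X n) (logit_prior (X n) (G n) (pmf n))
          (response_block (Z n) w)
          [set b | M4%:E * (Num.sqrt ((s0 (G n) b0)%:R * log_rate (G n) n))%:E
                   / (psi10 (X n) (G n) (Z n) (P n) A4 b0
                      * psi20 (X n) (G n) (Z n) (P n) A4 b0
                      * phi0 (X n) (G n) (Z n) (P n) b0
                      * (starnorm (G n) (stack (X n)))%:E)
                   < (norm2 (b - b0))%:E]
      | b0 in calB2 (X n) (G n) (Z n) (P n) A4 M3]%E
      @[n --> \oo] --> 0%E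
  & ereal_sup [set \int[P n b0]_w
        posterior (X n) (logit_prior (X n) (G n) (pmf n))
          (response_block (Z n) w)
          [set b | M4%:E * ((s0 (G n) b0)%:R * Num.sqrt (log_rate (G n) n))%:E
                   / (psi10 (X n) (G n) (Z n) (P n) A4 b0 ^+ 2
                      * phi0 (X n) (G n) (Z n) (P n) b0 ^+ 2
                      * (starnorm (G n) (stack (X n)))%:E)
                   < (norm21 (G n) [set: 'I_(p n)]%SET (b - b0))%:E]
      | b0 in calB2 (X n) (G n) (Z n) (P n) A4 M3]%E
      @[n --> \oo] --> 0%E].
Proof.
move=> m2 A10 A20 A30 A40 GP X0 psum ratio indep model.
have m0 : (0 < m)%N by exact: leq_trans m2.
(* The zero parameter belongs to the class, as s0 = 0 makes the left side of its inequality
   vanish. *)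
have B0 n : (0 < n)%N ->
    exists t, calB2 (X n) (G n) (Z n) (P n) A4 (bias_const A4) t.
  move=> n0; exists 0; rewrite /calB2 /mkset /s0.
  have -> : #|group_supp (G n) (0 : 'cV[R]_(d n))| = 0%N.
    by apply/eqP; rewrite group_supp_eq0//; exact: GP.
  rewrite !mul0r; apply: mule_ge0; last by rewrite lee_fin starnorm_ge0.
  by rewrite !mule_ge0 ?expe_ge0 ?psi1_ge0 ?phi_ge0// lee_fin ltW// bias_const_gt0.
exists (bias_const A4), (radius_const A3 A4).
have M0 := radius_const_gt0 A30 A40.
split; [exact: bias_const_gt0|exact: M0| | |];
  apply: (cvgn_ereal_sup (A1 := A1) (A2 := A2) A40 B0) => [n t|n t n0 thr Bt].
- by apply: integral_ge0 => w _; exact: posterior_ge0.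
- exact: (prediction_error_le (GP n n0) m0 (indep n t n0) (model n t n0) A10 A20 A30 A40
    (X0 n n0) thr (psum n n0) (fun s => ratio n s n0) Bt).
- by apply: integral_ge0 => w _; exact: posterior_ge0.
- exact: (euclidean_error_le (GP n n0) m0 (indep n t n0) (model n t n0) A10 A20 A30 A40
    (X0 n n0) thr (psum n n0) (fun s => ratio n s n0) Bt).
- by apply: integral_ge0 => w _; exact: posterior_ge0.
- exact: (group_error_le (GP n n0) m0 (indep n t n0) (model n t n0) A10 A20 A30 A40
    (X0 n n0) thr (psum n n0) (fun s => ratio n s n0) Bt).
Qed.
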